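(* Let $\frac32<p<\infty$ and let $A=(a_1,a_2,a_3,a_4)\in (L_\infty(G;\mathbb{H}_{\mathbb{C}}))^4$. (i) If $p<3$, then $\mathfrak{V}_A^p(G;\mathbb{H}_{\mathbb{C}})\subset C_{bloc}^{0,1-\frac3r}(G;\mathbb{H}_{\mathbb{C}})$ for all $3<r<p^*$, where $p^*=\frac{3p}{3-p}$. (ii) If $p\geqslant 3$, then $\mathfrak{V}_A^p(G;\mathbb{H}_{\mathbb{C}})\subset C_{bloc}^{0,1-\frac3r}(G;\mathbb{H}_{\mathbb{C}})$ for all real $r>3$.
   Context: Biquaternions: $\mathbb{H}_{\mathbb{C}}$ is the complex algebra of elements $p=p_0+\vec p$, $\vec p=\sum_{k=1}^3 p_ke_k$, $p_0,\dots,p_3\in\mathbb{C}$ (with $e_0=1$), with product $pq=p_0q_0+p_0\vec q+q_0\vec p-\vec p\cdot\vec q+\vec p\times\vec q$ (bilinear dot and cross products on $\mathbb{C}^3$, so $e_k^2=-1$ for $k=1,2,3$). Quaternionic conjugate: $\overline{p}=p_0-\vec p$. Norm: $|p|_{\mathbb{H}_{\mathbb{C}}}=(\sum_{k=0}^3|p_k|^2)^{1/2}$. Domain: $G\subset\mathbb{R}^3$ is a bounded domain whose boundary $\Gamma$ is a Liapunov surface (in particular a $C^1$ surface with Hölder continuous unit normal), with $\mathbb{R}^3\setminus\overline{G}$ connected. Function spaces: a function $u=\sum_{k=0}^3u_ke_k:G\to\mathbb{H}_{\mathbb{C}}$ belongs to $\mathscr{F}(G;\mathbb{H}_{\mathbb{C}})$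 if each $u_k\in\mathscr{F}(G)$ (complex-valued space). $\Omega\Subset G$ means $\Omega$ is open with $\overline\Omega\subset G$. For $0<\epsilon\leqslant1$, $C_{bloc}^{0,\epsilon}(G;\mathbb{H}_{\mathbb{C}})$ is the set of $u:G\to\mathbb{H}_{\mathbb{C}}$ with $u|_B\in C^{0,\epsilon}(\overline B;\mathbb{H}_{\mathbb{C}})$ for every ball $B\Subset G$ (elements of $L_p$ are identified with a representative equal a.e.). Operators: $\mathbf{D}=\sum_{k=1}^3e_k\frac{\partial}{\partial x_k}$ (acting from the left). A function $v\in L_{1,loc}(G;\mathbb{H}_{\mathbb{C}})$ is the weak $\mathbf{D}$-derivative of $u\in L_{1,loc}(G;\mathbb{H}_{\mathbb{C}})$, written $v=\mathbf{D}u$, if $\int_G\overline{u}(\mathbf{D}\varphi)=\int_G\overline{v}\varphi$ for all $\varphi\in C_0^\infty(G;\mathbb{H}_{\mathbb{C}})$. For $A=(a_1,a_2,a_3,a_4)\in(L_\infty(G;\mathbb{H}_{\mathbb{C}}))^4$, $\mathbf{Q}_Aw=wa_1+\overline{w}a_2+a_3w+a_4\overline{w}$. $\mathfrak{V}_A^p(G;\mathbb{H}_{\mathbb{C}})$ is the set of weak solutions $w\in L_p(G;\mathbb{H}_{\mathbb{C}})$ of $\mathbf{D}w-\mathbf{Q}_Aw=0$ in $G$, i.e. those $w\in L_p(G;\mathbb{H}_{\mathbb{C}})$ having a weak $\mathbf{D}$-derivative equal to $\mathbf{Q}_Aw$. *)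

(* Defs.v *)
From HB Require Import structures.
From mathcomp Require Import all_boot all_order all_algebra.
From mathcomp Require Import complex.
From mathcomp Require Import all_classical all_reals all_analysis.

Set Implicit Arguments.
Unset Strict Implicit.
Unset Printing Implicit Defensive.

Import Order.TTheory GRing.Theory Num.Theory.
Import numFieldNormedType.Exports.

Local Open Scope classical_set_scope.
Local Open Scope ring_scope.
Local Open Scope complex_scope.

Section Biquaternions.
Variable R : realType.

(* The row (p_0, p_1, p_2, p_3) stands for p_0 + p_1 e_1 + p_2 e_2 + p_3 e_3. *)
Definition biquaternion := 'rV[R[i]]_(1 + 3).

Definition bqscal (p : biquaternion) : R[i] := lsubmx p 0 0.
Definition bqvect (p : biquaternion) : 'rV[R[i]]_3 := rsubmx p.
Definition bqmk (s : R[i]) (v : 'rV[R[i]]_3) : biquaternion := row_mx s%:M v.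

(* Bilinear, without conjugation. *)
Definition dotC (u v : 'rV[R[i]]_3) : R[i] := \sum_k u 0 k * v 0 k.

(* Indices are added modulo 3 in 'I_3. *)
Definition crossC (u v : 'rV[R[i]]_3) : 'rV[R[i]]_3 :=
  \row_(k < 3) (u 0 (k + 1) * v 0 (k + 1 + 1) - u 0 (k + 1 + 1) * v 0 (k + 1)).

Definition bqmul (p q : biquaternion) : biquaternion :=
  bqmk (bqscal p * bqscal q - dotC (bqvect p) (bqvect q))
       (bqscal p *: bqvect q + bqscal q *: bqvect p
        + crossC (bqvect p) (bqvect q)).

Definition bqconj (p : biquaternion) : biquaternion :=
  bqmk (bqscal p) (- bqvect p).

Definition bqnorm (p : biquaternion) : R :=
  Num.sqrt (\sum_k Normc.normc (p 0 k) ^+ 2).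

(* [bqe k] is e_{k+1}: the coordinates of R^3 are numbered from 0. *)
Definition bqe (k : 'I_3) : biquaternion := bqmk 0 (delta_mx 0 k).

End Biquaternions.

(* Points of R^3.  The library norm of this product is the sup norm; it serves
   only for the topology, and metric notions use [enorm]. *)
Notation R3 R := (R * R * R)%type.

Notation leb3 R :=
  ((@lebesgue_measure R) \x (@lebesgue_measure R) \x (@lebesgue_measure R))%E.

Section Space.
Variable R : realType.
Implicit Types (x c : R3 R) (f : R3 R -> R) (G U : set (R3 R)).

Definition coord3 x (k : 'I_3) : R := [:: x.1.1; x.1.2; x.2]`_k.

Definition basis3 (k : 'I_3) : R3 R :=
  ((k == 0%N :> nat)%:R, (k == 1%N :> nat)%:R, (k == 2%N :> nat)%:R).

Definition enorm x : R := Num.sqrt (\sum_k coord3 x k ^+ 2).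

Definition eball c (r : R) : set (R3 R) := [set x | enorm (x - c) < r].

Definition partial (k : 'I_3) f : R3 R -> R := 'D_(basis3 k) f.

Definition grad f x : R3 R := \sum_k partial k f x *: basis3 k.

Definition C1_on U f := forall x k, U x ->
  derivable f x (basis3 k) /\ {for x, continuous (partial k f)}.

Fixpoint iter_partial (s : seq 'I_3) f : R3 R -> R :=
  if s is k :: s' then partial k (iter_partial s' f) else f.

(* All partial derivatives of all orders exist and are continuous. *)
Definition smooth f := forall s : seq 'I_3,
  continuous (iter_partial s f) /\
  forall k x, derivable (iter_partial s f) x (basis3 k).

(* [n] is a unit normal field of [S]; its values outside [S] are irrelevant. *)
Definition C1_surface (S : set (R3 R)) (n : R3 R -> R3 R) :=
  forall x, S x -> exists U psi,
    [/\ open U, U x, C1_on U psi &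
        forall y, U y ->
          [/\ grad psi y != 0,
              S y <-> psi y = 0 &
              S y -> n y = (enorm (grad psi y))^-1 *: grad psi y]].

(* The classical Liapunov conditions: a closed surface with a unit normal that
   is Hoelder continuous, and a radius [d] such that the part of the surface in
   the ball of radius [d] around any of its points x is met at most once by
   every line parallel to the normal at x.  A closed surface being orientable,
   the normal field can be taken globally. *)
Definition liapunov_surface (S : set (R3 R)) :=
  compact S /\
  exists (n : R3 R -> R3 R) (lam C d : R),
    [/\ 0 < lam <= 1, 0 < d, C1_surface S n,
        forall x y, S x -> S y -> enorm (n x - n y) <= C * enorm (x - y) `^ lam &
        forall x y t, S x -> (S `&` eball x d) y ->
          (S `&` eball x d) (y + t *: n x) -> t = 0].

Definition liapunov_domain G :=
  [/\ G !=set0, open G, connected G, bounded_set G &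
      liapunov_surface (closure G `\` G°) /\ connected (~` closure G)].

End Space.

Section FunctionSpaces.
Variable R : realType.
Local Notation H := (biquaternion R).
Implicit Types (u v w : R3 R -> H) (G : set (R3 R)).

(* Functions on G are represented by functions on R^3 whose values outside G
   are irrelevant; [f \_ G] is the extension of f by zero. *)
Definition LpC G (q : \bar R) (f : R3 R -> R[i]) :=
  [/\ measurable_fun G (fun x => complex.Re (f x)),
      measurable_fun G (fun x => complex.Im (f x)) &
      ((fun x => Normc.normc (f x)) \_ G) \in Lfun (leb3 R) q].

Definition Lp G (q : \bar R) : set (R3 R -> H) :=
  [set u | forall k, LpC G q (fun x => u x 0 k)].

Definition compactly_in (O G : set (R3 R)) := open O /\ closure O `<=` G.

Definition L1loc G : set (R3 R -> H) :=
  [set u | forall O, compactly_in O G -> Lp O 1%E u].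

Definition holder_on (K : set (R3 R)) (eps : R) u :=
  exists C : R, forall x y, K x -> K y ->
    bqnorm (u x - u y) <= C * enorm (x - y) `^ eps.

Definition Cbloc G (eps : R) : set (R3 R -> H) :=
  [set u | forall c r, 0 < r -> compactly_in (eball c r) G ->
     holder_on (closure (eball c r)) eps u].

(* The functions having a representative in [F]. *)
Definition ae_class G (F : set (R3 R -> H)) : set (R3 R -> H) :=
  [set u | exists2 v, F v & {ae leb3 R, forall x, G x -> u x = v x}].

(* C_0^oo(G), each test function being extended by zero to R^3. *)
Definition test_function G (phi : R3 R -> H) :=
  (forall k, smooth (fun x => complex.Re (phi x 0 k)) /\
             smooth (fun x => complex.Im (phi x 0 k))) /\
  exists K, [/\ compact K, K `<=` G & forall x, ~ K x -> phi x = 0].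

Definition dpartial (k : 'I_3) u x : H :=
  \row_j (partial k (fun y => complex.Re (u y 0 j)) x
          +i* partial k (fun y => complex.Im (u y 0 j)) x).

Definition Dop u x : H := \sum_k bqmul (bqe R k) (dpartial k u x).

Definition bqint G u : H :=
  \row_j ((\int[leb3 R]_(x in G) complex.Re (u x 0 j))
          +i* (\int[leb3 R]_(x in G) complex.Im (u x 0 j))).

(* v is the weak D-derivative of u in G. *)
Definition weakD G u v :=
  [/\ L1loc G u, L1loc G v &
      forall phi, test_function G phi ->
        bqint G (fun x => bqmul (bqconj (u x)) (Dop phi x)) =
        bqint G (fun x => bqmul (bqconj (v x)) (phi x))].

Definition QA (a1 a2 a3 a4 w : R3 R -> H) (x : R3 R) : H :=
  bqmul (w x) (a1 x) + bqmul (bqconj (w x)) (a2 x)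
  + bqmul (a3 x) (w x) + bqmul (a4 x) (bqconj (w x)).

Definition VA G (p : R) (a1 a2 a3 a4 : R3 R -> H) : set (R3 R -> H) :=
  [set w | Lp G p%:E w /\ weakD G w (QA a1 a2 a3 a4 w)].

End FunctionSpaces.

(* Main.v *)
Require Import Defs.
From HB Require Import structures.
From mathcomp Require Import all_boot all_order all_algebra.
From mathcomp Require Import complex ring lra.
From mathcomp Require Import all_classical all_reals all_analysis.
From mathcomp Require Import measurable_realfun ess_sup_inf.

Set Implicit Arguments.
Unset Strict Implicit.
Unset Printing Implicit Defensive.

Import Order.TTheory GRing.Theory Num.Theory.
Import numFieldNormedType.Exports.

Local Open Scope classical_set_scope.
Local Open Scope ring_scope.

(** Test the equation with the functions chi K_m e_m, where chi is a cutoff and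
K_m is the m-th derivative of the regularized kernel (|y-x|^2 + e^2)^(-1/2), and
sum over m.  The relations e_k e_m + e_m e_k = -2 delta_km turn the Hessian of
the kernel into its Laplacian, which is an approximate identity as e tends to 0
(its mass is only needed to be positive and finite).  So a constant multiple of
chi w is almost everywhere a sum of potentials, with kernels of size |z|^(-2), of
functions bounded by C |w|.  Young's inequality then improves w from L_p to L_q
locally whenever 1/q > 1/p - 1/3, and the estimate
|K(z) - K(z')| <= 4 |z - z'|^t (|z|^(-2-t) + |z'|^(-2-t)) with Hoelder's inequality
gives local Hoelder continuity of exponent t = 1 - 3/r as soon as q > r.  The local
representatives agree where they overlap, and countably many of their balls
cover G.  For p >= 3 one lowers p, since G is bounded. *)

(** * Smooth functions on R^3 *)

(** For p < 3 the bound 3/2 < p says exactly that the Sobolev conjugate of p exceeds 3. Hence a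
    single gain of integrability reaches some q > r > 3, and a single use of Hoelder's inequality on
    a smaller ball ends the argument: t < 1 - 3/q is the condition (2 + t) q' < 3 under which
    |z|^(-2-t) is locally in L_q', with q' conjugate to q. The obstacle is the limit e -> 0 in the
    tested identity. At a fixed x the integral of U(y) rho_e(x, y), with U merely integrable, need
    not converge to a multiple of U(x). The identity is therefore first integrated in x over a box:
    after Fubini the approximate identity acts on the indicator of the box, where convergence is
    clear off the faces, and an integrable function is determined almost everywhere by its integrals
    over boxes. Polar coordinates are avoided: |z|^(-a) is at most the product of the three
    |z_i|^(-a/3), so that a < 3 reduces to the integrability of |t|^(-b) near 0 for b < 1. The mass
    of the approximate identity is bounded in the same way. *)

Section DirectionalDerivatives.
Variable R : realType.
Implicit Types (f g : R3 R -> R) (x v : R3 R).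

(** Restricting to the line through x in direction v gives access to the one-variable chain rule and
    to the derivative of an affine function. *)
Lemma is_derive_lineP f x v (df : R) :
  is_derive x v f df <-> is_derive (0 : R) (1 : R) (fun h : R => f (h *: v + x)) df.
Proof.
have E : (fun h : R => h^-1 *: ((f \o shift x) (h *: v) - f x)) =
    (fun h : R => h^-1 *: (((fun h : R => f (h *: v + x)) \o shift (0 : R)) (h *: (1 : R))
       - (fun h : R => f (h *: v + x)) 0)).
  apply/funext => h /=.
  by rewrite scale0r add0r addr0 [h *: 1]mulr1.
by split => -[]; rewrite /derivable /derive => d1 d2; apply: DeriveDef;
  rewrite /derivable /derive -?E // E.
Qed.

Lemma is_derive_comp1 f x v (g : R -> R) (a b : R) :
  is_derive x v f a -> is_derive (f x) 1 g b ->
  is_derive x v (fun y => g (f y)) (b * a).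
Proof.
move=> /is_derive_lineP df dg; apply/is_derive_lineP.
apply: (is_derive1_comp (f := g) (g := fun h : R => f (h *: v + x))) df.
by rewrite scale0r add0r.
Qed.

Lemma is_derive_add f g x v (a b : R) : is_derive x v f a -> is_derive x v g b ->
  is_derive x v (fun y => f y + g y) (a + b).
Proof. exact: is_deriveD. Qed.

Lemma is_derive_mul f g x v (a b : R) : is_derive x v f a -> is_derive x v g b ->
  is_derive x v (fun y => f y * g y) (f x * b + g x * a).
Proof. exact: is_deriveM. Qed.

Lemma is_derive_coord3 (i : 'I_3) x v :
  is_derive x v (fun y => coord3 y i) (coord3 v i).
Proof.
apply/is_derive_lineP.
have -> : (fun h : R => coord3 (h *: v + x) i) = (fun h => coord3 v i * h + coord3 x i).
  by apply/funext => h; rewrite mulrC; case: i => -[|[|[|]]].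
have h1 := is_deriveD (is_deriveZ (coord3 v i) (is_derive_id (0:R) (1:R)))
  (is_derive_cst (coord3 x i) (0:R) (1:R)).
by apply: is_derive_eq h1 _; rewrite addr0 [_ *: _]mulr1.
Qed.

Lemma coord3_basis3 (k i : 'I_3) : coord3 (basis3 R k) i = (k == i)%:R.
Proof. by case: k i => -[|[|[|//]]] ? [] [|[|[|//]]]. Qed.

Lemma coord3_continuous (i : 'I_3) : continuous (fun y : R3 R => coord3 y i).
Proof.
case: i => -[|[|[|//]]] ? x; rewrite /coord3/=.
- apply: (@continuous_comp _ _ _ fst fst); exact: cvg_fst.
- apply: (@continuous_comp _ _ _ fst snd); [exact: cvg_fst|exact: cvg_snd].
- exact: cvg_snd.
Qed.

(* For generators closed under differentiation, the smoothness of every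
   polynomial in them and in the coordinates is a formal matter. *)
Inductive poly_in (gen : set (R3 R -> R)) : (R3 R -> R) -> Prop :=
| PolyGen g : gen g -> poly_in gen g
| PolyCst c : poly_in gen (fun=> c)
| PolyCoord i : poly_in gen (fun x => coord3 x i)
| PolyAdd f g : poly_in gen f -> poly_in gen g -> poly_in gen (fun x => f x + g x)
| PolyMul f g : poly_in gen f -> poly_in gen g -> poly_in gen (fun x => f x * g x).

Definition closed_generators (gen : set (R3 R -> R)) := forall g, gen g ->
  continuous g /\ forall k, exists2 g', poly_in gen g' &
    forall x, is_derive x (basis3 R k) g (g' x).

Lemma poly_in_derive gen f k : closed_generators gen -> poly_in gen f ->
  exists2 f', poly_in gen f' & forall x, is_derive x (basis3 R k) f (f' x).
Proof.
move=> cg; elim => [g /cg[_ /(_ k)//]|c|i|{}f g _ [f' pf' df] _ [g' pg' dg]|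
    {}f g pf [f' pf' df] pg [g' pg' dg]].
- exists (fun=> 0); first exact: PolyCst.
  by move=> x; exact: is_derive_cst.
- exists (fun=> (k == i)%:R); first exact: PolyCst.
  by move=> x; apply: is_derive_eq (is_derive_coord3 _ _ _) _; exact: coord3_basis3.
- exists (fun x => f' x + g' x); first exact: PolyAdd.
  by move=> x; exact: is_derive_add.
- exists (fun x => f x * g' x + g x * f' x).
    by apply: PolyAdd; exact: PolyMul.
  by move=> x; exact: is_derive_mul.
Qed.

Lemma poly_in_continuous gen f : closed_generators gen -> poly_in gen f -> continuous f.
Proof.
move=> cg; elim => [g /cg[]//|c|i|{}f g _ cf _ cg'|{}f g _ cf _ cg'].
- by move=> x; exact: cvg_cst.
- exact: coord3_continuous.
- by move=> x; apply: cvgD; [exact: cf|exact: cg'].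
- by move=> x; apply: cvgM; [exact: cf|exact: cg'].
Qed.

Lemma poly_in_smooth gen f : closed_generators gen -> poly_in gen f -> smooth f.
Proof.
move=> cg pf s.
have : poly_in gen (iter_partial s f).
  elim: s => [//|k s ih] /=.
  have [f' pf' df'] := poly_in_derive k cg ih.
  suff -> : partial k (iter_partial s f) = f' by [].
  by apply/funext => x; rewrite /partial; have [_ ->] := df' x.
move=> p; split; first exact: poly_in_continuous p.
by move=> k x; have [f' _ /(_ x)[]] := poly_in_derive k cg p.
Qed.

End DirectionalDerivatives.

(** * Functions flat at the origin *)

Section FlatFunctions.
Variable R : realType.

(* The derivatives of t |-> exp(-1/t), extended by 0, are combinations of these. *)
Definition flat (m : nat) (t : R) : R := if 0 < t then t^-1 ^+ m * expR (- t^-1) else 0.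

Lemma flat_ge0 m t : 0 <= flat m t.
Proof. by rewrite /flat; case: ifP => // t0; rewrite mulr_ge0 ?expR_ge0 ?exprn_ge0 ?invr_ge0 ?ltW. Qed.

(** The exponential series gives s^(m+1) / (m+1)! <= exp s. At s = 1/t one factor t is left over,
    which makes the difference quotients at 0 tend to 0. *)
Lemma flat_le m (t : R) : `|flat m t| <= (m.+1)`!%:R * `|t|.
Proof.
rewrite ger0_norm ?flat_ge0// /flat; case: ifPn => [t0|_]; last by rewrite mulr_ge0.
have s0 : 0 < t^-1 by rewrite invr_gt0.
have := expR_ge1Dxn m (ltW s0) => h.
have f0 : 0 < (m.+1)`!%:R :> R by rewrite ltr0n fact_gt0.
rewrite expRN ler_pdivrMr ?expR_gt0// gtr0_norm//.
apply: le_trans (ler_wpM2l _ h); last by rewrite mulr_ge0// ltW.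
rewrite mulrDr mulr1 exprS.
have -> : (m.+1)`!%:R * t * (t^-1 * t^-1 ^+ m / (m.+1)`!%:R) = t^-1 ^+ m.
  by field; rewrite !gt_eqF.
by rewrite lerDr mulr_ge0// ltW.
Qed.

Lemma is_derive_flat m (t : R) :
  is_derive t (1 : R) (flat m) (flat m.+2 t - m%:R * flat m.+1 t).
Proof.
have [t0|t0|->] := ltgtP t 0.
- apply: (near_eq_is_derive (f := cst (0 : R))); last first.
    apply: is_derive_eq (is_derive_cst (0 : R) t (1 : R)) _.
    by rewrite /flat !ltNge (ltW t0)/= mulr0 subr0.
  near=> s; rewrite /flat ltNge (_ : s <= 0)//; near: s.
  by apply: filterS (lt_nbhsl t0) => s /ltW.
- have dV : is_derive t (1 : R) (fun s : R => s^-1) (- t ^- 2).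
    apply: is_derive_eq (is_deriveV _ (is_derive_id t (1 : R))) _; first by rewrite gt_eqF.
    by rewrite [_ *: _]mulr1.
  have dE : is_derive t (1 : R) (fun s : R => expR (- s^-1)) (expR (- t^-1) * t ^- 2).
    have dN : is_derive t (1 : R) (fun s : R => - s^-1) (t ^- 2).
      by apply: is_derive_eq (is_deriveN dV) _; rewrite opprK.
    exact: (@is_derive1_comp R expR (fun s : R => - s^-1) t _ _ (is_derive_expR (- t^-1)) dN).
  apply: (near_eq_is_derive (f := fun s : R => s^-1 ^+ m * expR (- s^-1))).
    by near=> s; rewrite /flat (_ : 0 < s)//; near: s; exact: lt_nbhsr.
  have dX : is_derive t (1 : R) (fun s : R => s^-1 ^+ m) (m%:R * t^-1 ^+ m.-1 * - t ^- 2).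
    have -> : (fun s : R => s^-1 ^+ m) = (fun s : R => s^-1) ^+ m.
      by apply/funext => s; rewrite exprfctE.
    exact: is_deriveX.
  apply: is_derive_eq (is_deriveM dX dE) _.
  rewrite /flat t0 -![_ *: _]/(_ * _) -exprVn.
  case: m dX => [|m] dX; first by rewrite !mul0r !mulr0 addr0 subr0 expr0 mul1r mulrC.
  by rewrite succnK -[(m.+3)%N]addn3 -[(m.+2)%N]addn2 -[m.+1]addn1 !exprD expr1; ring.
(* At 0 the difference quotient of [flat m] is [flat m.+1], which [flat_le] sends to 0. *)
- rewrite {2 3}/flat ltxx mulr0 subr0.
  have cv : (fun h : R => h^-1 *: (flat m (h *: 1 + 0) - flat m 0)) @ 0^' --> (0 : R).
    apply/cvgrPdist_le => e e0; near=> h.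
    have h0 : h != 0 by near: h; exact: nbhs_dnbhs_neq.
    rewrite sub0r normrN addr0 [h *: 1]mulr1 {2}/flat ltxx subr0.
    have -> : h^-1 *: flat m h = flat m.+1 h.
      by rewrite /flat; case: ifP => _; rewrite ?scaler0// exprS -mulrA.
    apply: (le_trans (flat_le _ _)).
    rewrite mulrC -ler_pdivlMr ?ltr0n ?fact_gt0//.
    near: h; apply: dnbhs0_le; rewrite divr_gt0// ltr0n fact_gt0 //.
  by apply: DeriveDef; [apply/cvg_ex; eexists; exact: cv|exact: cvg_lim cv].
Unshelve. all: by end_near. Qed.

Lemma flat_continuous m : continuous (flat m).
Proof.
move=> t; apply: differentiable_continuous; apply/derivable1_diffP.
by have [] := is_derive_flat m t.
Qed.

Lemma flat_gt0 m t : 0 < t -> 0 < flat m t.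
Proof. by move=> t0; rewrite /flat t0 mulr_gt0 ?expR_gt0// exprn_gt0// invr_gt0. Qed.

Lemma flat_eq0 m t : t <= 0 -> flat m t = 0.
Proof. by rewrite /flat leNgt => /negbTE ->. Qed.

End FlatFunctions.

(** * The cutoff function and the regularized kernel *)

Section SmoothGenerators.
Variable R : realType.
Implicit Types (x y c : R3 R) (k : 'I_3).

Definition nsq3 x : R := \sum_k coord3 x k ^+ 2.

Lemma nsq3_ge0 x : 0 <= nsq3 x.
Proof. by apply: sumr_ge0 => k _; exact: sqr_ge0. Qed.

Lemma coord3B x y k : coord3 (x - y) k = coord3 x k - coord3 y k.
Proof. by case: k => -[|[|[|]]]. Qed.

Lemma coord3_0 k : coord3 (0 : R3 R) k = 0.
Proof. by case: k => -[|[|[|]]]. Qed.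

Lemma is_derive_nsq3 k c x :
  is_derive x (basis3 R k) (fun y => nsq3 (y - c)) (2 * coord3 (x - c) k).
Proof.
have E : (fun y => nsq3 (y - c)) = (fun y =>
    (coord3 y 0 + - coord3 c 0) * (coord3 y 0 + - coord3 c 0) +
    (coord3 y 1 + - coord3 c 1) * (coord3 y 1 + - coord3 c 1) +
    (coord3 y 2 + - coord3 c 2) * (coord3 y 2 + - coord3 c 2)).
  apply/funext => y; rewrite /nsq3 !big_ord_recl big_ord0 addr0 addrA.
  by rewrite !coord3B !expr2.
rewrite E.
have d (i : 'I_3) : is_derive x (basis3 R k) (fun y => coord3 y i + - coord3 c i) (k == i)%:R.
  apply: is_derive_eq (is_derive_add (is_derive_coord3 i x _) (is_derive_cst _ _ _)) _.
  by rewrite addr0 coord3_basis3.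
apply: is_derive_eq (is_derive_add (is_derive_add (is_derive_mul (d 0) (d 0))
  (is_derive_mul (d 1) (d 1))) (is_derive_mul (d 2) (d 2))) _.
rewrite -!coord3B.
case: k {d} => -[|[|[|//]]] i.
- by rewrite (_ : Ordinal i = 0) ?eqxx/=; [ring|exact/val_inj].
- by rewrite (_ : Ordinal i = 1) ?eqxx/=; [ring|exact/val_inj].
- by rewrite (_ : Ordinal i = 2) ?eqxx/=; [ring|exact/val_inj].
Qed.

Lemma nsq3_continuous c : continuous (fun y => nsq3 (y - c)).
Proof.
move=> y; rewrite /continuous_at.
have h k : coord3 (z - c) k @[z --> y] --> coord3 (y - c) k.
  under eq_fun do rewrite coord3B; rewrite coord3B.
  by apply: cvgB; [exact: coord3_continuous|exact: cvg_cst].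
rewrite /nsq3; under eq_fun do rewrite !big_ord_recl big_ord0.
rewrite !big_ord_recl big_ord0.
by do ?apply: cvgD; rewrite ?expr2; try exact: cvg_cst;
  under eq_fun do rewrite expr2; apply: cvgM; exact: h.
Qed.

(** The bump exp(-1/(r^2 - |y-c|^2)). It is not made constant near c: it is positive inside the
    ball, and the representation formula is eventually divided by it. *)
Definition cutoff c (r : R) y : R := flat 0 (r ^+ 2 - nsq3 (y - c)).

(* A smooth version of the fundamental solution |y - x|^-1 of the Laplacian. *)
Definition inv_dist (e : R) x y : R := (Num.sqrt (nsq3 (y - x) + e ^+ 2))^-1.

(** All orders m are included because differentiating [flat m] raises the order. The inverse
    distance needs no companion: its derivatives are coordinates times its cube. *)
Definition gen3 (c : R3 R) (r e : R) (x : R3 R) : set (R3 R -> R) := fun g =>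
  g = inv_dist e x \/ exists m, g = fun y => flat m (r ^+ 2 - nsq3 (y - c)).

Lemma is_derive_inv_dist (e : R) k x y : e != 0 ->
  is_derive y (basis3 R k) (inv_dist e x) (- (coord3 (y - x) k * inv_dist e x y ^+ 3)).
Proof.
move=> e0; have p0 : 0 < nsq3 (y - x) + e ^+ 2.
  by rewrite ltr_wpDl ?nsq3_ge0// exprn_even_gt0.
have d1 : is_derive y (basis3 R k) (fun y => nsq3 (y - x) + e ^+ 2) (2 * coord3 (y - x) k).
  by apply: is_derive_eq (is_derive_add (is_derive_nsq3 k x y) (is_derive_cst _ _ _)) _; rewrite addr0.
have s0 : Num.sqrt (nsq3 (y - x) + e ^+ 2) != 0 by rewrite gt_eqF// sqrtr_gt0.
have d2 := is_deriveV s0 (is_derive1_sqrt p0).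
apply: is_derive_eq (is_derive_comp1 d1 d2) _.
by rewrite /inv_dist -[_ *: _]/(_ * _) -!exprVn; field.
Qed.

Lemma is_derive_flat_nsq3 m (r : R) k c y :
  is_derive y (basis3 R k) (fun y => flat m (r ^+ 2 - nsq3 (y - c)))
    ((flat m.+2 (r ^+ 2 - nsq3 (y - c)) + - m%:R * flat m.+1 (r ^+ 2 - nsq3 (y - c)))
      * (- 2 * (coord3 y k + - coord3 c k))).
Proof.
have d1 : is_derive y (basis3 R k) (fun y => r ^+ 2 - nsq3 (y - c)) (- (2 * coord3 (y - c) k)).
  by apply: is_derive_eq (is_derive_add (is_derive_cst (r ^+ 2) _ _)
    (is_deriveN (is_derive_nsq3 k c y))) _; rewrite add0r.
apply: is_derive_eq (is_derive_comp1 d1 (is_derive_flat m _)) _.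
by rewrite -coord3B; ring.
Qed.

Lemma closed_gen3 c r e x : e != 0 -> closed_generators (gen3 c r e x).
Proof.
move=> e0 g [->|[m ->]]; split.
- move=> y; apply: cvgV.
    by rewrite gt_eqF// sqrtr_gt0 ltr_wpDl ?nsq3_ge0// exprn_even_gt0.
  apply: (@continuous_comp _ _ _ (fun y => nsq3 (y - x) + e ^+ 2) Num.sqrt); last exact: sqrt_continuous.
  by apply: cvgD; [exact: nsq3_continuous|exact: cvg_cst].
- move=> k; exists (fun y => (-1 * (coord3 y k + - coord3 x k)) *
    (inv_dist e x y * (inv_dist e x y * inv_dist e x y))).
    apply: PolyMul; first apply: PolyMul; [exact: PolyCst|apply: PolyAdd;[exact: PolyCoord|exact: PolyCst]|].
    by apply: PolyMul; [|apply: PolyMul]; apply: PolyGen; left.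
  move=> y; apply: is_derive_eq (is_derive_inv_dist k x y e0) _.
  by rewrite -coord3B; ring.
- move=> y; apply: (@continuous_comp _ _ _ (fun y => r ^+ 2 - nsq3 (y - c)) (flat m)); last exact: flat_continuous.
  by apply: cvgB; [exact: cvg_cst|exact: nsq3_continuous].
- move=> k; eexists; last by move=> y; exact: is_derive_flat_nsq3.
  apply: PolyMul; first apply: PolyAdd.
  + by apply: PolyGen; right; exists m.+2.
  + by apply: PolyMul; [exact: PolyCst|apply: PolyGen; right; exists m.+1].
  + by apply: PolyMul; [exact: PolyCst|apply: PolyAdd; [exact: PolyCoord|exact: PolyCst]].
Qed.

(** For e != 0 this is the m-th derivative in y of [inv_dist e x]; at e = 0 it is the kernel of the
    limiting potentials. There the inverse of 0 is 0, so [kern 0] vanishes on the diagonal. *)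
Definition kern (e : R) (m : 'I_3) x y : R := - (coord3 (y - x) m * inv_dist e x y ^+ 3).

Lemma is_derive_kern (e : R) k m x y : e != 0 ->
  is_derive y (basis3 R k) (kern e m x)
    (3 * coord3 (y - x) m * coord3 (y - x) k * inv_dist e x y ^+ 5
     - (k == m)%:R * inv_dist e x y ^+ 3).
Proof.
move=> e0; have di := is_derive_inv_dist k x y e0.
have dc : is_derive y (basis3 R k) (fun y => coord3 y m + - coord3 x m) (k == m)%:R.
  apply: is_derive_eq (is_derive_add (is_derive_coord3 m y _) (is_derive_cst _ _ _)) _.
  by rewrite addr0 coord3_basis3.
have -> : kern e m x = (fun y => (-1) * ((coord3 y m + - coord3 x m) *
    (inv_dist e x y * (inv_dist e x y * inv_dist e x y)))).
  by apply/funext => z; rewrite /kern coord3B; ring.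
apply: is_derive_eq (is_derive_mul (is_derive_cst (-1 : R) _ _)
  (is_derive_mul dc (is_derive_mul di (is_derive_mul di di)))) _.
by rewrite -!coord3B /cst; ring.
Qed.

Lemma smooth_cutoff_kern c r (e : R) m x : e != 0 ->
  smooth (fun y => cutoff c r y * kern e m x y).
Proof.
move=> e0; suff p : poly_in (gen3 c r e x) (fun y => cutoff c r y * kern e m x y).
  exact: poly_in_smooth (closed_gen3 e0) p.
apply: PolyMul; first by apply: PolyGen; right; exists 0%N.
have -> : kern e m x = (fun y => ((-1) * (coord3 y m + - coord3 x m)) *
    (inv_dist e x y * (inv_dist e x y * inv_dist e x y))).
  by apply/funext => z; rewrite /kern coord3B; ring.
apply: PolyMul; first apply: PolyMul; [exact: PolyCst|apply: PolyAdd;[exact: PolyCoord|exact: PolyCst]|].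
by apply: PolyMul; [|apply: PolyMul]; apply: PolyGen; left.
Qed.

Definition dcutoff c (r : R) k y : R :=
  flat 2 (r ^+ 2 - nsq3 (y - c)) * (- 2 * coord3 (y - c) k).

Lemma is_derive_cutoff c r k y : is_derive y (basis3 R k) (cutoff c r) (dcutoff c r k y).
Proof.
apply: is_derive_eq (is_derive_flat_nsq3 0 r k c y) _.
by rewrite /dcutoff coord3B mulNr mul0r oppr0 addr0.
Qed.

Lemma partial_cutoff_kern c r (e : R) k m x y : e != 0 ->
  partial k (fun y => cutoff c r y * kern e m x y) y =
  dcutoff c r k y * kern e m x y + cutoff c r y *
    (3 * coord3 (y - x) m * coord3 (y - x) k * inv_dist e x y ^+ 5
     - (k == m)%:R * inv_dist e x y ^+ 3).
Proof.
move=> e0; have [_ h] := is_derive_mul (is_derive_cutoff c r k y) (is_derive_kern k m x y e0).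
by rewrite /partial h addrC mulrC.
Qed.

Lemma nsq3_inv_dist (e : R) x y : e != 0 ->
  (nsq3 (y - x) + e ^+ 2) * inv_dist e x y ^+ 2 = 1.
Proof.
move=> e0; have p0 : 0 < nsq3 (y - x) + e ^+ 2.
  by rewrite ltr_wpDl ?nsq3_ge0// exprn_even_gt0.
by rewrite /inv_dist exprVn sqr_sqrtr ?ltW// divff ?gt_eqF.
Qed.

Lemma enormE x : enorm x = Num.sqrt (nsq3 x).
Proof. by []. Qed.

Lemma cutoff_eq0 c r y : 0 <= r -> r <= enorm (y - c) -> cutoff c r y = 0.
Proof.
move=> r0 h; apply: flat_eq0; rewrite subr_le0 -[leRHS]sqr_sqrtr ?nsq3_ge0//.
by rewrite ler_sqr ?nnegrE ?sqrtr_ge0.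
Qed.

Lemma cutoff_continuous c r : continuous (cutoff c r).
Proof.
move=> y; apply: (@continuous_comp _ _ _ (fun y => r ^+ 2 - nsq3 (y - c)) (flat 0)); last exact: flat_continuous.
by apply: cvgB; [exact: cvg_cst|exact: nsq3_continuous].
Qed.

Lemma dcutoff_continuous c r k : continuous (dcutoff c r k).
Proof.
move=> y; apply: cvgM.
  apply: (@continuous_comp _ _ _ (fun y => r ^+ 2 - nsq3 (y - c)) (flat 2)); last exact: flat_continuous.
  by apply: cvgB; [exact: cvg_cst|exact: nsq3_continuous].
apply: cvgM; first exact: cvg_cst.
under eq_fun do rewrite coord3B; rewrite /continuous_at coord3B.
by apply: cvgB; [exact: coord3_continuous|exact: cvg_cst].
Qed.

Lemma dcutoff_eq0 c r k y : 0 <= r -> r <= enorm (y - c) -> dcutoff c r k y = 0.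
Proof.
move=> r0 h; rewrite /dcutoff flat_eq0 ?mul0r// subr_le0 -[leRHS]sqr_sqrtr ?nsq3_ge0//.
by rewrite ler_sqr ?nnegrE ?sqrtr_ge0.
Qed.

End SmoothGenerators.

(** * Lebesgue measure on R^3 *)

Lemma le_of_eq d (T : porderType d) (x y : T) : x = y -> (x <= y)%O.
Proof. by move->. Qed.

Lemma measurable_EFin_powR d (T : measurableType d) (R : realType) (f : T -> R) (p : R) :
  measurable_fun setT f -> measurable_fun setT (fun y => (f y `^ p)%:E).
Proof. by move=> mf; apply/measurable_EFinP; exact: (measurableT_comp (measurable_powR _) mf). Qed.

Lemma measurable_norm d (T : measurableType d) (R : realType) (f : T -> R) :
  measurable_fun setT f -> measurable_fun setT (fun y => `|f y|).
Proof. exact: (measurableT_comp (@normr_measurable R setT)). Qed.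

Lemma ae_forall_fin d (T : measurableType d) (R : realType)
    (m : {measure set T -> \bar R}) (I : finType) (P : I -> T -> Prop) :
  (forall i, {ae m, forall x, P i x}) -> {ae m, forall x, forall i, P i x}.
Proof.
move=> h; have : {ae m, forall x, forall i, i \in enum I -> P i x}.
  elim: (enum I) => [|i s ih]; first by apply: aeW => x i; rewrite in_nil.
  by apply: filterS2 (h i) ih => x h1 h2 j; rewrite in_cons => /predU1P[->//|]; exact: h2.
by apply: filterS => x hx i; apply: hx; rewrite mem_enum.
Qed.

(** * Product measure: sigma-finiteness, dilations, Tonelli *)

Section ProductSigmaFinite.
Context d1 d2 (T1 : measurableType d1) (T2 : measurableType d2) (R : realType).
Variables (m1 : {sigma_finite_measure set T1 -> \bar R})
  (m2 : {sigma_finite_measure set T2 -> \bar R}).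

Lemma product_measure1_sigma_finite : sigma_finite setT (m1 \x m2)%E.
Proof.
have /sigma_finiteP[F [TF ndF Foo]] := sigma_finiteT m1.
have /sigma_finiteP[G [TG ndG Goo]] := sigma_finiteT m2.
exists (fun n => F n `*` G n).
  apply/seteqP; split=> [[x y] _|//].
  have [[n _ Fnx] [k _ Gky]] : (\bigcup_n F n) x /\ (\bigcup_n G n) y.
    by rewrite -TF -TG.
  exists (maxn n k) => //; split.
    by move: Fnx; exact/subsetPset/ndF/leq_maxl.
  by move: Gky; exact/subsetPset/ndG/leq_maxr.
move=> k; have [mF Fk] := Foo k; have [mG Gk] := Goo k.
split; first exact: measurableX.
by rewrite product_measure1E// lte_mul_pinfty// ge0_fin_numE.
Qed.

End ProductSigmaFinite.

Section Leb3.
Variable R : realType.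
Local Notation mu := (@lebesgue_measure R).

(** The products are named so that sigma-finite structures can be attached to them, as Tonelli and
    Fubini require; they stay convertible to the measure of the theorem. *)
Definition leb2m : set (measurableTypeR R * measurableTypeR R)%type -> \bar R :=
  (mu \x mu)%E.

HB.instance Definition _ := Measure.copy leb2m (mu \x mu)%E.
HB.instance Definition _ := Measure_isSigmaFinite.Build _ _ _ leb2m
  (product_measure1_sigma_finite mu mu).

Definition leb3m :
    set (measurableTypeR R * measurableTypeR R * measurableTypeR R)%type -> \bar R :=
  (leb2m \x mu)%E.

HB.instance Definition _ := Measure.copy leb3m (leb2m \x mu)%E.
HB.instance Definition _ := Measure_isSigmaFinite.Build _ _ _ leb3m
  (product_measure1_sigma_finite leb2m mu).

End Leb3.

Section MeasureR3.
Variable R : realType.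
Local Notation mu := (@lebesgue_measure R).
Local Notation leb2m := (@leb2m R).
Local Notation M := (measurableTypeR R).
(* Convertible to [R3 R], but with the measurable structure on which [leb3] lives. *)
Local Notation T3 := (M * M * M)%type.
Local Notation leb3m := (@leb3m R).

Definition box3 (A B C : set M) : set T3 := (A `*` B) `*` C.

Lemma measurable_box3 (A B C : set M) :
  measurable A -> measurable B -> measurable C -> measurable (box3 A B C).
Proof. by move=> mA mB mC; apply: measurableX => //; exact: measurableX. Qed.

Lemma leb3_box3 (A B C : set M) :
  measurable A -> measurable B -> measurable C ->
  leb3m (box3 A B C) = (mu A * mu B * mu C)%E.
Proof.
move=> mA mB mC.
etransitivity; first by apply: product_measure1E => //; exact: measurableX.
by congr (_ * _)%E; exact: product_measure1E.
Qed.

(** Boxes with rational endpoints form a countable base, and [Q] passes from a neighbourhood to the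
    boxes inside it; [Q set0] pads the enumeration. It serves to make open sets measurable and, at
    the end, to glue almost everywhere equalities. *)
Lemma lindelof3 (G : set (R3 R)) (Q : set (R3 R) -> Prop) :
  Q set0 -> (forall U V, U `<=` V -> Q V -> Q U) ->
  (forall x, G x -> exists2 U, nbhs x U & Q U) ->
  exists F : nat -> set (R3 R),
    (forall n, measurable (F n) /\ Q (F n)) /\ G `<=` \bigcup_n F n.
Proof.
move=> Q0 Qsub QG.
pose itvq (q : rat * rat) : set R := `]ratr q.1, ratr q.2[%classic.
pose bx (i : (rat * rat) * (rat * rat) * (rat * rat)) :=
  box3 (itvq i.1.1) (itvq i.1.2) (itvq i.2).
pose F n := if unpickle n is Some i then
  (if `[< Q (bx i) >] then bx i else set0) else set0.
exists F; split.
  move=> n; rewrite /F; case: unpickle => [i|//].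
  case: asboolP => [Qi|//]; split => //.
  by apply: measurable_box3; exact: measurable_itv.
move=> x Gx; have [U xU QU] := QG x Gx.
move: xU => /nbhs_ballP[e /= e0 eU].
have itvqP (t : R) : exists q, itvq q t /\ itvq q `<=` ball t e.
  have [a /[!in_itv]/= /andP[a1 a2]] : exists a : rat, ratr a \in `](t - e), t[.
    by apply: rat_in_itvoo; rewrite ltrBlDr ltrDl.
  have [b /[!in_itv]/= /andP[b1 b2]] : exists b : rat, ratr b \in `]t, (t + e)[.
    by apply: rat_in_itvoo; rewrite ltrDl.
  exists (a, b); rewrite /itvq/= in_itv/= a2 b1; split => // s.
  rewrite /= in_itv/= => /andP[s1 s2]; rewrite /ball/= ltr_distlC.
  by rewrite (lt_trans a1)//= (lt_trans s2).
have [q1 [q1x q1U]] := itvqP x.1.1.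
have [q2 [q2x q2U]] := itvqP x.1.2.
have [q3 [q3x q3U]] := itvqP x.2.
exists (pickle (q1, q2, q3)); first exact: I.
rewrite /F pickleK; case: asboolP => [_|[]]; first by split => //; split.
apply: Qsub QU => y [[/= y1 y2] y3]; apply: eU.
by split; [split; [exact: q1U|exact: q2U]|exact: q3U].
Qed.

Lemma open_measurable3 (G : set (R3 R)) : open G -> @measurable _ T3 G.
Proof.
move=> oG.
have [|U V UV VG|x Gx|F [mF GF]] := @lindelof3 G (fun U => U `<=` G).
- exact: sub0set.
- exact: subset_trans UV VG.
- by exists G => //; exact: open_nbhs_nbhs.
rewrite (_ : G = \bigcup_n F n); last first.
  by rewrite eqEsubset; split => //; apply: bigcup_sub => n _; have [] := mF n.
by apply: bigcup_measurable => n _; have [] := mF n.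
Qed.

Lemma continuous_measurable_fun3 (f : R3 R -> R) :
  continuous f -> measurable_fun [set: T3] f.
Proof.
move=> /continuousP cf; apply: (measurability _ (RGenOpens.measurableE R)).
move=> _ [_ [a [b ->] <-]]; rewrite setTI.
by apply: open_measurable3; apply: cf; exact: interval_open.
Qed.

(** The right-hand side is a measure in [A], so uniqueness of Lebesgue measure leaves only half-open
    intervals to compare. *)
Lemma lebesgue_measure_affine (a e : R) (A : set M) : 0 < e -> measurable A ->
  mu A = (e%:E * mu ((fun t => (a + e * t)%R) @^-1` A))%E.
Proof.
move=> e0 mA.
have mphi : measurable_fun setT
    ((fun t => a + e * t) : M -> M).
  by apply: measurable_funD => //; apply: measurable_funM.
pose m := mscale (NngNum (ltW e0)) (pushforward mu
  ((fun t => a + e * t) : M -> M)).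
pose m' : {measure set (M) -> \bar R} := m mphi.
rewrite (@lebesgue_measure_unique _ m')// => _ [[c d]] _ <-.
rewrite /m' /m /= /mscale/= /pushforward/=.
rewrite (_ : _ @^-1` _ = `](c - a) / e, (d - a) / e]%classic); last first.
  apply/seteqP; split => t /=; rewrite !in_itv/= ltr_pdivrMr// ler_pdivlMr//;
    by rewrite ltrBlDl lerBrDl (mulrC t).
rewrite !lebesgue_measure_itv/= !lte_fin.
rewrite ltr_pM2r ?invr_gt0// ltrD2r; case: ifPn => _; last by rewrite mule0.
by rewrite -EFinD -EFinD -EFinM; congr (_%:E); field; rewrite gt_eqF.
Qed.

Lemma ge0_integral_affine1 (a e : R) (f : M -> \bar R) : 0 < e ->
  measurable_fun setT f -> (forall x, 0 <= f x)%E ->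
  (\int[mu]_t f t = e%:E * \int[mu]_t f (a + e * t)%R)%E.
Proof.
move=> e0 mf f0.
have mphi : measurable_fun setT
    ((fun t => a + e * t) : M -> M).
  by apply: measurable_funD => //; apply: measurable_funM.
have := ge0_integral_pushforward mphi mu measurableT mf (fun x _ => f0 x).
rewrite preimage_setT => <-.
rewrite -(ge0_integral_mscale _ measurableT (NngNum (ltW e0)))//.
by apply: eq_measure_integral => A mA _; exact: lebesgue_measure_affine.
Qed.

Definition aff3 (a : T3) (e : R) (z : T3) : T3 :=
  ((a.1.1 + e * z.1.1, a.1.2 + e * z.1.2), a.2 + e * z.2).

Lemma measurable_fst3 d (T : measurableType d) (f : T -> T3) :
  measurable_fun setT f -> measurable_fun setT (fun x => (f x).1.1).
Proof. by move=> mf; do 2 apply: (measurableT_comp measurable_fst). Qed.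

Lemma measurable_snd3 d (T : measurableType d) (f : T -> T3) :
  measurable_fun setT f -> measurable_fun setT (fun x => (f x).1.2).
Proof.
move=> mf; apply: (measurableT_comp measurable_snd).
exact: (measurableT_comp measurable_fst).
Qed.

Lemma measurable_thd3 d (T : measurableType d) (f : T -> T3) :
  measurable_fun setT f -> measurable_fun setT (fun x => (f x).2).
Proof. by move=> mf; apply: (measurableT_comp measurable_snd). Qed.

Lemma measurable_triple d (T : measurableType d) (f g h : T -> M) :
  measurable_fun setT f -> measurable_fun setT g -> measurable_fun setT h ->
  measurable_fun setT (fun x => ((f x, g x), h x) : T3).
Proof. by move=> mf mg mh; do 2 apply: measurable_fun_pair => //. Qed.

Lemma measurable_aff3 a e : measurable_fun setT (aff3 a e).
Proof.
apply: measurable_triple; (apply: measurable_funD => //); apply: measurable_funM => //.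
- exact: (@measurable_fst3 _ (T3) id).
- exact: (@measurable_snd3 _ (T3) id).
Qed.

Lemma ge0_integral3 (f : T3 -> \bar R) :
  measurable_fun setT f -> (forall x, 0 <= f x)%E ->
  (\int[leb3m]_z f z = \int[mu]_x \int[mu]_y \int[mu]_z f (x, y, z))%E.
Proof.
move=> mf f0; etransitivity; first exact: (@fubini_tonelli1 _ _ _ _ _ leb2m mu f).
apply: (@fubini_tonelli1 _ _ _ _ _ mu mu (fubini_F mu f)).
  exact: measurable_fun_fubini_tonelli_F.
by move=> x; apply: integral_ge0.
Qed.

(** The one-variable substitution is applied inside the iterated integral, one variable at a time;
    each contributes a factor e. *)
Lemma ge0_integral_affine3 (a : T3) (e : R) (f : T3 -> \bar R) : 0 < e ->
  measurable_fun setT f -> (forall x, 0 <= f x)%E ->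
  (\int[leb3m]_z f z = (e ^+ 3)%:E * \int[leb3m]_z f (aff3 a e z))%E.
Proof.
move=> e0 mf f0.
have ma := measurable_aff3 a e.
have ee0 : (0 <= e%:E)%E by rewrite lee_fin ltW.
rewrite (ge0_integral3 mf f0).
rewrite (ge0_integral3 (measurableT_comp mf ma) (fun x => f0 _)).
have mF : measurable_fun setT (fun xy : (M * M)%type => \int[mu]_z f (xy, z))%E.
  exact: (@measurable_fun_fubini_tonelli_F _ _ _ _ _ mu f mf f0).
have F0 xy : (0 <= \int[mu]_z f (xy, z))%E by exact: integral_ge0.
have mG : measurable_fun setT (fun x : M => \int[mu]_y \int[mu]_z f (x, y, z))%E.
  exact: (@measurable_fun_fubini_tonelli_F _ _ _ _ _ mu _ mF F0).
have G0 x : (0 <= \int[mu]_y \int[mu]_z f (x, y, z))%E by exact: integral_ge0.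
etransitivity; first exact: (ge0_integral_affine1 a.1.1 e0 mG G0).
pose L z := (\int[mu]_t f (z, a.2 + e * t)%R)%E.
have maff (b : R) : measurable_fun setT (fun t : M => b + e * t : M).
  by apply: measurable_funD => //; apply: measurable_funM.
have mL : measurable_fun setT L.
  apply: (@measurable_fun_fubini_tonelli_F _ _ _ _ _ mu (fun u : T3 => f (u.1, a.2 + e * u.2))) => //.
  apply: (measurableT_comp mf); apply: measurable_fun_pair => //.
  exact: (measurableT_comp (maff _)).
have L0 z : (0 <= L z)%E by exact: integral_ge0.
have eL z : (\int[mu]_t f (z, t) = e%:E * L z)%E.
  apply: (@ge0_integral_affine1 a.2 e (fun t : M => f (z, t)) e0) => //.
  exact: measurableT_comp.
have mL1 x : measurable_fun setT (fun y => L (x, y)).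
  exact: (measurableT_comp mL).
pose K x := (\int[mu]_y L (a.1.1 + e * x, a.1.2 + e * y)%R)%E.
have mK : measurable_fun setT K.
  apply: (@measurable_fun_fubini_tonelli_F _ _ _ _ _ mu (fun u : (M * M)%type => L (a.1.1 + e * u.1, a.1.2 + e * u.2))) => //.
  apply: (measurableT_comp mL); apply: measurable_fun_pair => //.
    exact: (measurableT_comp (maff _)).
  exact: (measurableT_comp (maff _)).
have K0 x : (0 <= K x)%E by exact: integral_ge0.
have eK x : (\int[mu]_y \int[mu]_t f ((a.1.1 + e * x)%R, y, t) =
    (e ^+ 2)%:E * K x)%E.
  under eq_integral do rewrite eL.
  rewrite (ge0_integralZl mu measurableT (mL1 _) (fun x _ => L0 _) ee0).
  rewrite expr2 EFinM -muleA; congr (_ * _)%E.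
  apply: (@ge0_integral_affine1 a.1.2 e (fun t => L (a.1.1 + e * x, t)) e0) => //.
under eq_integral do rewrite eK.
have e20 : (0 <= (e ^+ 2)%:E)%E by rewrite lee_fin exprn_ge0 ?ltW.
rewrite (ge0_integralZl mu measurableT mK (fun x _ => K0 x) e20).
by rewrite muleA -EFinM -exprS.
Qed.

Lemma ge0_integral_prod3 (f g h : M -> \bar R) :
  measurable_fun setT f -> measurable_fun setT g -> measurable_fun setT h ->
  (forall x, 0 <= f x)%E -> (forall x, 0 <= g x)%E -> (forall x, 0 <= h x)%E ->
  (\int[leb3m]_z (f z.1.1 * g z.1.2 * h z.2) =
   \int[mu]_t f t * \int[mu]_t g t * \int[mu]_t h t)%E.
Proof.
move=> mf mg mh f0 g0 h0.
have m1 : measurable_fun setT (fun z : T3 => f z.1.1).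
  by apply: (measurableT_comp mf); exact: (@measurable_fst3 _ (T3) id).
have m2 : measurable_fun setT (fun z : T3 => g z.1.2).
  by apply: (measurableT_comp mg); exact: (@measurable_snd3 _ (T3) id).
have m3 : measurable_fun setT (fun z : T3 => h z.2).
  by apply: (measurableT_comp mh); exact: (@measurable_thd3 _ (T3) id).
have fg0 x y : (0 <= f x * g y)%E by exact: mule_ge0.
rewrite (ge0_integral3 (emeasurable_funM (emeasurable_funM m1 m2) m3)); last first.
  by move=> x; exact: mule_ge0.
have h'0 : (0 <= \int[mu]_t h t)%E by exact: integral_ge0.
have g'0 : (0 <= \int[mu]_t g t)%E by exact: integral_ge0.
transitivity (\int[mu]_x \int[mu]_y (f x * g y * \int[mu]_t h t))%E.
  apply: eq_integral => x _; apply: eq_integral => y _ /=.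
  exact: (ge0_integralZl mu measurableT mh (fun x _ => h0 x) (fg0 x y)).
transitivity (\int[mu]_x (f x * (\int[mu]_t g t * \int[mu]_t h t)))%E.
  apply: eq_integral => x _.
  under eq_integral do rewrite -muleA.
  have mgh : measurable_fun setT (fun y => g y * \int[mu]_t h t)%E.
    by apply: emeasurable_funM.
  rewrite (ge0_integralZl mu measurableT mgh (fun y _ => mule_ge0 (g0 y) h'0) (f0 x)).
  by rewrite (ge0_integralZr mu measurableT mg (fun y _ => g0 y) h'0).
by rewrite (ge0_integralZr mu measurableT mf (fun y _ => f0 y) (mule_ge0 g'0 h'0)) muleA.
Qed.

End MeasureR3.

(** * Integrable functions are determined by their integrals over boxes *)

Section Density.
Context d (T : measurableType d) (R : realType) (m : {measure set T -> \bar R}).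
Variables (f : T -> \bar R) (mf : measurable_fun setT f).
Hypothesis f0 : forall x, (0 <= f x)%E.

Definition density (A : set T) : \bar R := (\int[m]_(x in A) f x)%E.

Let density0 : density set0 = 0%E.
Proof. exact: integral_set0. Qed.

Let density_ge0 A : (0 <= density A)%E.
Proof. by apply: integral_ge0 => x _; exact: f0. Qed.

Let density_sigma_additive : semi_sigma_additive density.
Proof. exact: semi_sigma_additive_nng_induced. Qed.

HB.instance Definition _ := isMeasure.Build _ _ _ density
  density0 density_ge0 density_sigma_additive.

Definition density_measure : {measure set T -> \bar R} := density.

End Density.

Section BoxUnique.
Variable R : realType.
Local Notation leb3m := (@leb3m R).
Local Notation M := (measurableTypeR R).
Local Notation T3 := (M * M * M)%type.

Definition oc3 (a b : T3) : set (T3) :=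
  box3 `]a.1.1, b.1.1]%classic `]a.1.2, b.1.2]%classic `]a.2, b.2]%classic.

Lemma measurable_oc3 a b : measurable (oc3 a b).
Proof. by apply: measurable_box3; exact: measurable_itv. Qed.

Definition cst3 (t : R) : T3 := ((t, t), t).

Let boxes : set (set (T3)) := [set oc3 ab.1 ab.2 | ab in [set: T3 * T3]].

Lemma oc3I a b c d : oc3 a b `&` oc3 c d =
  oc3 ((Num.max a.1.1 c.1.1, Num.max a.1.2 c.1.2), Num.max a.2 c.2)
      ((Num.min b.1.1 d.1.1, Num.min b.1.2 d.1.2), Num.min b.2 d.2).
Proof.
apply/seteqP; split => -[[x y] z]; rewrite /oc3 /box3/= !in_itv/= !gt_max !le_min.
  by move=> [[[/andP[-> ->] /andP[-> ->]] /andP[-> ->]] [[/andP[-> ->] /andP[-> ->]] /andP[-> ->]]].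
by move=> [[/andP[/andP[-> ->] /andP[-> ->]] /andP[/andP[-> ->] /andP[-> ->]]] /andP[/andP[-> ->] /andP[-> ->]]].
Qed.

Lemma bigcup_oc3 : \bigcup_n oc3 (cst3 (- n%:R)) (cst3 n%:R) = [set: T3].
Proof.
apply/seteqP; split => // -[[x y] z] _.
pose M := `|x| + `|y| + `|z|.
have Mt t : t \in [:: x; y; z] -> `|t| <= M.
  rewrite /M !inE => /or3P[] /eqP ->; rewrite -?addrA.
  - by rewrite lerDl addr_ge0.
  - by rewrite addrCA lerDl addr_ge0.
  - by rewrite addrA lerDr addr_ge0.
have [n Mn] : exists n : nat, M < n%:R.
  by exists (Num.trunc M).+1; rewrite truncnS_gt.
exists n => //; rewrite /oc3 /box3/= !in_itv/=.
have H t : t \in [:: x; y; z] -> (- n%:R < t) && (t <= n%:R).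
  move=> /Mt/le_lt_trans/(_ Mn); rewrite ltr_norml => /andP[-> /ltW ->] //.
by split; [split|]; apply: H; rewrite !inE eqxx ?orbT.
Qed.

(** For the nontrivial inclusion, the identity from the sigma-algebra of boxes is shown measurable,
    coordinate by coordinate: the preimage of a half-open interval is a slab, the union over n of
    boxes of half-width n in the other two directions. *)
Lemma measurable_oc3_gen : @measurable _ (T3) = <<s boxes >>.
Proof.
apply/seteqP; split; last first.
  apply: smallest_sub; first exact: sigma_algebra_measurable.
  by move=> _ [ab _ <-]; exact: measurable_oc3.
pose T := g_sigma_algebraType boxes.
have mb a b : @measurable _ T (oc3 a b) by apply: sub_sigma_algebra; exists (a, b).
have mitv (i : T -> M) : (forall a b, exists F : nat -> T3 * T3,
    i @^-1` `]a, b]%classic = \bigcup_n oc3 (F n).1 (F n).2) -> measurable_fun [set: T] i.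
  move=> iF; apply: (@measurability _ _ _ (measurableTypeR R) _ _ (@ocitv R)) => //.
  move=> _ [_ [[a b] _ <-] <-]; rewrite setTI.
  have [F ->] := iF a b; apply: bigcupT_measurable => n; exact: mb.
have mid : measurable_fun [set: T] (id : T -> T3).
  rewrite (_ : id = (fun x : T3 => ((x.1.1, x.1.2), x.2))); last first.
    by apply/funext => -[[]].
  have cover (x y z : R) : exists n, oc3 (cst3 (- n%:R)) (cst3 n%:R) ((x, y), z).
    have [n _ hn] : (\bigcup_n oc3 (cst3 (- n%:R)) (cst3 n%:R)) ((x, y), z) by rewrite bigcup_oc3.
    by exists n.
  apply: measurable_triple; apply: mitv => a b.
  - exists (fun n => (((a, - n%:R), - n%:R), ((b, n%:R), n%:R))).
    apply/seteqP; split => -[[x y] z] /=; last first.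
      by move=> [n _ [[]]].
    by move=> xab; have [n] := cover x y z; move=> [[_ h2] h3]; exists n.
  - exists (fun n => (((- n%:R, a), - n%:R), ((n%:R, b), n%:R))).
    apply/seteqP; split => -[[x y] z] /=; last first.
      by move=> [n _ [[]]].
    by move=> xab; have [n] := cover x y z; move=> [[h1 h2] h3]; exists n.
  - exists (fun n => (((- n%:R, - n%:R), a), ((n%:R, n%:R), b))).
    apply/seteqP; split => -[[x y] z] /=; last first.
      by move=> [n _ [[]]].
    by move=> xab; have [n] := cover x y z; move=> [[h1 h2] h3]; exists n.
by move=> X mX; have := mid measurableT X mX; rewrite setTI.
Qed.

(** The positive and negative parts of h are densities of two measures that agree on boxes. Boxes
    are stable under intersection, generate the sigma-algebra and exhaust space, so the measures
    coincide, hence so do their densities almost everywhere. *)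
Lemma ae_eq0_oc3 (h : T3 -> \bar R) : leb3m.-integrable setT h ->
  (forall a b, \int[leb3m]_(x in oc3 a b) h x = 0)%E ->
  ae_eq leb3m setT h (cst 0%E).
Proof.
move=> ih h0.
have mh : measurable_fun setT h by exact: measurable_int ih.
have mp := measurable_funepos mh; have mn := measurable_funeneg mh.
have ip := integrable_funepos measurableT ih.
have in_ := integrable_funeneg measurableT ih.
have key A : measurable A -> (\int[leb3m]_(x in A) h^\+ x = \int[leb3m]_(x in A) h^\- x)%E.
  pose m1 := density_measure leb3m mp (fun x => funepos_ge0 h x).
  pose m2 := density_measure leb3m mn (fun x => funeneg_ge0 h x).
  move=> mA.
  have U := @measure_unique _ R (T3) boxes (fun n => oc3 (cst3 (- n%:R)) (cst3 n%:R)) measurable_oc3_gen.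
  apply: (U _ _ _ m1 m2 _ _ A mA).
  - move=> _ _ [[a b] _ <-] [[c d] _ <-]; rewrite oc3I.
    by eexists (_, _).
  - by move=> n; exists (cst3 (- n%:R), cst3 n%:R).
  - exact: bigcup_oc3.
  - move=> _ [[a b] _ <-] /=; rewrite /m1 /m2/= /density.
    have mo := measurable_oc3 a b.
    have fp : (\int[leb3m]_(x in oc3 a b) h^\+ x)%E \is a fin_num.
      by apply: integrable_fin_num => //; exact: integrableS ip.
    have fn : (\int[leb3m]_(x in oc3 a b) h^\- x)%E \is a fin_num.
      by apply: integrable_fin_num => //; exact: integrableS in_.
    have : (\int[leb3m]_(x in oc3 a b) h^\+ x - \int[leb3m]_(x in oc3 a b) h^\- x = 0)%E.
      by rewrite -[RHS](h0 a b) [RHS]integralE.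
    by rewrite -(fineK fp) -(fineK fn) -EFinB => -[] /eqP; rewrite subr_eq0 => /eqP ->.
  - move=> k; rewrite /m1/= /density; apply: integrable_lty => //.
      exact: measurable_oc3.
    by apply: (integrableS _ _ _ ip) => //; exact: measurable_oc3.
have H : ae_eq leb3m setT h^\+%E h^\-%E.
  by apply: integral_ae_eq => // E _ mE; exact: key.
(* At each point one of the two parts is 0, so their equality forces h to vanish there. *)
apply: filterS H => x /(_ I) /= + _; rewrite funeposE funenegE.
case: (h x) => [r| |]//.
- have [r0|r0] := leP r 0.
    rewrite max_r ?lee_fin// max_l; last by rewrite -EFinN lee_fin oppr_ge0.
    by move=> [] /eqP; rewrite eq_sym oppr_eq0 => /eqP ->.
  rewrite max_l ?lee_fin ?ltW// max_r => [->//|].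
  by rewrite -EFinN lee_fin oppr_le0 ltW.
- by rewrite max_l ?leey// max_r.
- by rewrite max_r// max_l ?leey.
Qed.

End BoxUnique.

(** * Integrable singularities *)

Section Kernel1.
Variable R : realType.
Local Notation mu := (@lebesgue_measure R).
Local Notation M := (measurableTypeR R).

Lemma even_integral_le (f : M -> \bar R) : measurable_fun setT f ->
  (forall t, 0 <= f t)%E -> (forall t, f (- t)%R = f t) ->
  (\int[mu]_t f t <= \int[mu]_(t in `[0%R, +oo[) f t + \int[mu]_(t in `[0%R, +oo[) f t)%E.
Proof.
move=> mf f0 fN.
have -> : [set: M] = `]-oo, 0%R]%classic `|` `]0%R, +oo[%classic.
  by rewrite -itv_bndbnd_setU// set_itvNyy.
rewrite ge0_integral_setU//=; first last.
- apply/disj_setPLR => x /=; rewrite !in_itv/= andbT => x0.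
  by apply/negP; rewrite -leNgt.
- exact: measurable_funTS.
rewrite {2}ge0_integration_by_substitution0//.
under [X in (_ <= _ + X)%E]eq_integral do rewrite fN.
rewrite addeC; apply: leeD => //; apply: ge0_subset_integral => //.
- exact: measurable_funTS.
- by apply: subset_itvr; rewrite bnd_simp.
Qed.

(** The integral is the increasing limit over the segments [1/(i+1), L], where the integrand is
    continuous; the primitive bounds each of them by L^(1-b)/(1-b). *)
Lemma integral_powRN_lty (b L : R) : b < 1 -> 0 < L ->
  (\int[mu]_(t in `]0%R, L]) (t `^ (- b))%:E < +oo)%E.
Proof.
move=> b1 L0; have b10 : 0 < 1 - b by rewrite subr_gt0.
pose F (i : nat) := `[i.+1%:R^-1, L]%classic : set M.
have FE : \bigcup_i F i = `]0%R, L]%classic.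
  apply/seteqP; split => x.
    move=> [i _]; rewrite /F/= !in_itv/= => /andP[ix ->]; rewrite andbT.
    by apply: lt_le_trans ix; rewrite invr_gt0.
  rewrite /= in_itv/= => /andP[x0 xL]; exists (Num.trunc x^-1) => //.
  rewrite /F/= in_itv/= xL andbT invf_ple ?posrE//.
  by apply: ltW; rewrite truncnS_gt.
have mp : measurable_fun [set: M] (fun t : M => (t `^ (- b))%:E).
  by apply/measurable_EFinP; exact: measurable_powR.
have ndF : nondecreasing_seq F.
  move=> i j ij; apply/subsetPset => x; rewrite /F/= !in_itv/= => /andP[ix ->].
  by rewrite andbT (le_trans _ ix)// lef_pV2 ?posrE// ler_nat.
have mF i : measurable (F i) by exact: measurable_itv.
have h := @ge0_nondecreasing_set_cvg_integral _ _ _ F _ mu ndF mF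
  (fun i => measurable_funTS mp)
  (fun i x _ => (ltac:(by rewrite lee_fin powR_ge0) : (0 <= (x `^ (- b))%:E)%E)).
rewrite FE in h; apply: (@le_lt_trans _ _ (L `^ (1 - b) / (1 - b))%:E); last exact: ltry.
rewrite -(cvg_lim _ h)//; apply: lime_le; first by apply/cvg_ex; eexists; exact: h.
apply: nearW => i.
(* For small i the segment may be a point or empty. *)
have [iL|Li] := ltP i.+1%:R^-1 L; last first.
  apply: (@le_trans _ _ 0%E); last by rewrite lee_fin divr_ge0 ?powR_ge0// ltW.
  rewrite /F; move: Li; rewrite le_eqVlt => /predU1P[<-|Li].
    by rewrite set_itv1 integral_set1.
  by rewrite set_itv_ge ?integral_set0// bnd_simp -ltNge.
have i0 : 0 < i.+1%:R^-1 :> R by rewrite invr_gt0.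
pose G (t : R) := (1 - b)^-1 * t `^ (1 - b).
have dG (x : R) : 0 < x -> is_derive x (1 : R) G (x `^ (- b)).
  move=> x0; apply: is_derive_eq (is_deriveZ (1 - b)^-1 (is_derive1_powR (1 - b) x0)) _.
  by rewrite -[_ *: _]/(_ * _) addrAC subrr add0r mulrA mulVf ?mul1r// gt_eqF.
have cpow (x : R) : 0 < x -> {for x, continuous (fun t => t `^ (- b))}.
  move=> x0; apply: differentiable_continuous; apply/derivable1_diffP.
  by apply: ex_derive; exact: is_derive1_powR.
have cG (x : R) : 0 < x -> {for x, continuous G}.
  move=> x0; apply: differentiable_continuous; apply/derivable1_diffP.
  by apply: ex_derive; exact: dG.
rewrite /F (@continuous_FTC2 _ _ G)//.
- rewrite -EFinB lee_fin /G mulrC gerBl//; by rewrite mulr_ge0 ?powR_ge0// invr_ge0 ltW.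
- apply: continuous_in_subspaceT => x; rewrite inE/= in_itv/= => /andP[ix _].
  by apply: cpow; exact: lt_le_trans ix.
- split.
  + move=> x; rewrite in_itv/= => /andP[ix _].
    by apply: ex_derive; apply: dG; exact: lt_trans ix.
  + by apply: cvg_at_right_filter; exact: cG.
  + by apply: cvg_at_left_filter; apply: cG; exact: lt_trans iL.
- move=> x; rewrite in_itv/= => /andP[ix _].
  rewrite derive1E; apply: derive_val; apply: dG; exact: lt_trans ix.
Qed.

(* The value +oo at 0 makes [le_kap3] hold on the coordinate planes. *)
Definition kappa (b L t : R) : \bar R :=
  if `|t| <= L then (if t == 0%R then +oo else (`|t| `^ (- b))%:E)%E else 0%E.

Lemma kappa_ge0 b L t : (0 <= kappa b L t)%E.
Proof. by rewrite /kappa; do 2 case: ifP => //; rewrite lee_fin powR_ge0. Qed.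

Lemma measurable_kappa b L : measurable_fun [set: M] (kappa b L).
Proof.
have mn : measurable_fun [set: M] (fun t : M => `|t| : R) by exact: (@normr_measurable R setT).
apply: measurable_fun_if => //.
- by apply: measurable_fun_ler.
- apply: measurable_funTS; apply: measurable_fun_if => //.
  + exact: measurable_fun_eqr.
  + apply: measurable_funTS; apply/measurable_EFinP.
    by apply: (measurableT_comp (measurable_powR _)).
Qed.

Lemma integral_kappa_lty b L : b < 1 -> 0 < L -> (\int[mu]_t kappa b L t < +oo)%E.
Proof.
move=> b1 L0.
have mk := measurable_kappa b L; have k0 := kappa_ge0 b L.
apply: (le_lt_trans (even_integral_le mk k0 _)).
  by move=> t; rewrite /kappa normrN oppr_eq0.
suff : (\int[mu]_(t in `[0%R, +oo[) kappa b L t < +oo)%E by move=> h; rewrite lte_add_pinfty.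
(* Removing the endpoint 0, a null set, disposes of the value +oo. *)
rewrite -integral_itv_obnd_cbnd; last exact: measurable_funTS.
have -> : `]0%R, +oo[%classic = (`]0%R, L]%classic `|` `]L, +oo[%classic) :> set M.
  by rewrite -itv_bndbnd_setU// bnd_simp ltW.
rewrite ge0_integral_setU//=; first last.
- apply/disj_setPLR => x /=; rewrite !in_itv/= andbT => /andP[_ x0].
  by apply/negP; rewrite -leNgt.
- exact: measurable_funTS.
rewrite [X in (_ + X)%E]integral0_eq ?adde0; last first.
  move=> x; rewrite /= in_itv/= andbT /kappa => Lx.
  suff -> : `|x| <= L = false by [].
  by rewrite ger0_norm ?(ltW (lt_trans L0 Lx))// leNgt Lx.
apply: le_lt_trans (integral_powRN_lty b1 L0); apply/le_of_eq/eq_integral => x; rewrite inE/= in_itv/= /kappa => /andP[x0 xL].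
by rewrite (gtr0_norm x0) xL gt_eqF.
Qed.

(** The exponent 5/6 is a third of 5/2: (|z|^2 + 1)^(-5/2) is split into three equal factors, one
    per coordinate. Since (1 + t)^2 <= 2 (1 + t^2), the integrand is at most a multiple of (1 +
    t)^(-5/3), whose primitive is explicit. *)
Lemma integral_1Dsqr_powR_lty :
  (\int[mu]_t ((1 + t ^+ 2) `^ (- (5 / 6)))%:E < +oo)%E.
Proof.
have m1 : measurable_fun [set: M] (fun t : M => ((1 + t ^+ 2) `^ (- (5 / 6)))%:E).
  apply/measurable_EFinP; apply: (measurableT_comp (measurable_powR _)).
  by apply: measurable_funD => //; exact: measurable_funX.
apply: (le_lt_trans (even_integral_le m1 _ _)).
- by move=> t; rewrite lee_fin powR_ge0.
- by move=> t; rewrite sqrrN.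
suff h : (\int[mu]_(t in `[0%R, +oo[) ((1 + t ^+ 2) `^ (- (5 / 6)))%:E < +oo)%E by rewrite lte_add_pinfty.
pose f (t : R) := 2 `^ (5/6) * (1 + t) `^ (- (5 / 3)).
pose F (t : R) := - (2 `^ (5/6) * (3 / 2) * (1 + t) `^ (- (2 / 3))).
have dF (x : R) : -1 < x -> is_derive x (1 : R) F (f x).
  move=> x1; have x10 : 0 < 1 + x by rewrite -ltrBlDl sub0r.
  have d1 : is_derive x (1:R) (fun t : R => 1 + t) 1.
    by apply: is_derive_eq (is_deriveD (is_derive_cst (1:R) x (1:R)) (is_derive_id x (1:R))) _; rewrite add0r.
  have d2 := is_derive1_comp (@is_derive1_powR R (- (2/3)) (1 + x) x10) d1.
  have d3 : is_derive x (1:R) F (- (2 `^ (5/6) * (3 / 2) * (- (2 / 3) * (1 + x) `^ (- (2 / 3) - 1) * 1))).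
    rewrite /F; have := is_deriveN (is_deriveZ (2 `^ (5/6) * (3 / 2)) d2).
    exact.
  apply: (is_derive_eq d3).
  rewrite /f mulr1 (_ : - (2 / 3) - 1 = - (5 / 3) :> R); last by lra.
  by rewrite mulrA -mulNr; congr (_ * _); field.
have cF (x : R) : -1 < x -> {for x, continuous F}.
  move=> x0; apply: differentiable_continuous; apply/derivable1_diffP.
  by have [] := dF x x0.
have cf (x : R) : -1 < x -> {for x, continuous f}.
  move=> x1; have x10 : 0 < 1 + x by rewrite -ltrBlDl sub0r.
  apply: differentiable_continuous; apply/derivable1_diffP.
  have d1 : is_derive x (1:R) (fun t : R => 1 + t) 1.
    by apply: is_derive_eq (is_deriveD (is_derive_cst (1:R) x (1:R)) (is_derive_id x (1:R))) _; rewrite add0r.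
  have d2 := is_derive1_comp (@is_derive1_powR R (- (5/3)) (1 + x) x10) d1.
  by have [] := is_deriveZ (2 `^ (5/6)) d2.
apply: (@le_lt_trans _ _ (\int[mu]_(t in `[0%R, +oo[) (f t)%:E)%E).
  apply: ge0_le_integral => //.
  - by move=> x _; rewrite lee_fin powR_ge0.
  - exact: measurable_funTS.
  - apply: measurable_funTS; apply/measurable_EFinP; apply: measurable_funM => //.
    by apply: (measurableT_comp (measurable_powR _)); exact: measurable_funD.
  - move=> x; rewrite /= in_itv/= andbT => x0; rewrite lee_fin /f.
    have h1 : (1 + x) `^ (- (5 / 3)) = ((1 + x) ^+ 2) `^ (- (5 / 6)).
      by rewrite -powR_mulrn ?addr_ge0// -powRrM; congr (_ `^ _); field.
    have x12 : 0 < (1 + x) ^+ 2 by rewrite exprn_gt0// ltr_pwDl.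
    have x22 : 0 < 1 + x ^+ 2 by rewrite ltr_pwDl// sqr_ge0.
    have q0 : 0 <= 5 / 6 :> R by rewrite divr_ge0.
    have h2 : ((1 + x) ^+ 2) `^ (5 / 6) <= (2 * (1 + x ^+ 2)) `^ (5 / 6).
      apply: (ge0_ler_powR q0); rewrite ?nnegrE; [exact: ltW|by rewrite mulr_ge0 ?ltW|].
      by rewrite -subr_ge0 (_ : _ - _ = (1 - x) ^+ 2) ?sqr_ge0//; ring.
    rewrite h1 !powRN ler_pdivlMr ?powR_gt0// mulrC ler_pdivrMr ?powR_gt0//.
    by rewrite -powRM// ltW.
suff -> : (\int[mu]_(t in `[0%R, +oo[) (f t)%:E = 0%:E - (F 0)%:E)%E.
  by rewrite -EFinB; exact: ltry.
apply: ge0_continuous_FTC2y.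
- by move=> x _; rewrite mulr_ge0 ?powR_ge0.
- apply: continuous_in_subspaceT => x; rewrite inE/= in_itv/= andbT => x0.
  by apply: cf; apply: lt_le_trans x0; lra.
- have h : (1 + x) `^ (- (2 / 3)) @[x --> +oo%R] --> (0 : R).
    apply/cvgrPdist_lt => e e0; near=> x.
    have x0 : (e^-1) `^ (3 / 2) < x.
      by near: x; apply: nbhs_pinfty_gt; rewrite num_real.
    have x1 : 0 < 1 + x by rewrite ltr_pwDl// ltW// (le_lt_trans _ x0)// powR_ge0.
    rewrite sub0r normrN ger0_norm ?powR_ge0// powRN -[ltRHS]invrK.
    rewrite ltf_pV2 ?posrE ?powR_gt0 ?invr_gt0//.
    have -> : e^-1 = ((e^-1) `^ (3 / 2)) `^ (2 / 3).
      by rewrite -powRrM (_ : 3 / 2 * (2 / 3) = 1) ?powRr1 ?invr_ge0 ?ltW//; field.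
    apply: gt0_ltr_powR; rewrite ?nnegrE ?powR_ge0 ?ltW ?divr_gt0//.
    by rewrite (lt_trans x0)// ltrDr.
  have := cvgN (cvgMl_tmp (a := 2 `^ (5/6) * (3 / 2)) h).
  by rewrite mulr0 oppr0; exact.
- by move=> x x0; have [|] := dF x _; first by lra.
- by apply: cvg_at_right_filter; apply: cF; lra.
- move=> x; rewrite in_itv/= andbT => x0; rewrite derive1E; apply: derive_val; apply: dF; lra.
Unshelve. all: by end_near. Qed.

End Kernel1.

(** * Majorants of the kernel in three variables *)

Section Kernel3.
Variable R : realType.
Local Notation mu := (@lebesgue_measure R).
Local Notation leb3m := (@leb3m R).
Local Notation M := (measurableTypeR R).
Local Notation T3 := (M * M * M)%type.
Implicit Types x y z : R3 R.

Lemma measurable_coord3 (k : 'I_3) : measurable_fun [set: T3] (fun z : T3 => coord3 (z : R3 R) k).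
Proof. by apply: continuous_measurable_fun3; exact: coord3_continuous. Qed.

Lemma measurable_nsq3 : measurable_fun [set: T3] (fun z : T3 => nsq3 (z : R3 R)).
Proof.
apply: measurable_sum => k; apply: measurable_funX; exact: measurable_coord3.
Qed.

Lemma measurable_subr3 d (T : measurableType d) (f g : T -> T3) :
  measurable_fun setT f -> measurable_fun setT g ->
  measurable_fun setT (fun u => (f u : R3 R) - g u : T3).
Proof.
move=> mf mg.
have p (i : 'I_3) : measurable_fun setT (fun u => coord3 (f u : R3 R) i - coord3 (g u : R3 R) i).
  by apply: measurable_funB; exact: (measurableT_comp (measurable_coord3 i)).
exact: (measurable_triple (p 0) (p 1) (p 2)).
Qed.

Lemma measurable_sub3 : measurable_fun [set: T3 * T3] (fun u : T3 * T3 => ((u.2 : R3 R) - u.1) : T3).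
Proof. by apply: measurable_subr3. Qed.

Lemma measurable_subl x : measurable_fun [set: T3] (fun y : T3 => ((y : R3 R) - x) : T3).
Proof. by apply: measurable_subr3. Qed.

Lemma sub_aff3 x e z : (aff3 x e z : R3 R) - x = e *: z.
Proof.
by rewrite /aff3; case: x z => [[x1 x2] x3] [[z1 z2] z3]; congr (_, _, _);
  rewrite /= addrC addKr.
Qed.

Lemma ge0_integral_shift3 x (f : T3 -> \bar R) : measurable_fun setT f ->
  (forall z, 0 <= f z)%E ->
  (\int[leb3m]_y f ((y : R3 R) - x)%R = \int[leb3m]_z f z)%E.
Proof.
move=> mf f0.
have mfx : measurable_fun [set: T3] (fun y : T3 => f ((y : R3 R) - x)).
  exact: (measurableT_comp mf (measurable_subl x)).
rewrite (ge0_integral_affine3 x ltr01 mfx (fun y => f0 _)) expr1n mul1e.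
by apply: eq_integral => z _; rewrite sub_aff3 scale1r.
Qed.

(** A product majorant of |z|^(-a) on the cube of half-side L, which Tonelli reduces to one
    variable. *)
Definition kap3 (a L : R) z : \bar R :=
  (kappa (a / 3) L z.1.1 * kappa (a / 3) L z.1.2 * kappa (a / 3) L z.2)%E.

Lemma kap3_ge0 a L z : (0 <= kap3 a L z)%E.
Proof. by rewrite !mule_ge0// kappa_ge0. Qed.

Lemma measurable_kap3 a L : measurable_fun [set: T3] (fun z : T3 => kap3 a L z).
Proof.
apply: emeasurable_funM; first apply: emeasurable_funM.
- exact: (measurableT_comp (measurable_kappa _ _) (@measurable_fst3 R _ T3 id _)).
- exact: (measurableT_comp (measurable_kappa _ _) (@measurable_snd3 R _ T3 id _)).
- exact: (measurableT_comp (measurable_kappa _ _) (@measurable_thd3 R _ T3 id _)).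
Qed.

Lemma kap3N a L z : kap3 a L (- z) = kap3 a L z.
Proof.
by case: z => [[z1 z2] z3]; rewrite /kap3 /kappa/= !normrN !oppr_eq0.
Qed.

Lemma integral_kap3_lty a L : a < 3 -> 0 < L -> (\int[leb3m]_z kap3 a L z < +oo)%E.
Proof.
move=> a3 L0; have b1 : a / 3 < 1 by rewrite ltr_pdivrMr ?mul1r.
have mk := measurable_kappa (a / 3) L.
have k0 := kappa_ge0 (a / 3) L.
have kfin : (\int[mu]_t kappa (a / 3) L t)%E \is a fin_num.
  by rewrite ge0_fin_numE ?integral_kappa_lty//; exact: integral_ge0.
rewrite (ge0_integral_prod3 mk mk mk k0 k0 k0).
by rewrite ltey_eq !fin_numM.
Qed.

Definition sup3 z : R := Num.max (Num.max `|z.1.1| `|z.1.2|) `|z.2|.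

Lemma sup3_le z (L : R) : (sup3 z <= L) = [&& `|z.1.1| <= L, `|z.1.2| <= L & `|z.2| <= L].
Proof. by rewrite /sup3 !ge_max andbA. Qed.

Lemma sup3B x y (L : R) : sup3 x <= L -> sup3 y <= L -> sup3 (y - x) <= 2 * L.
Proof.
rewrite !sup3_le => /and3P[x1 x2 x3] /and3P[y1 y2 y3].
rewrite mulr_natl mulr2n; apply/and3P; split.
- by rewrite (le_trans (ler_normB _ _))// lerD.
- by rewrite (le_trans (ler_normB _ _))// lerD.
- by rewrite (le_trans (ler_normB _ _))// lerD.
Qed.

Lemma coord3_le_enorm z (k : 'I_3) : `|coord3 z k| <= enorm z.
Proof.
rewrite -sqrtr_sqr ler_sqrt ?nsq3_ge0// /nsq3 (bigD1 k)//= lerDl.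
by apply: sumr_ge0 => i _; exact: sqr_ge0.
Qed.

Lemma sup3_le_enorm z : sup3 z <= enorm z.
Proof.
have h := coord3_le_enorm z.
by rewrite sup3_le; apply/and3P; split; [exact: (h 0)|exact: (h 1)|exact: (h 2)].
Qed.

Lemma enorm_ge0 z : 0 <= enorm z.
Proof. exact: sqrtr_ge0. Qed.

Lemma enorm_eq0 z : enorm z = 0 -> z = 0.
Proof.
move=> z0; have := sup3_le_enorm z; rewrite z0 sup3_le !normr_le0.
by case: z {z0} => [[z1 z2] z3] /= /and3P[/eqP-> /eqP-> /eqP->].
Qed.

Lemma enorm0 : enorm (0 : R3 R) = 0.
Proof.
rewrite enormE /nsq3 big1 ?sqrtr0// => k _.
by rewrite coord3_0 expr0n.
Qed.

(** The power is split into three equal factors, and in each |z| is replaced by the smaller |z_i|,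
    which increases a negative power. At the origin the left side is 0, by convention for powers of
    0. *)
Lemma le_kap3 a L z : 0 < a -> sup3 z <= L -> ((enorm z `^ (- a))%:E <= kap3 a L z)%E.
Proof.
move=> a0 zL; set b := a / 3.
have b0 : 0 < b by rewrite divr_gt0.
have := enorm_ge0 z; rewrite le_eqVlt => /predU1P[/esym z0|z0].
  by rewrite z0 powR0 ?oppr_eq0 ?gt_eqF// kap3_ge0.
have h t : `|t| <= enorm z -> `|t| <= L -> ((enorm z `^ (- b))%:E <= kappa b L t)%E.
  move=> tz tL; rewrite /kappa tL; case: eqVneq => [_|t0]; first by rewrite leey.
  rewrite lee_fin !powRN lef_pV2 ?posrE ?powR_gt0 ?normr_gt0//.
  by apply: (ge0_ler_powR (ltW b0)); rewrite ?nnegrE ?normr_ge0// ltW.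
have -> : enorm z `^ (- a) = enorm z `^ (- b) * enorm z `^ (- b) * enorm z `^ (- b).
  rewrite -!powRD ?(gt_eqF z0) ?implybT//; congr (_ `^ _).
  by rewrite /b; field.
have := sup3_le_enorm z; rewrite sup3_le => /and3P[n1 n2 n3].
move: zL; rewrite sup3_le => /and3P[l1 l2 l3].
rewrite !EFinM; apply: lee_pmul; rewrite ?mule_ge0 ?lee_fin ?powR_ge0//.
- by apply: lee_pmul; rewrite ?lee_fin ?powR_ge0//; exact: h.
- exact: h.
Qed.

Lemma measurable_inv_dist (e : R) :
  measurable_fun [set: T3 * T3] (fun u : T3 * T3 => inv_dist e (u.1 : R3 R) u.2).
Proof.
have -> : (fun u : T3 * T3 => inv_dist e (u.1 : R3 R) u.2) =
    (fun u => (nsq3 ((u.2 : R3 R) - u.1) + e ^+ 2) `^ (- 2^-1)).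
  apply/funext => u; rewrite powRN powR12_sqrt//.
  by rewrite addr_ge0 ?nsq3_ge0 ?sqr_ge0.
apply: (measurableT_comp (measurable_powR _)); apply: measurable_funD => //.
exact: (measurableT_comp measurable_nsq3 measurable_sub3).
Qed.

Lemma measurable_kern (e : R) m :
  measurable_fun [set: T3 * T3] (fun u : T3 * T3 => kern e m (u.1 : R3 R) u.2).
Proof.
apply: measurableT_comp => //; apply: measurable_funM.
  exact: (measurableT_comp (measurable_coord3 m) measurable_sub3).
by apply: measurable_funX; exact: measurable_inv_dist.
Qed.

Lemma inv_dist_ge0 (e : R) x y : 0 <= inv_dist e x y.
Proof. by rewrite invr_ge0 sqrtr_ge0. Qed.

Lemma inv_dist_le (e : R) x y : 0 < enorm (y - x) -> inv_dist e x y <= (enorm (y - x))^-1.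
Proof.
move=> p; rewrite lef_pV2 ?posrE// ?sqrtr_gt0.
  by rewrite ler_sqrt ?addr_ge0 ?nsq3_ge0 ?sqr_ge0// lerDl sqr_ge0.
by rewrite ltr_wpDr ?sqr_ge0//; rewrite enormE sqrtr_gt0 in p.
Qed.

Lemma inv_dist_le_inv (e : R) x y : 0 < e -> inv_dist e x y <= e^-1.
Proof.
move=> e0; have p0 : 0 < nsq3 (y - x) + e ^+ 2 by rewrite ltr_wpDl ?nsq3_ge0// exprn_gt0.
rewrite /inv_dist lef_pV2 ?posrE ?sqrtr_gt0//.
have : Num.sqrt (e ^+ 2) <= Num.sqrt (nsq3 (y - x) + e ^+ 2).
  by rewrite ler_sqrt ?(ltW p0)// lerDr nsq3_ge0.
by rewrite sqrtr_sqr gtr0_norm.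
Qed.

(** Uniform in e, so that one majorant serves the whole passage to the limit, e = 0 included. On the
    diagonal both sides are 0. *)
Lemma kern_le (e : R) m x y : `|kern e m x y| <= enorm (y - x) `^ (- 2).
Proof.
rewrite normrN normrM normrX (ger0_norm (inv_dist_ge0 _ _ _)).
have := enorm_ge0 (y - x); rewrite le_eqVlt => /predU1P[/esym z0|z0].
  have -> : y - x = 0 by exact: enorm_eq0.
  by rewrite coord3_0 normr0 mul0r powR_ge0.
apply: (@le_trans _ _ (enorm (y - x) * (enorm (y - x))^-1 ^+ 3)).
  apply: ler_pM => //; rewrite ?exprn_ge0 ?inv_dist_ge0 ?coord3_le_enorm//.
  apply: lerXn2r; [by rewrite nnegrE inv_dist_ge0| |exact: inv_dist_le].
  by rewrite nnegrE invr_ge0 ltW.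
rewrite powRN powR_mulrn ?(ltW z0)//; apply: le_of_eq.
by field; rewrite gt_eqF.
Qed.

Lemma cvg_kern m x y : kern n.+1%:R^-1 m x y @[n --> \oo] --> kern 0 m x y.
Proof.
have := enorm_ge0 (y - x); rewrite le_eqVlt => /predU1P[/esym z0|z0].
  have z : y - x = 0 by exact: enorm_eq0.
  rewrite /kern z coord3_0 mul0r oppr0; under eq_fun do rewrite mul0r oppr0.
  exact: cvg_cst.
apply: cvgN; apply: cvgM; first exact: cvg_cst.
have hJ : inv_dist n.+1%:R^-1 x y @[n --> \oo] --> inv_dist 0 x y.
  rewrite /inv_dist; apply: cvgV.
    by rewrite expr0n/= addr0 -enormE gt_eqF.
  apply: (cvg_comp (fun n => nsq3 (y - x) + n.+1%:R^-1 ^+ 2) Num.sqrt); last exact: sqrt_continuous.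
  apply: cvgD; first exact: cvg_cst.
  rewrite !expr2; under eq_fun do rewrite expr2.
  by apply: cvgM; exact: cvg_harmonic.
by rewrite !exprS expr0; under eq_fun do rewrite !exprS expr0;
  do 3 (apply: cvgM; first exact: hJ); exact: cvg_cst.
Qed.

End Kernel3.

(** * The representation formula *)

Section ApproxIdentity.
Variable R : realType.
Local Notation mu := (@lebesgue_measure R).
Local Notation leb3m := (@leb3m R).
Local Notation M := (measurableTypeR R).
Local Notation T3 := (M * M * M)%type.
Implicit Types x y z : R3 R.

(** For e != 0, minus one third of the Laplacian of [inv_dist e x]: with J the inverse distance, 3
    |y-x|^2 J^5 - 3 J^3 = - 3 e^2 J^5. It scales as an approximate identity. *)
Definition rho (e : R) x y : R := e ^+ 2 * inv_dist e x y ^+ 5.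

Lemma rho_ge0 e x y : 0 <= rho e x y.
Proof. by rewrite mulr_ge0 ?sqr_ge0 ?exprn_ge0 ?inv_dist_ge0. Qed.

Lemma nsq3Z (e : R) z : nsq3 (e *: z) = e ^+ 2 * nsq3 z.
Proof.
rewrite /nsq3 mulr_sumr; apply: eq_bigr => k _; rewrite -exprMn; congr (_ ^+ 2).
by case: k => -[|[|[|//]]].
Qed.

Lemma nsq3N z : nsq3 (- z) = nsq3 z.
Proof. by rewrite -scaleN1r nsq3Z sqrrN expr1n mul1r. Qed.

Lemma rhoC e x y : rho e x y = rho e y x.
Proof. by rewrite /rho /inv_dist -(opprB x y) nsq3N. Qed.

Lemma rho_aff3 e x z : 0 < e -> rho e x (aff3 x e z) = e ^- 3 * rho 1 0 z.
Proof.
move=> e0; rewrite /rho /inv_dist sub_aff3 subr0 nsq3Z expr1n mul1r.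
have -> : e ^+ 2 * nsq3 z + e ^+ 2 = e ^+ 2 * (nsq3 z + 1) by ring.
rewrite sqrtrM ?sqr_ge0// sqrtr_sqr gtr0_norm//.
field; rewrite (gt_eqF e0)/= gt_eqF// sqrtr_gt0.
by rewrite ltr_wpDl ?nsq3_ge0.
Qed.

Lemma measurable_rho e :
  measurable_fun [set: T3 * T3] (fun u : T3 * T3 => rho e (u.1 : R3 R) u.2).
Proof.
apply: measurable_funM => //; apply: measurable_funX; exact: measurable_inv_dist.
Qed.

Lemma measurable_rhor e x : measurable_fun [set: T3] (fun y : T3 => rho e x y).
Proof. exact: (measurableT_comp (measurable_rho e) (pair1_measurable x)). Qed.

Lemma measurable_rhol e y : measurable_fun [set: T3] (fun x : T3 => rho e x y).
Proof. by under eq_fun do rewrite rhoC; exact: measurable_rhor. Qed.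

Lemma rho1_le z : rho 1 0 z <= (1 + z.1.1 ^+ 2) `^ (- (5 / 6)) *
  (1 + z.1.2 ^+ 2) `^ (- (5 / 6)) * (1 + z.2 ^+ 2) `^ (- (5 / 6)).
Proof.
have E : nsq3 z = z.1.1 ^+ 2 + z.1.2 ^+ 2 + z.2 ^+ 2.
  by rewrite /nsq3 !big_ord_recl big_ord0 addr0 addrA.
have p1 (t : R) : 0 < 1 + t ^+ 2 by rewrite ltr_pwDl ?sqr_ge0.
have p2 : 0 < nsq3 z + 1 by rewrite ltr_wpDl ?nsq3_ge0.
have -> : rho 1 0 z = (nsq3 z + 1) `^ (- (5 / 6)) * (nsq3 z + 1) `^ (- (5 / 6)) * (nsq3 z + 1) `^ (- (5 / 6)).
  rewrite -!powRD ?(gt_eqF p2) ?implybT//.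
  rewrite /rho /inv_dist subr0 expr1n mul1r -powR12_sqrt ?(ltW p2)//.
  rewrite exprVn -powR_mulrn ?powR_ge0// -powRrM -powRN; congr (_ `^ _).
  by field.
have q0 : 0 <= 5 / 6 :> R by rewrite divr_ge0.
have h t : 0 <= t -> 1 + t <= nsq3 z + 1 ->
    (nsq3 z + 1) `^ (- (5 / 6)) <= (1 + t) `^ (- (5 / 6)).
  move=> t0 tz; have t1 : 0 < 1 + t by rewrite ltr_pwDl.
  rewrite !powRN lef_pV2 ?posrE ?powR_gt0//.
  by apply: (ge0_ler_powR q0); rewrite ?nnegrE ?(ltW p2) ?(ltW t1).
have s1 := sqr_ge0 z.1.1; have s2 := sqr_ge0 z.1.2; have s3 := sqr_ge0 z.2.
by apply: ler_pM; rewrite ?mulr_ge0 ?powR_ge0//; [apply: ler_pM; rewrite ?powR_ge0//|];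
  apply: h => //; rewrite E; lra.
Qed.

Lemma integral_rho1_lty : (\int[leb3m]_z (rho 1 0 z)%:E < +oo)%E.
Proof.
pose g (t : M) : \bar R := ((1 + t ^+ 2) `^ (- (5 / 6)))%:E.
have g0 t : (0 <= g t)%E by rewrite lee_fin powR_ge0.
have mg : measurable_fun setT g.
  apply/measurable_EFinP; apply: (measurableT_comp (measurable_powR _)).
  by apply: measurable_funD => //; exact: measurable_funX.
apply: (@le_lt_trans _ _ (\int[leb3m]_z (g z.1.1 * g z.1.2 * g z.2))%E).
  apply: ge0_le_integral => //.
  - by move=> z _; rewrite lee_fin rho_ge0.
  - by apply/measurable_EFinP; exact: measurable_rhor.
  - apply: emeasurable_funM; first apply: emeasurable_funM.
    + exact: (measurableT_comp mg (@measurable_fst3 R _ T3 id _)).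
    + exact: (measurableT_comp mg (@measurable_snd3 R _ T3 id _)).
    + exact: (measurableT_comp mg (@measurable_thd3 R _ T3 id _)).
  - by move=> z _; rewrite /g -!EFinM lee_fin; exact: rho1_le.
have gfin : (\int[mu]_t g t)%E \is a fin_num.
  by rewrite ge0_fin_numE ?integral_1Dsqr_powR_lty//; exact: integral_ge0.
by rewrite (ge0_integral_prod3 mg mg mg g0 g0 g0) ltey_eq !fin_numM.
Qed.

Definition rho_mass : R := fine (\int[leb3m]_z (rho 1 0 z)%:E)%E.

Lemma rho_massE : (\int[leb3m]_z (rho 1 0 z)%:E = rho_mass%:E)%E.
Proof.
rewrite fineK// ge0_fin_numE ?integral_rho1_lty//.
by apply: integral_ge0 => z _; rewrite lee_fin rho_ge0.
Qed.

(** On the unit cube |z|^2 + 1 <= 4, so the integrand is at least 2^(-5) there. *)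
Lemma rho_mass_gt0 : 0 < rho_mass.
Proof.
rewrite -lte_fin -rho_massE.
pose Q := oc3 (cst3 (0 : R)) (cst3 1).
have mQ : measurable Q by exact: measurable_oc3.
have mQ1 : leb3m Q = 1%E.
  rewrite /Q /oc3 leb3_box3; [|exact: measurable_itv..].
  by rewrite !lebesgue_measure_itv/= !lte_fin ltr01 -EFinB subr0 !mule1.
apply: (@lt_le_trans _ _ (\int[leb3m]_(z in Q) (2 ^- 5)%:E)%E).
  have -> : (\int[leb3m]_(z in Q) (2 ^- 5)%:E = (2 ^- 5)%:E)%E.
    by rewrite integral_cst// -[RHS]mule1; congr (_ * _)%E; exact: mQ1.
  by rewrite lte_fin invr_gt0.
apply: (@le_trans _ _ (\int[leb3m]_(z in Q) (rho 1 0 z)%:E)%E).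
  apply: ge0_le_integral => //.
  - by apply/measurable_EFinP; apply: measurable_funTS; exact: measurable_rhor.
  - move=> z; rewrite /Q /oc3 /box3 /cst3/= !in_itv/= => -[[/andP[a1 b1] /andP[a2 b2]] /andP[a3 b3]].
    rewrite lee_fin /rho expr1n mul1r /inv_dist subr0 -exprVn.
    have sq (t : R) : 0 < t -> t <= 1 -> t ^+ 2 <= 1.
      by move=> t0 t1; rewrite expr_le1// ltW.
    have q4 : nsq3 z + 1 <= 2 ^+ 2.
      rewrite /nsq3 !big_ord_recl big_ord0 addr0.
      have := sq _ a1 b1; have := sq _ a2 b2; have := sq _ a3 b3.
      by rewrite /coord3/=; lra.
    have p : 0 < nsq3 z + 1 by rewrite ltr_wpDl ?nsq3_ge0.
    apply: lerXn2r; rewrite ?nnegrE ?invr_ge0 ?sqrtr_ge0//.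
    rewrite lef_pV2 ?posrE ?sqrtr_gt0 ?expr1n//.
    have : Num.sqrt (nsq3 z + 1) <= Num.sqrt (2 ^+ 2) by rewrite ler_sqrt.
    by rewrite sqrtr_sqr ger0_norm.
apply: ge0_subset_integral => //.
- by apply/measurable_EFinP; exact: measurable_rhor.
- by move=> z _; rewrite lee_fin rho_ge0.
Qed.

(** Substituting x = y + e z moves e from the kernel into the indicator; the weight [rho 1 0] is
    then a fixed integrable majorant. *)
Lemma integral_rho_indic (S : set T3) e y : measurable S -> 0 < e ->
  (\int[leb3m]_x (\1_S x * rho e x y)%:E =
   \int[leb3m]_z (\1_S (aff3 y e z) * rho 1 0 z)%:E)%E.
Proof.
move=> mS e0.
have m1 : measurable_fun [set: T3] (fun x : T3 => (\1_S x * rho e x y)%:E).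
  apply/measurable_EFinP; apply: measurable_funM; last exact: measurable_rhol.
  exact: measurable_indic.
rewrite (ge0_integral_affine3 y e0 m1); last first.
  by move=> x; rewrite lee_fin mulr_ge0 ?rho_ge0// indicE.
have m2 : measurable_fun [set: T3] (fun x : T3 => (\1_S (aff3 y e x) * rho e (aff3 y e x) y)%:E).
  exact: (measurableT_comp m1 (measurable_aff3 y e)).
rewrite -(ge0_integralZl _ measurableT m2).
- apply: eq_integral => z _; rewrite -EFinM rhoC rho_aff3//; congr (_%:E).
  by field; rewrite gt_eqF.
- by move=> x _; rewrite lee_fin mulr_ge0 ?rho_ge0// indicE.
- by rewrite lee_fin exprn_ge0// ltW.
Qed.

Lemma integral_rho_indic_le (S : set T3) e y : measurable S -> 0 < e ->
  (\int[leb3m]_x (\1_S x * rho e x y)%:E <= rho_mass%:E)%E.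
Proof.
move=> mS e0; rewrite integral_rho_indic// -rho_massE.
apply: ge0_le_integral => //.
- by move=> x _; rewrite lee_fin mulr_ge0 ?rho_ge0// indicE.
- apply/measurable_EFinP; apply: measurable_funM; last exact: measurable_rhor.
  exact: (measurableT_comp (measurable_indic mS) (measurable_aff3 y e)).
- by apply/measurable_EFinP; exact: measurable_rhor.
- move=> z _; rewrite lee_fin -[leRHS]mul1r ler_wpM2r ?rho_ge0// indicE.
Qed.

Lemma itvoc_near (a b t z : R) : t != a -> t != b ->
  \forall n \near \oo, (t + n.+1%:R^-1 * z \in `]a, b]) = (t \in `]a, b]).
Proof.
move=> ta tb.
have cv : t + n.+1%:R^-1 * z @[n --> \oo] --> t.
  rewrite -[X in _ --> X]addr0 -[X in _ + X](mul0r z).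
  by apply: cvgD; [exact: cvg_cst|apply: cvgMr_tmp; exact: cvg_harmonic].
have ha : \forall n \near \oo, (a < t + n.+1%:R^-1 * z) = (a < t).
  have [lat|tla] := ltP a t.
    by near=> n; apply/idP; near: n; apply: (cvgr_gt t).
  have {}tla : t < a by rewrite lt_neqAle ta.
  near=> n; apply/negbTE; rewrite -leNgt ltW//.
  by near: n; apply: (cvgr_lt t).
have hb : \forall n \near \oo, (t + n.+1%:R^-1 * z <= b) = (t <= b).
  have [ltb|btl] := leP t b.
    have {}ltb : t < b by rewrite lt_neqAle tb.
    near=> n; apply/idP; rewrite ltW//.
    by near: n; apply: (cvgr_lt t).
  near=> n; apply/negbTE; rewrite -ltNge.
  by near: n; apply: (cvgr_gt t).
near=> n; rewrite !in_itv/=; congr (_ && _); near: n; [exact: ha|exact: hb].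
Unshelve. all: by end_near. Qed.

(** Away from the planes that carry the faces, a small displacement of y does not change membership
    in the box; the exceptional set is null. *)
Definition off_faces (a b y : R3 R) := forall k : 'I_3,
  coord3 y k != coord3 a k /\ coord3 y k != coord3 b k.

Lemma cvg_integral_rho_indic (a b y : R3 R) : off_faces a b y ->
  (\int[leb3m]_x (\1_(oc3 a b) x * rho n.+1%:R^-1 x y)%:E)%E @[n --> \oo] -->
  (rho_mass * \1_(oc3 a b) y)%:E.
Proof.
move=> yf; set S := oc3 a b; have mS : measurable S by exact: measurable_oc3.
have e0 n : 0 < n.+1%:R^-1 :> R by rewrite invr_gt0.
under eq_cvg do rewrite integral_rho_indic//.
have mr := measurable_rhor 1 (0 : R3 R).
have E : (\int[leb3m]_z (\1_S y * rho 1 0 z)%:E)%E = (rho_mass * \1_S y)%:E.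
  under eq_integral do rewrite EFinM.
  rewrite ge0_integralZl//.
  - by rewrite rho_massE -EFinM mulrC.
  - exact/measurable_EFinP.
  - by move=> x _; rewrite lee_fin rho_ge0.
have mn n : measurable_fun [set: T3] (fun z : T3 => (\1_S (aff3 y n.+1%:R^-1 z) * rho 1 0 z)%:E).
  apply/measurable_EFinP; apply: measurable_funM => //.
  exact: (measurableT_comp (measurable_indic mS) (measurable_aff3 y _)).
have ml : measurable_fun [set: T3] (fun z : T3 => (\1_S y * rho 1 0 z)%:E).
  by apply/measurable_EFinP; apply: measurable_funM.
have ir : leb3m.-integrable setT (fun z : T3 => (rho 1 0 z)%:E).
  apply/integrableP; split; first exact/measurable_EFinP.
  under eq_integral do rewrite gee0_abs ?lee_fin ?rho_ge0//.
  exact: integral_rho1_lty.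
suff [f1 f2] : {ae leb3m, forall z : T3, [set: T3] z ->
     (\1_S (aff3 y n.+1%:R^-1 z) * rho 1 0 z)%:E @[n --> \oo] --> (\1_S y * rho 1 0 z)%:E} /\
   {ae leb3m, forall z : T3, forall n, [set: T3] z ->
     (`|(\1_S (aff3 y n.+1%:R^-1 z) * rho 1 0 z)%:E| <= (rho 1 0 z)%:E)%E}.
  have [_ _ C] := dominated_convergence measurableT mn ml f1 ir f2.
  by rewrite E in C; exact: C.
split.
(* For each z the sequence is eventually constant, coordinate by coordinate. *)
- apply: aeW => z _; apply: cvg_near_cst.
  have [f1 g1] := yf 0; have [f2 g2] := yf 1; have [f3 g3] := yf 2.
  have h1 := itvoc_near z.1.1 f1 g1.
  have h2 := itvoc_near z.1.2 f2 g2.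
  have h3 := itvoc_near z.2 f3 g3.
  near=> n; congr (_%:E); congr (_ * _).
  rewrite !indicE; congr (_%:R); congr nat_of_bool.
  have inS (w : R3 R) : (w \in S) = [&& w.1.1 \in `]a.1.1, b.1.1], w.1.2 \in `]a.1.2, b.1.2] & w.2 \in `]a.2, b.2] ].
    apply/idP/and3P => [/set_mem[[? ?] ?]|[? ? ?]]; first by split.
    by apply/mem_set; split; first split.
  rewrite !inS; congr [&& _, _ & _]; near: n; [exact: h1|exact: h2|exact: h3].
- apply: aeW => z n _; have r0 := rho_ge0 1 0 z.
  rewrite gee0_abs lee_fin; last by apply: mulr_ge0 => //; rewrite indicE.
  by rewrite -[leRHS]mul1r; apply: ler_wpM2r => //; rewrite indicE; case: (_ \in _).
Unshelve. all: by end_near. Qed.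

Lemma ord3_cases (k : 'I_3) : [\/ k = 0, k = 1 | k = 2].
Proof.
by case: k => -[|[|[|//]]] i; [constructor 1|constructor 2|constructor 3]; exact/val_inj.
Qed.

Lemma ae_off_faces (a b : R3 R) : {ae leb3m, forall y : T3, off_faces a b y}.
Proof.
have h (k : 'I_3) (c : R) : {ae leb3m, forall y : T3, coord3 (y : R3 R) k != c}.
  pose I (j : 'I_3) : set M := if j == k then [set c] else setT.
  have mI j : measurable (I j) by rewrite /I; case: ifP => _; [exact: measurable_set1|].
  exists (box3 (I 0) (I 1) (I 2)); split.
  - exact: measurable_box3.
  - rewrite leb3_box3// /I; have [->|->|->] := ord3_cases k; rewrite /=.
    + by rewrite lebesgue_measure_set1 !mul0e.
    + by rewrite lebesgue_measure_set1 mule0 mul0e.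
    + by rewrite lebesgue_measure_set1 mule0.
  - move=> y /= /negP; rewrite negbK => /eqP yc; rewrite /box3 /I.
    by move: yc; have [->|->|->] := ord3_cases k; move=> <- /=.
have H : {ae leb3m, forall y : T3,
   ((coord3 (y : R3 R) 0 != coord3 a 0 /\ coord3 (y : R3 R) 0 != coord3 b 0) /\
   (coord3 (y : R3 R) 1 != coord3 a 1 /\ coord3 (y : R3 R) 1 != coord3 b 1)) /\
   (coord3 (y : R3 R) 2 != coord3 a 2 /\ coord3 (y : R3 R) 2 != coord3 b 2)}.
  by do ?apply: filterI; exact: h.
apply: filterS H => y [[h0 h1] h2] k.
by have [->|->|->] := ord3_cases k.
Qed.

End ApproxIdentity.

(** * Letting the regularization tend to zero *)

Section Representation.
Variable R : realType.
Local Notation leb3m := (@leb3m R).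
Local Notation M := (measurableTypeR R).
Local Notation T3 := (M * M * M)%type.
Implicit Types x y z : R3 R.

Definition sum_kern (F : 'I_3 -> T3 -> R) (e : R) x y : R :=
  \sum_m F m y * kern e m x y.

Lemma cvg_sum3 (f : 'I_3 -> nat -> R) (l : 'I_3 -> R) :
  (forall m, f m n @[n --> \oo] --> l m) ->
  (\sum_m f m n) @[n --> \oo] --> \sum_m l m.
Proof.
move=> fl; under eq_fun do rewrite !big_ord_recl big_ord0.
rewrite !big_ord_recl big_ord0.
by do 3 (apply: cvgD; first exact: fl); exact: cvg_cst.
Qed.

Definition sum_norm (F : 'I_3 -> T3 -> R) y : R := \sum_m `|F m y|.

Lemma sum_norm_ge0 F y : 0 <= sum_norm F y.
Proof. by apply: sumr_ge0. Qed.

Lemma measurable_sum_norm (F : 'I_3 -> T3 -> R) : (forall m, measurable_fun setT (F m)) ->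
  measurable_fun setT (sum_norm F : T3 -> R).
Proof. by move=> mF; apply: measurable_sum => m; exact: measurableT_comp. Qed.

Lemma measurable_sum_kern (F : 'I_3 -> T3 -> R) e : (forall m, measurable_fun setT (F m)) ->
  measurable_fun [set: T3 * T3] (fun u : T3 * T3 => sum_kern F e u.1 u.2).
Proof.
move=> mF; apply: measurable_sum => m; apply: measurable_funM; last exact: measurable_kern.
exact: (measurableT_comp (mF m)).
Qed.

(** Where F does not vanish, both x and y lie in the cube of half-side L, hence y - x in the one of
    half-side 2 L. *)
Lemma sum_kern_le (F : 'I_3 -> T3 -> R) (L e : R) x y :
  (forall m y, L < sup3 y -> F m y = 0) -> sup3 x <= L ->
  (`|(sum_kern F e x y)%:E| <= (sum_norm F y)%:E * kap3 2 (2 * L) (y - x)%R)%E.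
Proof.
move=> F0 xL; have [yL|yL] := leP (sup3 y) L; last first.
  have -> : sum_kern F e x y = 0 by rewrite /sum_kern big1// => m _; rewrite F0 ?mul0r.
  by rewrite abse0 mule_ge0 ?kap3_ge0// lee_fin sum_norm_ge0.
have h := le_kap3 (ltr0n R 2) (sup3B xL yL).
apply: (@le_trans _ _ ((sum_norm F y)%:E * (enorm (y - x)%R `^ (- 2))%:E)%E); last first.
  by apply: lee_wpmul2l => //; rewrite lee_fin sum_norm_ge0.
rewrite -EFinM lee_fin; apply: (le_trans (ler_norm_sum _ _ _)).
rewrite mulr_suml; apply: ler_sum => m _; rewrite normrM ler_wpM2l//.
exact: kern_le.
Qed.

Lemma integral_kap3_subl (a L : R) y :
  (\int[leb3m]_x kap3 a L ((y : R3 R) - x)%R = \int[leb3m]_z kap3 a L z)%E.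
Proof.
rewrite -(ge0_integral_shift3 y (measurable_kap3 a L) (kap3_ge0 a L)).
by apply: eq_integral => x _; rewrite -kap3N opprB.
Qed.

Lemma measurable_kap3_sub a L :
  measurable_fun [set: T3 * T3] (fun u : T3 * T3 => kap3 a L ((u.2 : R3 R) - u.1)).
Proof. by apply: (measurableT_comp (measurable_kap3 a L)); exact: measurable_sub3. Qed.

Lemma measurable_kap3_subl a L y :
  measurable_fun [set: T3] (fun x : T3 => kap3 a L ((y : R3 R) - x)).
Proof.
by apply: (measurableT_comp (measurable_kap3 a L)); exact: measurable_subr3.
Qed.

(** By Tonelli one may integrate in x first; by translation invariance the inner integral of the
    kernel does not depend on y. *)
Lemma integrable_kap3_sub (a L : R) (N : T3 -> R) : a < 3 -> 0 < L ->
  (forall y, 0 <= N y) -> leb3m.-integrable setT (EFin \o N) ->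
  (leb3m \x leb3m)%E.-integrable [set: T3 * T3]
    (fun u : T3 * T3 => ((N u.2)%:E * kap3 a L ((u.2 : R3 R) - u.1)%R)%E).
Proof.
move=> a3 L0 N0 iN.
have mN : measurable_fun setT N by apply/measurable_EFinP; exact: measurable_int iN.
have mf : measurable_fun [set: T3 * T3]
    (fun u : T3 * T3 => ((N u.2)%:E * kap3 a L ((u.2 : R3 R) - u.1)%R)%E).
  apply: emeasurable_funM; last exact: measurable_kap3_sub.
  by apply/measurable_EFinP; exact: (measurableT_comp mN).
apply: (proj2 (@integrable21ltyP _ _ _ _ _ leb3m leb3m _ mf)).
have K0 : (0 <= \int[leb3m]_z kap3 a L z)%E by apply: integral_ge0 => z _; exact: kap3_ge0.
have E y : (\int[leb3m]_x `|(N y)%:E * kap3 a L ((y : R3 R) - x)%R| =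
    (N y)%:E * \int[leb3m]_z kap3 a L z)%E.
  transitivity (\int[leb3m]_x ((N y)%:E * kap3 a L ((y : R3 R) - x)%R))%E.
    apply: eq_integral => x _; rewrite gee0_abs//.
    by apply: mule_ge0; [rewrite lee_fin; exact: N0|exact: kap3_ge0].
  have Ny : (0 <= (N y)%:E)%E by rewrite lee_fin.
  rewrite (ge0_integralZl leb3m measurableT (measurable_kap3_subl a L y)
    (fun x _ => kap3_ge0 _ _ _) Ny).
  by rewrite integral_kap3_subl.
under eq_integral do rewrite E.
have mNE : measurable_fun setT (EFin \o N) by apply/measurable_EFinP.
have N0E y : setT y -> (0 <= (EFin \o N) y)%E by move=> _; rewrite lee_fin.
rewrite (ge0_integralZr leb3m measurableT mNE N0E K0).
apply: lte_mul_pinfty; first exact: integral_ge0.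
  exact: integrable_fin_num.
exact: integral_kap3_lty.
Qed.

Section Identity.
Variables (L : R) (U : T3 -> R) (F : 'I_3 -> T3 -> R).
Hypotheses (L0 : 0 < L) (iU : leb3m.-integrable setT (EFin \o U))
  (mF : forall m, measurable_fun setT (F m))
  (iF : leb3m.-integrable setT (EFin \o (sum_norm F)))
  (F0 : forall m y, L < sup3 y -> F m y = 0).
Hypothesis UF : forall (e : R) x, 0 < e ->
  (\int[leb3m]_y (U y * rho e x y)%:E = \int[leb3m]_y (sum_kern F e x y)%:E)%E.

Let Bx : set T3 := oc3 (cst3 (- L)) (cst3 L).

Let mU : measurable_fun setT U.
Proof. by apply/measurable_EFinP; exact: measurable_int iU. Qed.

Let supBx x : Bx x -> sup3 x <= L.
Proof.
rewrite /Bx /oc3 /box3/= !in_itv/= sup3_le => -[[/andP[a1 b1] /andP[a2 b2]] /andP[a3 b3]].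
by rewrite !ler_norml b1 b2 b3 !ltW.
Qed.

(** Its integral averages the kernel side of [UF] over the points x of S. For S inside [Bx] the
    function [dom] majorizes it for all e at once. *)
Let g (S : set T3) e (u : T3 * T3) : \bar R := (\1_S u.1 * sum_kern F e u.1 u.2)%:E.

Let measurable_g (S : set T3) e : measurable S -> measurable_fun setT (g S e).
Proof.
move=> mS; apply/measurable_EFinP; apply: measurable_funM; last exact: measurable_sum_kern.
exact: (measurableT_comp (measurable_indic mS)).
Qed.

Let dom (u : T3 * T3) : \bar R := ((sum_norm F u.2)%:E * kap3 2 (2 * L) ((u.2 : R3 R) - u.1)%R)%E.

Let integrable_bound : (leb3m \x leb3m)%E.-integrable setT dom.
Proof.
apply: integrable_kap3_sub => //; first by rewrite ltr_nat.
- by rewrite mulr_gt0.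
- by move=> y; exact: sum_norm_ge0.
Qed.

Let g_le (S : set T3) e u : S `<=` Bx -> (`|g S e u| <= dom u)%E.
Proof.
move=> SB; rewrite /g indicE; have [/set_mem uS|uS] := boolP (u.1 \in S).
  by rewrite mul1r; apply: sum_kern_le => //; exact/supBx/SB.
by rewrite mul0r abse0 mule_ge0 ?kap3_ge0// lee_fin sum_norm_ge0.
Qed.

Let integrable_g (S : set T3) e : measurable S -> S `<=` Bx ->
  (leb3m \x leb3m)%E.-integrable setT (g S e).
Proof.
move=> mS SB; apply: (le_integrable measurableT _ _ integrable_bound).
  exact: measurable_g.
move=> u _; apply: (le_trans (g_le e u SB)); exact: lee_abs.
Qed.

Let cvg_g (S : set T3) : measurable S -> S `<=` Bx ->
  (\int[(leb3m \x leb3m)%E]_u g S n.+1%:R^-1 u)%E @[n --> \oo] -->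
  (\int[(leb3m \x leb3m)%E]_u g S 0 u)%E.
Proof.
move=> mS SB.
have h1 : {ae (leb3m \x leb3m)%E, forall u : T3 * T3, [set: T3 * T3] u ->
    g S n.+1%:R^-1 u @[n --> \oo] --> g S 0 u}.
  apply: aeW => u _; apply: cvg_EFin; first exact: nearW.
  apply: cvgM; first exact: cvg_cst.
  apply: (cvg_sum3 (f := fun m n => F m u.2 * kern n.+1%:R^-1 m u.1 u.2)) => m; apply: cvgM; first exact: cvg_cst.
  exact: cvg_kern.
have h2 : {ae (leb3m \x leb3m)%E, forall u : T3 * T3, forall n, [set: T3 * T3] u ->
    (`|g S n.+1%:R^-1 u| <= dom u)%E}.
  by apply: aeW => u n _; exact: g_le.
by have [_ _] := dominated_convergence measurableT
  (fun n => measurable_g n.+1%:R^-1 mS) (measurable_g 0 mS) h1 integrable_bound h2.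
Qed.

(** [UF] replaces the kernel sum by U times [rho] for each x; exchanging the integrals then isolates
    the average of [rho] over S. Fubini applies because that average is at most the mass of
    [rho]. *)
Let integral_gn (S : set T3) e : measurable S -> S `<=` Bx -> 0 < e ->
  (\int[(leb3m \x leb3m)%E]_u g S e u =
   \int[leb3m]_y ((U y)%:E * \int[leb3m]_x (\1_S x * rho e x y)%:E))%E.
Proof.
move=> mS SB e0.
rewrite -(integral12_prod_meas1 (integrable_g e mS SB)).
pose k (u : T3 * T3) := (\1_S u.1 * (U u.2 * rho e u.1 u.2))%:E.
have mk : measurable_fun setT k.
  apply/measurable_EFinP; apply: measurable_funM.
    exact: (measurableT_comp (measurable_indic mS)).
  apply: measurable_funM; last exact: measurable_rho.
  exact: (measurableT_comp mU).
have mr y : measurable_fun [set: T3] (fun x : T3 => (\1_S x * rho e x y)%:E).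
  apply/measurable_EFinP; apply: measurable_funM; first exact: measurable_indic.
  exact: measurable_rhol.
have r0 y x : (0 <= (\1_S x * rho e x y)%:E)%E.
  by rewrite lee_fin; apply: mulr_ge0; [rewrite indicE|exact: rho_ge0].
have ik : (leb3m \x leb3m)%E.-integrable setT k.
  apply: (proj2 (@integrable21ltyP _ _ _ _ _ leb3m leb3m _ mk)).
  have E y : (\int[leb3m]_x `|k (x, y)| =
      `|U y|%:E * \int[leb3m]_x (\1_S x * rho e x y)%:E)%E.
    rewrite -ge0_integralZl//.
    apply: eq_integral => x _; rewrite /k/= -EFinM mulrCA normrM; congr (_ * _)%:E.
    by rewrite ger0_norm// -lee_fin; exact: r0.
  under eq_integral do rewrite E.
  apply: (@le_lt_trans _ _ (\int[leb3m]_y (`|U y|%:E * (rho_mass R)%:E))%E).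
    apply: ge0_le_integral => //.
    - by move=> y _; rewrite mule_ge0// integral_ge0.
    - apply: emeasurable_funM.
        by apply/measurable_EFinP; exact: (measurable_norm mU).
      pose q (u : T3 * T3) := (\1_S u.1 * rho e u.1 u.2)%:E.
      apply: (@measurable_fun_fubini_tonelli_G _ _ _ _ _ leb3m q).
        apply/measurable_EFinP; apply: measurable_funM; last exact: measurable_rho.
        exact: (measurableT_comp (measurable_indic mS)).
      by move=> u; exact: r0.
    - apply: emeasurable_funM => //.
      by apply/measurable_EFinP; exact: (measurable_norm mU).
    - by move=> y _; apply: lee_wpmul2l => //; exact: integral_rho_indic_le.
  rewrite ge0_integralZr//.
  - have fU : (\int[leb3m]_y `|U y|%:E < +oo)%E by move/integrableP: iU => [].
    have U0 : (0 <= \int[leb3m]_y `|U y|%:E)%E by apply: integral_ge0.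
    by apply: lte_mul_pinfty => //; [rewrite ge0_fin_numE|rewrite ltry].
  - by apply/measurable_EFinP; exact: (measurable_norm mU).
  - by rewrite lee_fin ltW// rho_mass_gt0.
transitivity (\int[leb3m]_x \int[leb3m]_y k (x, y))%E.
  apply: eq_integral => x _; rewrite /fubini_F /g /k/= indicE.
  case: (x \in S); last by apply: eq_integral => y _; rewrite !mul0r.
  under eq_integral do rewrite mul1r.
  by rewrite -(UF x e0); apply: eq_integral => y _; rewrite mul1r.
rewrite (Fubini ik); apply: eq_integral => y _.
rewrite -integralZl//.
  by apply: eq_integral => x _; rewrite /k/= -EFinM mulrCA.
apply/integrableP; split => //.
under eq_integral do rewrite gee0_abs//.
by apply: (le_lt_trans (integral_rho_indic_le y mS e0)); rewrite ltry.
Qed.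

Let integral_g0 (a b : R3 R) : oc3 a b `<=` Bx ->
  (\int[(leb3m \x leb3m)%E]_u g (oc3 a b) 0 u =
   \int[leb3m]_y (\1_(oc3 a b) y * (rho_mass R * U y))%:E)%E.
Proof.
move=> SB; set S := oc3 a b; have mS : measurable S by exact: measurable_oc3.
have := cvg_g mS SB.
have e0 n : 0 < n.+1%:R^-1 :> R by rewrite invr_gt0.
under eq_cvg do rewrite (integral_gn mS SB (e0 _)).
(* Both sides are limits of one sequence. The second limit is taken under the integral in y, for y
   off the faces, with majorant |U| times the mass of [rho]. *)
move=> /cvg_lim <-//; apply/cvg_lim => //.
have mn n : measurable_fun setT (fun y : T3 => (U y)%:E *
    \int[leb3m]_x (\1_S x * rho n.+1%:R^-1 x y)%:E)%E.
  apply: emeasurable_funM; first by apply/measurable_EFinP; exact: mU.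
  pose q (u : T3 * T3) := (\1_S u.1 * rho n.+1%:R^-1 u.1 u.2)%:E.
  apply: (@measurable_fun_fubini_tonelli_G _ _ _ _ _ leb3m q).
    apply/measurable_EFinP; apply: measurable_funM; last exact: measurable_rho.
    exact: (measurableT_comp (measurable_indic mS)).
  move=> u; rewrite /q lee_fin; apply: mulr_ge0; [by rewrite indicE|exact: rho_ge0].
have ml : measurable_fun setT (fun y : T3 => (\1_S y * (rho_mass R * U y))%:E).
  apply/measurable_EFinP; apply: measurable_funM; first exact: measurable_indic.
  by apply: measurable_funM; [exact: measurable_cst|exact: mU].
have h1 : {ae leb3m, forall y : T3, [set: T3] y ->
    ((U y)%:E * \int[leb3m]_x (\1_S x * rho n.+1%:R^-1 x y)%:E)%E @[n --> \oo] -->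
    (\1_S y * (rho_mass R * U y))%:E}.
  apply: (@filterS _ _ (ae_filter_ringOfSetsType leb3m) _ _ _ (ae_off_faces a b)) => y yf _.
  have -> : (\1_S y * (rho_mass R * U y))%:E = ((U y)%:E * (rho_mass R * \1_S y)%:E)%E.
    by rewrite -EFinM; congr (_%:E); ring.
  by apply: cvgeM; [by []|exact: cvg_cst|exact: cvg_integral_rho_indic].
have ig : leb3m.-integrable setT (fun y : T3 => (`|U y| * rho_mass R)%:E).
  under eq_fun do rewrite EFinM; apply: integrableZr => //.
  exact: (integrable_abse iU).
have h2 : {ae leb3m, forall y : T3, forall n, [set: T3] y ->
    (`|(U y)%:E * \int[leb3m]_x (\1_S x * rho n.+1%:R^-1 x y)%:E| <= (`|U y| * rho_mass R)%:E)%E}.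
  apply: aeW => y n _; rewrite abseM EFinM; apply: lee_wpmul2l => //.
  rewrite gee0_abs; first exact: integral_rho_indic_le.
  apply: integral_ge0 => x _; rewrite lee_fin.
  by apply: mulr_ge0; [rewrite indicE|exact: rho_ge0].
by have [_ _] := dominated_convergence measurableT mn ml h1 ig h2.
Qed.

(** A box meets [Bx] in a box, so by [integral_g0] the two sides, restricted to [Bx], have equal
    integrals over every box; [ae_eq0_oc3] applies to their difference. *)
Lemma representation : {ae leb3m, forall x : T3, Bx x ->
  ((rho_mass R * U x)%:E = \int[leb3m]_y (sum_kern F 0 x y)%:E)%E}.
Proof.
have mB : measurable Bx by exact: measurable_oc3.
pose h1 (x : T3) : \bar R := (\1_Bx x * (rho_mass R * U x))%:E.
pose h2 (x : T3) : \bar R := (\int[leb3m]_y g Bx 0 (x, y))%E.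
have ih2 : leb3m.-integrable setT h2.
  exact: (integrable_fubini_F (integrable_g 0 mB (@subset_refl _ _))).
have ih1 : leb3m.-integrable setT h1.
  have : leb3m.-integrable setT (fun y : T3 => (rho_mass R)%:E * (U y)%:E)%E.
    exact: integrableZl.
  apply: le_integrable => //.
    apply/measurable_EFinP; apply: measurable_funM; first exact: measurable_indic.
    by apply: measurable_funM; [exact: measurable_cst|exact: mU].
  move=> x _; rewrite -EFinM lee_fin [leLHS]normrM ler_piMl//.
  by rewrite indicE; case: (_ \in _); rewrite ?normr1 ?normr0.
have ih : leb3m.-integrable setT (h1 \- h2)%E by exact: (integrableB measurableT ih1 ih2).
have : ae_eq leb3m setT (h1 \- h2)%E (cst 0%E).
  apply: (ae_eq0_oc3 ih) => a b; set Q := oc3 a b.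
  have mQ : measurable Q by exact: measurable_oc3.
  have [S SE] : exists ab : R3 R * R3 R, Q `&` Bx = oc3 ab.1 ab.2.
    by rewrite /Q /Bx oc3I; eexists (_, _).
  have SB : oc3 S.1 S.2 `<=` Bx by rewrite -SE; apply: subIsetr.
  have mS : measurable (oc3 S.1 S.2) by exact: measurable_oc3.
  have ind x : (\1_Bx x : R) * (x \in Q)%:R = \1_(oc3 S.1 S.2) x.
    by rewrite -SE indicI mulrC /= !indicE.
  rewrite integralB//; [|exact: integrableS ih1|exact: integrableS ih2].
  rewrite (_ : \int[leb3m]_(x in Q) h1 x = \int[leb3m]_y (\1_(oc3 S.1 S.2) y * (rho_mass R * U y))%:E)%E; last first.
    rewrite integral_mkcond; apply: eq_integral => x _.
    rewrite /patch /h1 -ind; case: ifP => _; first by rewrite mulr1.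
    by rewrite mulr0 mul0r.
  rewrite (_ : \int[leb3m]_(x in Q) h2 x = \int[leb3m]_x \int[leb3m]_y g (oc3 S.1 S.2) 0 (x, y))%E; last first.
    rewrite integral_mkcond; apply: eq_integral => x _.
    rewrite /patch /h2 /g /= -ind; case: ifP => _.
      by apply: eq_integral => y _; rewrite mulr1.
    by rewrite integral0_eq// => y _; rewrite mulr0 mul0r.
  rewrite -[X in (_ - X)%E]/(\int[leb3m]_x (fubini_F leb3m (g (oc3 S.1 S.2) 0)) x)%E.
  rewrite (integral12_prod_meas1 (integrable_g 0 mS SB)) integral_g0// subee//.
  apply: integrable_fin_num => //; apply: le_integrable ih1 => //.
    apply/measurable_EFinP; apply: measurable_funM; first exact: measurable_indic.
    by apply: measurable_funM; [exact: measurable_cst|exact: mU].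
  move=> x _; rewrite lee_fin -ind -mulrA [leLHS]normrM [leRHS]normrM ler_wpM2l//.
  rewrite [leLHS]normrM ler_piMl//.
  by case: (_ \in _); rewrite ?normr1 ?normr0.
apply: filterS => x /(_ I) /=; rewrite /h1 /h2 /g /= indicE => + Bxx.
rewrite mem_set// !mul1r.
under eq_integral do rewrite mul1r.
case: (\int[leb3m]_y _)%E => [r| |]//.
by rewrite -EFinB => -[] /eqP; rewrite subr_eq0 => /eqP ->.
Qed.

End Identity.

End Representation.

(** * Potentials *)

Section PotentialEstimates.
Variable R : realType.
Local Notation leb3m := (@leb3m R).
Local Notation M := (measurableTypeR R).
Local Notation T3 := (M * M * M)%type.
Implicit Types x y z w : R3 R.

(** Real-valued, unlike [kap3], so that it can be raised to powers in Young's and Hoelder's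
    inequalities; [kap3] only serves to show its integral finite. *)
Definition trunc_pow (a L : R) z : R := if sup3 z <= L then enorm z `^ (- a) else 0.

Lemma trunc_pow_ge0 a L z : 0 <= trunc_pow a L z.
Proof. by rewrite /trunc_pow; case: ifP => // _; exact: powR_ge0. Qed.

Lemma trunc_powN a L z : trunc_pow a L (- z) = trunc_pow a L z.
Proof.
by rewrite /trunc_pow /sup3 !enormE nsq3N; case: z => [[z1 z2] z3]; rewrite /= !normrN.
Qed.

Lemma trunc_pow_powR a L q z : 0 < q -> trunc_pow a L z `^ q = trunc_pow (a * q) L z.
Proof.
move=> q0; rewrite /trunc_pow; case: ifP => _; last by rewrite powR0 ?gt_eqF.
by rewrite -powRrM mulNr.
Qed.

Lemma measurable_trunc_pow a L : measurable_fun [set: T3] (fun z : T3 => trunc_pow a L z).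
Proof.
have me : measurable_fun [set: T3] (fun z : T3 => enorm (z : R3 R)).
  have -> : (fun z : T3 => enorm (z : R3 R)) = (fun z => nsq3 (z : R3 R) `^ 2^-1).
    by apply/funext => z; rewrite powR12_sqrt ?nsq3_ge0.
  by apply: (measurableT_comp (measurable_powR _)); exact: measurable_nsq3.
have mn (k : 'I_3) : measurable_fun [set: T3] (fun z : T3 => `|coord3 (z : R3 R) k|).
  exact: (measurable_norm (measurable_coord3 k)).
apply: measurable_fun_if => //.
- apply: measurable_fun_ler => //.
  exact: (measurable_maxr (measurable_maxr (mn 0) (mn 1)) (mn 2)).
- by apply: measurable_funTS; exact: (measurableT_comp (measurable_powR _) me).
Qed.

Lemma measurable_trunc_pow_sub a L :
  measurable_fun [set: T3 * T3] (fun u : T3 * T3 => trunc_pow a L ((u.2 : R3 R) - u.1)).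
Proof. by apply: (measurableT_comp (measurable_trunc_pow a L)); exact: measurable_sub3. Qed.

Lemma measurable_trunc_pow_subr a L x :
  measurable_fun [set: T3] (fun y : T3 => trunc_pow a L ((y : R3 R) - x)).
Proof. by apply: (measurableT_comp (measurable_trunc_pow a L)); exact: measurable_subr3. Qed.

Lemma integral_trunc_pow_lty a L : 0 < a < 3 -> 0 < L ->
  (\int[leb3m]_z (trunc_pow a L z)%:E < +oo)%E.
Proof.
move=> /andP[a0 a3] L0; apply: (@le_lt_trans _ _ (\int[leb3m]_z kap3 a L z)%E); last first.
  exact: integral_kap3_lty.
apply: ge0_le_integral => //.
- by move=> z _; rewrite lee_fin trunc_pow_ge0.
- by apply/measurable_EFinP; exact: measurable_trunc_pow.
- exact: measurable_kap3.
- move=> z _; rewrite /trunc_pow; case: ifP => [zL|_]; last exact: kap3_ge0.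
  exact: le_kap3.
Qed.

Lemma integral_trunc_pow_subr a L x :
  (\int[leb3m]_y (trunc_pow a L ((y : R3 R) - x)%R)%:E = \int[leb3m]_z (trunc_pow a L z)%:E)%E.
Proof.
apply: (ge0_integral_shift3 x (f := fun z : T3 => (trunc_pow a L z)%:E)).
  by apply/measurable_EFinP; exact: measurable_trunc_pow.
by move=> z; rewrite lee_fin trunc_pow_ge0.
Qed.

Lemma integral_trunc_pow_subl a L y :
  (\int[leb3m]_x (trunc_pow a L ((y : R3 R) - x)%R)%:E = \int[leb3m]_z (trunc_pow a L z)%:E)%E.
Proof.
rewrite -(integral_trunc_pow_subr a L y); apply: eq_integral => x _.
by rewrite -trunc_powN opprB.
Qed.

(** The numerical inequality a b <= a^q / q + b^q' / q' under the integral is enough, since only a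
    bound independent of x is wanted; 1/q and 1/q' are at most 1. *)
Lemma integral_potential_le (N : T3 -> R) (a L q q' : R) x :
  measurable_fun setT N -> (forall y, 0 <= N y) ->
  0 < q -> 0 < q' -> q^-1 + q'^-1 = 1 ->
  (\int[leb3m]_y (N y * trunc_pow a L ((y : R3 R) - x)%R)%:E <=
   \int[leb3m]_y (N y `^ q)%:E + \int[leb3m]_z (trunc_pow (a * q') L z)%:E)%E.
Proof.
move=> mN N0 q0 q'0 qq'.
have mNq : measurable_fun [set: T3] (fun y : T3 => (N y `^ q)%:E).
  exact: measurable_EFin_powR mN.
have mt : measurable_fun [set: T3] (fun y : T3 => (trunc_pow (a * q') L ((y : R3 R) - x)%R)%:E).
  by apply/measurable_EFinP; exact: measurable_trunc_pow_subr.
have N0q (y : T3) : setT y -> (0 <= (N y `^ q)%:E)%E by rewrite lee_fin powR_ge0.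
have t0q (y : T3) : setT y -> (0 <= (trunc_pow (a * q') L ((y : R3 R) - x)%R)%:E)%E.
  by rewrite lee_fin trunc_pow_ge0.
rewrite -(integral_trunc_pow_subr (a * q') L x).
rewrite -(ge0_integralD leb3m measurableT N0q mNq t0q mt).
apply: ge0_le_integral => //.
- by move=> y _; rewrite lee_fin mulr_ge0 ?trunc_pow_ge0.
- apply/measurable_EFinP; apply: measurable_funM => //; exact: measurable_trunc_pow_subr.
- exact: emeasurable_funD.
move=> y _; rewrite -EFinD lee_fin -trunc_pow_powR//.
set t := trunc_pow _ _ _; have t0 : 0 <= t by exact: trunc_pow_ge0.
apply: (le_trans (conjugate_powR (N0 y) t0 q0 q'0 qq')).
have q1 : q^-1 <= 1 by rewrite -qq' lerDl invr_ge0 ltW.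
have q'1 : q'^-1 <= 1 by rewrite -qq' lerDr invr_ge0 ltW.
by apply: lerD; rewrite ler_piMr ?powR_ge0.
Qed.

Lemma enorm_tri x y : enorm (x + y) <= enorm x + enorm y.
Proof.
rewrite -(@ler_sqr _ (enorm (x + y))) ?nnegrE ?addr_ge0 ?enorm_ge0//.
rewrite sqrrD !enormE !sqr_sqrtr ?nsq3_ge0//.
have hd : nsq3 (x + y) = nsq3 x + (\sum_k coord3 x k * coord3 y k) *+ 2 + nsq3 y.
  rewrite /nsq3 -sumrMnl -!big_split/=; apply: eq_bigr => k _.
  have -> : coord3 (x + y) k = coord3 x k + coord3 y k by case: k => -[|[|[|]]].
  by rewrite sqrrD.
rewrite hd lerD2r lerD2l lerMn2r/= -sqrtrM ?nsq3_ge0//.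
apply: (le_trans (ler_norm _)); rewrite -sqrtr_sqr ler_sqrt ?mulr_ge0 ?nsq3_ge0//.
rewrite /nsq3 !big_ord_recl !big_ord0 !addr0.
set a := coord3 x _; set b := coord3 x _; set c := coord3 x _.
set a' := coord3 y _; set b' := coord3 y _; set c' := coord3 y _.
(* Lagrange's identity, which gives the Cauchy-Schwarz inequality. *)
rewrite -subr_ge0 [leRHS](_ : _ = (a * b' - b * a') ^+ 2 + (a * c' - c * a') ^+ 2
  + (b * c' - c * b') ^+ 2); first by rewrite !addr_ge0 ?sqr_ge0.
ring.
Qed.

Lemma enormN z : enorm (- z) = enorm z.
Proof. by rewrite !enormE nsq3N. Qed.

Lemma ler_dist_enorm x y : `|enorm x - enorm y| <= enorm (x - y).
Proof.
have h (u v : R3 R) : enorm u - enorm v <= enorm (u - v).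
  by rewrite lerBlDr; have := enorm_tri (u - v) v; rewrite subrK.
by rewrite ler_norml h andbT lerNl (opprB (enorm x)) -(enormN (x - y)) opprB h.
Qed.

Definition newton (m : 'I_3) z : R := coord3 z m * (enorm z)^-1 ^+ 3.

Lemma kern0E m x y : kern 0 m x y = - newton m (y - x).
Proof. by rewrite /kern /newton /inv_dist expr0n addr0. Qed.

Lemma newton_le m z : `|newton m z| <= enorm z `^ (- 2).
Proof.
have := kern_le 0 m 0 z; rewrite kern0E normrN subr0; exact.
Qed.

(** Two regimes for d = |z - w|. If d > |z|, both values are at most |z|^(-2) = |z|^t |z|^(-2-t),
    and |z|^t <= d^t. If d <= |z|, the difference is at most 4 d / |z|^3, and d = d^t d^(1-t) with
    d^(1-t) <= |z|^(1-t). *)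
Lemma newton_holder_aux m z w (t : R) : 0 <= t <= 1 -> 0 < enorm z -> enorm z <= enorm w ->
  `|newton m z - newton m w| <= 4 * enorm (z - w) `^ t * enorm z `^ (- (2 + t)).
Proof.
move=> /andP[t0 t1] z0 zw; set d := enorm (z - w).
have w0 : 0 < enorm w by exact: lt_le_trans zw.
have d0 : 0 <= d by exact: enorm_ge0.
have [dz|zd] := leP d (enorm z); last first.
  have h1 : enorm w `^ (- 2) <= enorm z `^ (- 2).
    rewrite !powRN lef_pV2 ?posrE ?powR_gt0//.
    by apply: (ge0_ler_powR (ltW (ltr0n R 2))); rewrite ?nnegrE ?enorm_ge0.
  have h2 : enorm z `^ (- 2) = enorm z `^ t * enorm z `^ (- (2 + t)).
    rewrite -powRD ?(gt_eqF z0) ?implybT//; congr (_ `^ _); ring.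
  have h3 : enorm z `^ t <= d `^ t.
    by apply: (ge0_ler_powR t0); rewrite ?nnegrE ?enorm_ge0// ltW.
  have p0 := powR_ge0 (enorm z) (- (2 + t)).
  have h4 := ler_wpM2r p0 h3; rewrite -h2 in h4.
  have nz := newton_le m z; have nw := newton_le m w.
  apply: (le_trans (ler_normB _ _)); apply: (le_trans (lerD nz (le_trans nw h1))).
  rewrite -mulrA; apply: (le_trans (lerD h4 h4)).
  rewrite -mulr2n -[leLHS]mulr_natl; apply: ler_wpM2r; first by rewrite mulr_ge0 ?powR_ge0.
  by rewrite ler_nat.
have a0 := z0; set a := enorm z in z0 zw dz *; set b := enorm w in w0 zw *.
have ab : `|a - b| <= d by exact: ler_dist_enorm.
(* The numerator and the cubed norm vary in turn. The first term is at most d / a^3; in the second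
   b^2 + a b + a^2 <= 3 b^2, whence 3 d / a^3. *)
have E : newton m z - newton m w = (coord3 z m - coord3 w m) / a ^+ 3 +
     coord3 w m * ((b - a) * (b ^+ 2 + a * b + a ^+ 2) / (a ^+ 3 * b ^+ 3)).
  by rewrite /newton -/a -/b; field; rewrite !gt_eqF.
have h1 : `|(coord3 z m - coord3 w m) / a ^+ 3| <= d / a ^+ 3.
  have a30 : 0 <= a ^+ 3 by rewrite exprn_ge0 ?(ltW z0).
  rewrite normrM normfV (ger0_norm a30) ler_wpM2r ?invr_ge0//.
  by rewrite -coord3B; exact: coord3_le_enorm.
have h2 : `|coord3 w m * ((b - a) * (b ^+ 2 + a * b + a ^+ 2) / (a ^+ 3 * b ^+ 3))| <= 3 * d / a ^+ 3.
  have s0 : 0 <= b ^+ 2 + a * b + a ^+ 2.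
    by rewrite !addr_ge0 ?sqr_ge0 ?mulr_ge0 ?(ltW w0) ?(ltW z0).
  have s1 : b ^+ 2 + a * b + a ^+ 2 <= 3 * b ^+ 2.
    have : a * b <= b * b by rewrite ler_wpM2r ?(ltW w0).
    have : a * a <= b * b by rewrite ler_pM ?(ltW z0).
    by rewrite -!expr2; lra.
  rewrite normrM normrM normrM normfV (ger0_norm s0) distrC.
  rewrite (ger0_norm (_ : 0 <= a ^+ 3 * b ^+ 3)); last by rewrite mulr_ge0 ?exprn_ge0 ?(ltW w0) ?(ltW z0).
  apply: (@le_trans _ _ (b * (d * (3 * b ^+ 2) / (a ^+ 3 * b ^+ 3)))).
    apply: ler_pM => //; first by rewrite !mulr_ge0 ?invr_ge0 ?mulr_ge0 ?exprn_ge0 ?(ltW w0) ?(ltW z0).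
      exact: coord3_le_enorm.
    by rewrite ler_wpM2r ?ler_pM// invr_ge0 mulr_ge0 ?exprn_ge0 ?(ltW w0) ?(ltW z0).
  by apply: le_of_eq; field; rewrite !gt_eqF.
have h3 : `|newton m z - newton m w| <= 4 * d / a ^+ 3.
  rewrite E; apply: (le_trans (ler_normD _ _)); apply: (le_trans (lerD h1 h2)).
  by rewrite -mulrDl; have -> : d + 3 * d = 4 * d by ring.
apply: (le_trans h3).
have := d0; rewrite le_eqVlt => /predU1P[<-|dp].
  by rewrite mulr0 mul0r !mulr_ge0 ?powR_ge0.
have -> : d = d `^ t * d `^ (1 - t).
  rewrite -powRD ?(gt_eqF dp) ?implybT//.
  by rewrite addrC subrK powRr1.
rewrite (_ : _ `^ t = d `^ t); last by rewrite -powRD ?(gt_eqF dp) ?implybT// addrC subrK powRr1.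
rewrite -!mulrA; apply: ler_wpM2l => //; apply: ler_wpM2l; first exact: powR_ge0.
have -> : a `^ (- (2 + t)) = a `^ (1 - t) / a ^+ 3.
  rewrite -powR_mulrn ?(ltW z0)// -powRN -powRD ?(gt_eqF z0) ?implybT//.
  by congr (_ `^ _); ring.
apply: ler_wpM2r; first by rewrite invr_ge0 exprn_ge0 ?(ltW z0).
by apply: ge0_ler_powR; rewrite ?nnegrE ?subr_ge0 ?(ltW z0).
Qed.

(* At the origin both [newton m] and the negative power of [enorm] are 0. *)
Lemma newton_holder m z w (t : R) : 0 <= t <= 1 ->
  `|newton m z - newton m w| <=
  4 * enorm (z - w) `^ t * (enorm z `^ (- (2 + t)) + enorm w `^ (- (2 + t))).
Proof.
move=> t01; have /andP[t0 t1] := t01.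
have n0 : newton m 0 = 0 by rewrite /newton coord3_0 mul0r.
have z1 u : 0 < enorm u -> enorm u `^ (- 2) <= 4 * enorm u `^ t * enorm u `^ (- (2 + t)).
  move=> u0; rewrite -mulrA -powRD ?(gt_eqF u0) ?implybT//.
  have -> : t - (2 + t) = - 2 by ring.
  by rewrite ler_peMl ?powR_ge0// ler1n.
wlog zw : z w / enorm z <= enorm w => [hw|].
  have [|/ltW] := leP (enorm z) (enorm w); first exact: hw.
  by move=> /hw; rewrite distrC -(enormN (w - z)) opprB [X in _ <= _ * X]addrC.
have := enorm_ge0 z; rewrite le_eqVlt => /predU1P[/esym/enorm_eq0 ->|z0].
  rewrite n0 !sub0r normrN enormN.
  have := enorm_ge0 w; rewrite le_eqVlt => /predU1P[/esym/enorm_eq0 ->|w0].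
    by rewrite n0 normr0 !mulr_ge0 ?addr_ge0 ?powR_ge0.
  apply: (le_trans (newton_le _ _)); apply: (le_trans (z1 _ w0)).
  by rewrite mulrDr lerDr !mulr_ge0 ?powR_ge0.
apply: (le_trans (newton_holder_aux m t01 z0 zw)).
by rewrite mulrDr lerDl !mulr_ge0 ?powR_ge0.
Qed.

End PotentialEstimates.

(** * Mapping properties of the potentials *)

Section PotentialMaps.
Variable R : realType.
Local Notation leb3m := (@leb3m R).
Local Notation M := (measurableTypeR R).
Local Notation T3 := (M * M * M)%type.
Implicit Types x y z w : R3 R.

Lemma powR_interp (a b t u : R) : 0 <= a -> 0 <= b -> 0 <= t -> 0 <= u -> t + u = 1 ->
  a `^ t * b `^ u <= a + b.
Proof.
move=> a0 b0 t0 u0 tu; pose m := Num.max a b.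
have am : a <= m by rewrite le_max lexx.
have bm : b <= m by rewrite le_max lexx orbT.
have m0 : 0 <= m by exact: le_trans am.
apply: (@le_trans _ _ (m `^ t * m `^ u)).
  by apply: ler_pM; rewrite ?powR_ge0//; apply: ge0_ler_powR; rewrite ?nnegrE.
rewrite -powRD; last by rewrite tu oner_eq0.
by rewrite tu powRr1// /m ge_max lerDl lerDr b0.
Qed.

(* Hoelder's inequality for N T = (N^(p/r) T^(s/r)) (N^(1-p/r) T^(1-s/r)). *)
Lemma young_pointwise (N T : T3 -> R) (p r s : R) :
  measurable_fun setT N -> measurable_fun setT T ->
  (forall y, 0 <= N y) -> (forall y, 0 <= T y) ->
  1 < p -> p <= r -> 0 < s -> s <= r -> s^-1 = 1 + r^-1 - p^-1 ->
  (\int[leb3m]_y (N y * T y)%:E <=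
   (\int[leb3m]_y (N y `^ p * T y `^ s)%:E) `^ r^-1 *
   (\int[leb3m]_y (N y `^ p)%:E + \int[leb3m]_y (T y `^ s)%:E) `^ (1 - r^-1))%E.
Proof.
move=> mN mT N0 T0 p1 pr s0 sr sE.
have p0 : 0 < p by rewrite (lt_trans _ p1).
have r1 : 1 < r by exact: lt_le_trans pr.
have r0 : 0 < r by rewrite (lt_trans _ r1).
have ri1 : r^-1 < 1 by rewrite invf_lt1.
have q0 : 0 < (1 - r^-1)^-1 by rewrite invr_gt0 subr_gt0.
pose A y := N y `^ (p / r) * T y `^ (s / r).
pose B y := N y `^ (1 - p / r) * T y `^ (1 - s / r).
have mpow (f : T3 -> R) c : measurable_fun setT f -> measurable_fun setT (fun y => f y `^ c).
  by move=> mf; exact: (measurableT_comp (measurable_powR _) mf).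
have mA : measurable_fun setT A by apply: measurable_funM; exact: mpow.
have mB : measurable_fun setT B by apply: measurable_funM; exact: mpow.
have split1 (t c : R) : 0 <= t -> 0 < c -> t = t `^ c * t `^ (1 - c).
  rewrite le_eqVlt => /predU1P[<- c0|t0 _].
    by rewrite powR0 ?gt_eqF// mul0r.
  by rewrite -powRD ?(gt_eqF t0) ?implybT// addrC subrK powRr1 ?ltW.
have AB y : N y * T y = A y * B y.
  rewrite {1}(split1 (N y) (p / r)) ?divr_gt0// {1}(split1 (T y) (s / r)) ?divr_gt0//.
  by rewrite /A /B mulrACA.
have A0 y : 0 <= A y by rewrite mulr_ge0 ?powR_ge0.
have B0 y : 0 <= B y by rewrite mulr_ge0 ?powR_ge0.
have H := @hoelder _ _ _ leb3m A B r (1 - r^-1)^-1 mA mB r0 q0.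
have {}H := H (ltac:(by rewrite invrK addrC subrK)).
have L1 : ('N[leb3m]_1[EFin \o (A \* B)%R] = \int[leb3m]_y (N y * T y)%:E)%E.
  rewrite Lnorm1; apply: eq_integral => y _ /=.
  by rewrite ger0_norm ?(mulr_ge0 (A0 y) (B0 y))// AB.
have L2 : ('N[leb3m]_r%:E[EFin \o A] = (\int[leb3m]_y (N y `^ p * T y `^ s)%:E) `^ r^-1)%E.
  rewrite unlock /Lnorm; congr (_ `^ _)%E; apply: eq_integral => y _ /=.
  rewrite ger0_norm// powRM ?powR_ge0// -!powRrM !divfK ?gt_eqF//.
have L3 : ('N[leb3m]_((1 - r^-1)^-1)%:E[EFin \o B] <=
   (\int[leb3m]_y (N y `^ p)%:E + \int[leb3m]_y (T y `^ s)%:E) `^ (1 - r^-1))%E.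
  rewrite unlock /Lnorm invrK.
  have mNp : measurable_fun [set: T3] (fun y => (N y `^ p)%:E) by apply/measurable_EFinP; exact: mpow.
  have mTs : measurable_fun [set: T3] (fun y => (T y `^ s)%:E) by apply/measurable_EFinP; exact: mpow.
  have N0p (y : T3) : setT y -> (0 <= (N y `^ p)%:E)%E by rewrite lee_fin powR_ge0.
  have T0s (y : T3) : setT y -> (0 <= (T y `^ s)%:E)%E by rewrite lee_fin powR_ge0.
  rewrite -(ge0_integralD leb3m measurableT N0p mNp T0s mTs).
  apply: gt0_ler_poweR.
  - by rewrite subr_ge0 ltW.
  - by rewrite in_itv/= leey andbT; apply: integral_ge0 => y _; rewrite lee_fin powR_ge0.
  - by rewrite in_itv/= leey andbT; apply: integral_ge0 => y _; rewrite adde_ge0 ?lee_fin ?powR_ge0.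
  apply: ge0_le_integral => //.
  - by move=> y _; rewrite lee_fin powR_ge0.
  - apply/measurable_EFinP; apply: mpow; exact: (measurable_norm mB).
  - exact: emeasurable_funD.
  move=> y _ /=; rewrite lee_fin ger0_norm// powRM ?powR_ge0// -!powRrM.
  (* The exponents are p and s times two weights whose sum is 1 by [sE]; thus B^q is a weighted
     geometric mean of N^p and T^s, at most their sum. *)
  set q := (1 - r^-1)^-1 in q0 *.
  have -> : (1 - p / r) * q = p * ((p^-1 - r^-1) * q) by field; rewrite !gt_eqF.
  have -> : (1 - s / r) * q = s * ((s^-1 - r^-1) * q) by field; rewrite !gt_eqF.
  rewrite (powRrM (N y) p) (powRrM (T y) s); apply: powR_interp; rewrite ?powR_ge0//.
  - by rewrite mulr_ge0 ?(ltW q0)// subr_ge0 lef_pV2.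
  - by rewrite mulr_ge0 ?(ltW q0)// subr_ge0 lef_pV2.
  - rewrite -mulrDl sE (_ : _ + _ = 1 - r^-1); last by ring.
    by rewrite /q mulfV// subr_eq0 eq_sym lt_eqF.
rewrite L1 L2 in H; apply: (le_trans H); apply: lee_wpmul2l => //.
exact: poweR_ge0.
Qed.

(** [young_pointwise] is raised to the power r and integrated in x. Its first factor becomes a
    convolution [J] of two integrable functions, of integral P S by Tonelli; the second is bounded
    by a constant. *)
Lemma young_potential (N V : T3 -> R) (D : set T3) (p r L : R) : 0 < L ->
  measurable_fun setT N -> (forall y, 0 <= N y) ->
  (\int[leb3m]_y (N y `^ p)%:E < +oo)%E ->
  1 < p -> p <= r -> p^-1 - 3^-1 < r^-1 ->
  measurable D -> measurable_fun setT V -> (forall x, 0 <= V x) ->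
  {ae leb3m, forall x : T3, D x ->
    ((V x)%:E <= \int[leb3m]_y (N y * trunc_pow 2 L ((y : R3 R) - x)%R)%:E)%E} ->
  (\int[leb3m]_(x in D) (V x `^ r)%:E < +oo)%E.
Proof.
move=> L0 mN N0 Np p1 pr pr3 mD mV V0 Vle.
have p0 : 0 < p by rewrite (lt_trans _ p1).
have r1 : 1 < r by exact: lt_le_trans pr.
have r0 : 0 < r by rewrite (lt_trans _ r1).
have si0 : 0 < 1 + r^-1 - p^-1.
  by rewrite subr_gt0 ltr_wpDr ?invr_ge0 ?(ltW r0)// invf_lt1.
pose s := (1 + r^-1 - p^-1)^-1.
have s0 : 0 < s by rewrite invr_gt0.
have sE : s^-1 = 1 + r^-1 - p^-1 by rewrite invrK.
have sr : s <= r.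
  rewrite -lef_pV2 ?posrE// sE addrAC lerDr subr_ge0 ltW// invf_lt1//.
(* The hypothesis relating p and r says that 1/s > 2/3, which is the integrability of |z|^(-2 s)
   near 0. *)
have s3 : 2 * s < 3.
  rewrite -ltr_pdivlMl// -ltf_pV2 ?posrE ?mulr_gt0// sE invfM invrK.
  move: pr3; set a := p^-1; set b := r^-1 => h; lra.
pose J x := (\int[leb3m]_y (N y `^ p * trunc_pow (2 * s) L ((y : R3 R) - x)%R)%:E)%E.
pose P := fine (\int[leb3m]_y (N y `^ p)%:E)%E.
pose S := fine (\int[leb3m]_y (trunc_pow (2 * s) L y)%:E)%E.
have NpE : (\int[leb3m]_y (N y `^ p)%:E = P%:E)%E.
  by rewrite fineK// ge0_fin_numE// integral_ge0// => y _; rewrite lee_fin powR_ge0.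
have SE : (\int[leb3m]_y (trunc_pow (2 * s) L y)%:E = S%:E)%E.
  rewrite fineK// ge0_fin_numE; last by apply: integral_ge0 => y _; rewrite lee_fin trunc_pow_ge0.
  by apply: integral_trunc_pow_lty => //; rewrite mulr_gt0.
have P0 : 0 <= P by rewrite fine_ge0// integral_ge0// => y _; rewrite lee_fin powR_ge0.
have S0 : 0 <= S by rewrite fine_ge0// integral_ge0// => y _; rewrite lee_fin trunc_pow_ge0.
have mNp : measurable_fun [set: T3] (fun y => N y `^ p).
  exact: (measurableT_comp (measurable_powR _) mN).
have mJu : measurable_fun [set: T3 * T3] (fun u : T3 * T3 =>
    (N u.2 `^ p * trunc_pow (2 * s) L ((u.2 : R3 R) - u.1))%:E).
  apply/measurable_EFinP; apply: measurable_funM; last exact: measurable_trunc_pow_sub.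
  exact: (measurableT_comp mNp).
have Ju0 (u : T3 * T3) : (0 <= (N u.2 `^ p * trunc_pow (2 * s) L ((u.2 : R3 R) - u.1)%R)%:E)%E.
  by rewrite lee_fin mulr_ge0 ?powR_ge0 ?trunc_pow_ge0.
have mJ : measurable_fun [set: T3] (J : T3 -> _).
  exact: (@measurable_fun_fubini_tonelli_F _ _ _ _ _ leb3m _ mJu Ju0).
have J0 x : (0 <= J x)%E by apply: integral_ge0 => y _; exact: (Ju0 (x, y)).
have iJ : (\int[leb3m]_x J x = (P * S)%:E)%E.
  rewrite (fubini_tonelli (m1 := leb3m) (m2 := leb3m) _ mJu Ju0).
  transitivity (\int[leb3m]_y ((N y `^ p)%:E * S%:E))%E.
    apply: eq_integral => y _.
    have m1 : measurable_fun [set: T3] (fun x : T3 => (trunc_pow (2 * s) L ((y : R3 R) - x))%:E).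
      apply/measurable_EFinP; apply: (measurableT_comp (measurable_trunc_pow _ _)).
      exact: measurable_subr3.
    transitivity (\int[leb3m]_x ((N y `^ p)%:E * (trunc_pow (2 * s) L ((y : R3 R) - x)%R)%:E))%E.
      by apply: eq_integral => x _; rewrite -EFinM.
    rewrite (ge0_integralZl leb3m measurableT m1).
    - by rewrite integral_trunc_pow_subl SE.
    - by move=> x _; rewrite lee_fin trunc_pow_ge0.
    - by rewrite lee_fin powR_ge0.
  have m2 : measurable_fun [set: T3] (fun y => (N y `^ p)%:E) by apply/measurable_EFinP.
  rewrite (ge0_integralZr leb3m measurableT m2).
  - by rewrite NpE EFinM.
  - by move=> x _; rewrite lee_fin powR_ge0.
  - by rewrite lee_fin.
(* The added 1 makes the constant positive, so the bound stays +oo where [J] is infinite. *)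
pose C1 := (P + S + 1) `^ (1 - r^-1).
have C10 : 0 < C1 by rewrite powR_gt0// ltr_wpDl ?addr_ge0.
have VJ : {ae leb3m, forall x : T3, D x -> ((V x `^ r)%:E <= J x * (C1 `^ r)%:E)%E}.
  apply: filterS Vle => x h Dx; move: {h} (h Dx) => h.
  have := young_pointwise mN (measurable_trunc_pow_subr 2 L x) N0
    (fun y => trunc_pow_ge0 _ _ _) p1 pr s0 sr sE.
  under [X in (_ <= X `^ _ * _)%E -> _]eq_integral do rewrite trunc_pow_powR//.
  under [X in (_ <= _ * (_ + X) `^ _)%E -> _]eq_integral do rewrite trunc_pow_powR//.
  rewrite -/(J x) integral_trunc_pow_subr NpE SE -EFinD poweR_EFin => /(le_trans h) {}h.
  have {}h : ((V x)%:E <= J x `^ r^-1 * C1%:E)%E.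
    apply: (le_trans h); apply: lee_wpmul2l; first exact: poweR_ge0.
    have e1 : 0 <= 1 - r^-1 by rewrite subr_ge0 ltW// invf_lt1.
    by rewrite lee_fin; apply: (ge0_ler_powR e1); rewrite ?nnegrE ?addr_ge0// lerDl.
  move: h (J0 x); case: (J x) => [j| |]//.
    rewrite poweR_EFin -!EFinM !lee_fin => h j0.
    have -> : j * C1 `^ r = (j `^ r^-1 * C1) `^ r.
      rewrite powRM ?powR_ge0// -powRrM mulVf ?powRr1// gt_eqF//.
    by apply: ge0_ler_powR; rewrite ?nnegrE ?mulr_ge0 ?powR_ge0// ltW.
  by move=> _ _; rewrite gt0_mulye ?leey// lte_fin powR_gt0.
have mJC : measurable_fun [set: T3] (fun x => J x * (C1 `^ r)%:E)%E by exact: emeasurable_funM.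
have JC0 x : (0 <= J x * (C1 `^ r)%:E)%E by rewrite mule_ge0// lee_fin powR_ge0.
apply: (@le_lt_trans _ _ (\int[leb3m]_(x in D) (J x * (C1 `^ r)%:E))%E).
  apply: ae_ge0_le_integral => //.
  - by move=> x _; rewrite lee_fin powR_ge0.
  - by apply: measurable_funTS; exact: measurable_EFin_powR mV.
  - exact: measurable_funTS.
apply: (@le_lt_trans _ _ (\int[leb3m]_x (J x * (C1 `^ r)%:E))%E).
  exact: ge0_subset_integral.
rewrite (ge0_integralZr leb3m measurableT mJ (fun x _ => J0 x)) ?lee_fin ?powR_ge0//.
by rewrite iJ -EFinM ltry.
Qed.

Lemma integrable_trunc_pow (N : T3 -> R) (a L q q' : R) x :
  measurable_fun setT N -> (forall y, 0 <= N y) -> 0 < L ->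
  (\int[leb3m]_y (N y `^ q)%:E < +oo)%E ->
  0 < q -> 0 < q' -> q^-1 + q'^-1 = 1 -> 0 < a -> a * q' < 3 ->
  leb3m.-integrable setT (fun y : T3 => (N y * trunc_pow a L ((y : R3 R) - x))%:E).
Proof.
move=> mN N0 L0 Nq q0 q'0 qq' a0 a3.
have m1 : measurable_fun [set: T3] (fun y : T3 => (N y * trunc_pow a L ((y : R3 R) - x))%:E).
  by apply/measurable_EFinP; apply: measurable_funM => //; exact: measurable_trunc_pow_subr.
apply/integrableP; split => //.
apply: (@le_lt_trans _ _ (\int[leb3m]_y (N y * trunc_pow a L ((y : R3 R) - x)%R)%:E)%E).
  apply/le_of_eq/eq_integral => y _.
  by rewrite gee0_abs// lee_fin mulr_ge0 ?trunc_pow_ge0.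
apply: (le_lt_trans (integral_potential_le a L x mN N0 q0 q'0 qq')).
by rewrite lte_add_pinfty// integral_trunc_pow_lty// a3 mulr_gt0.
Qed.

Section HoelderContinuity.
Variables (F : 'I_3 -> T3 -> R) (L q q' t : R).
Hypotheses (L0 : 0 < L) (mF : forall m, measurable_fun setT (F m))
  (F0 : forall m y, L < sup3 y -> F m y = 0)
  (Fq : (\int[leb3m]_y (sum_norm F y `^ q)%:E < +oo)%E)
  (q0 : 0 < q) (q'0 : 0 < q') (qq' : q^-1 + q'^-1 = 1)
  (t01 : 0 <= t <= 1) (tq : (2 + t) * q' < 3).

Let L20 : 0 < 2 * L. Proof. by rewrite mulr_gt0. Qed.

Let mN : measurable_fun setT (sum_norm F : T3 -> R).
Proof. exact: measurable_sum_norm. Qed.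

Let mFk x : measurable_fun [set: T3] (fun y : T3 => sum_kern F 0 x y).
Proof. exact: (measurableT_comp (measurable_sum_kern 0 mF) (pair1_measurable x)). Qed.

Lemma integrable_sum_kern x : sup3 x <= L ->
  leb3m.-integrable setT (fun y : T3 => (sum_kern F 0 x y)%:E).
Proof.
have /andP[t0 t1] := t01.
have q2 : 2 * q' < 3 by apply: le_lt_trans tq; rewrite ler_wpM2r ?(ltW q'0)// lerDl.
move=> xL.
have := integrable_trunc_pow x mN (sum_norm_ge0 F) L20 Fq q0 q'0 qq' (ltr0n R 2) q2.
apply: le_integrable => //; first by apply/measurable_EFinP; exact: mFk.
move=> y _; rewrite lee_fin [leRHS]ger0_norm; last first.
  by rewrite mulr_ge0 ?sum_norm_ge0 ?trunc_pow_ge0.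
have [yL|yL] := leP (sup3 y) L; last first.
  have -> : sum_kern F 0 x y = 0 by rewrite /sum_kern big1// => m _; rewrite F0 ?mul0r.
  by rewrite normr0 mulr_ge0 ?sum_norm_ge0 ?trunc_pow_ge0.
apply: (le_trans (ler_norm_sum _ _ _)).
rewrite mulr_suml; apply: ler_sum => m _; rewrite normrM ler_wpM2l//.
by rewrite /trunc_pow sup3B//; exact: kern_le.
Qed.

Definition potential x : R := (\int[leb3m]_y sum_kern F 0 x y)%R.

(** By [newton_holder] the difference is at most 4 |x - x'|^t times the sum of two potentials with
    kernel |z|^(-2-t). Each is at most K, since (2 + t) q' < 3; hence the constant 8 K. *)
Lemma potential_holder : exists C : R, forall x x', sup3 x <= L -> sup3 x' <= L ->
  `|potential x - potential x'| <= C * enorm (x - x') `^ t.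
Proof.
have /andP[t0 t1] := t01.
have a0 : 0 < 2 + t by rewrite ltr_pwDl.
pose T z := trunc_pow (2 + t) (2 * L) z.
pose K := (\int[leb3m]_y (sum_norm F y `^ q)%:E + \int[leb3m]_z (trunc_pow ((2 + t) * q') (2 * L) z)%:E)%E.
have Kfin : K \is a fin_num.
  rewrite ge0_fin_numE.
    by rewrite lte_add_pinfty// integral_trunc_pow_lty// tq mulr_gt0.
  by rewrite adde_ge0// integral_ge0// => y _; rewrite lee_fin ?powR_ge0 ?trunc_pow_ge0.
exists (8 * fine K) => x x' xL x'L.
have ix := integrable_sum_kern xL; have ix' := integrable_sum_kern x'L.
rewrite /potential -RintegralB//.
pose d := enorm (x - x').
have iT z : leb3m.-integrable setT (fun y : T3 => (sum_norm F y * T ((y : R3 R) - z))%:E).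
  exact: (integrable_trunc_pow z mN (sum_norm_ge0 F) L20 Fq q0 q'0 qq' a0 tq).
have TK z : (\int[leb3m]_y (sum_norm F y * T ((y : R3 R) - z)%R)%:E <= K)%E.
  exact: (integral_potential_le _ _ _ mN (sum_norm_ge0 F) q0 q'0 qq').
have ib : leb3m.-integrable setT (fun y : T3 => (4 * d `^ t)%:E *
   ((sum_norm F y * T ((y : R3 R) - x)%R)%:E + (sum_norm F y * T ((y : R3 R) - x')%R)%:E))%E.
  by apply: integrableZl => //; apply: integrableD.
rewrite -lee_fin.
have id : leb3m.-integrable setT (fun y : T3 => (sum_kern F 0 x y - sum_kern F 0 x' y)%:E).
  by under eq_fun do rewrite EFinB; exact: integrableB.
rewrite -abse_EFin /Rintegral fineK; last exact: integrable_fin_num.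
apply: (le_trans (le_abse_integral leb3m measurableT (measurable_int _ id))).
apply: (@le_trans _ _ (\int[leb3m]_y ((4 * d `^ t)%:E *
   ((sum_norm F y * T ((y : R3 R) - x)%R)%:E + (sum_norm F y * T ((y : R3 R) - x')%R)%:E)))%E).
  apply: ge0_le_integral => //.
  - by apply: measurableT_comp => //; exact: measurable_int id.
  - exact: measurable_int ib.
  move=> y _; rewrite -EFinD -EFinM lee_fin.
  have [yL|yL] := leP (sup3 y) L; last first.
    have z0 u : sum_kern F 0 u y = 0 by rewrite /sum_kern big1// => m _; rewrite F0 ?mul0r.
    rewrite !z0 subr0 normr0 mulr_ge0 ?mulr_ge0 ?powR_ge0//.
    by rewrite addr_ge0// mulr_ge0 ?sum_norm_ge0 ?trunc_pow_ge0.
  rewrite /sum_kern -sumrB -mulrDr mulrCA mulr_suml.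
  apply: (le_trans (ler_norm_sum _ _ _)); apply: ler_sum => m _.
  rewrite -mulrBr normrM ler_wpM2l//.
  rewrite !kern0E -opprD normrN.
  have := newton_holder m ((y : R3 R) - x) ((y : R3 R) - x') t01.
  have -> : ((y : R3 R) - x) - ((y : R3 R) - x') = x' - x by rewrite opprB addrC addrA subrK.
  rewrite -(enormN (x' - x)) opprB -/d.
  have -> : T ((y : R3 R) - x) = enorm ((y : R3 R) - x) `^ (- (2 + t)).
    by rewrite /T /trunc_pow (sup3B xL yL).
  have -> : T ((y : R3 R) - x') = enorm ((y : R3 R) - x') `^ (- (2 + t)).
    by rewrite /T /trunc_pow (sup3B x'L yL).
  exact.
rewrite integralZl//; last exact: integrableD.
rewrite integralD//.
apply: (@le_trans _ _ ((4 * d `^ t)%:E * (K + K))%E).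
  by apply: lee_wpmul2l; [rewrite lee_fin mulr_ge0 ?powR_ge0|exact: leeD].
rewrite -(fineK Kfin) -EFinD -EFinM lee_fin -/d.
by apply: le_of_eq; ring.
Qed.

End HoelderContinuity.

End PotentialMaps.

(** * Interior regularity *)

Section BallsAndBumps.
Variable R : realType.
Local Notation M := (measurableTypeR R).
Local Notation T3 := (M * M * M)%type.
Implicit Types x y z w c : R3 R.

Definition cball c (r : R) : set (R3 R) := [set x | enorm (x - c) <= r].

Lemma enorm_continuous c : continuous (fun y => enorm (y - c)).
Proof.
move=> y; apply: (@continuous_comp _ _ _ (fun y => nsq3 (y - c)) Num.sqrt).
  exact: nsq3_continuous.
exact: sqrt_continuous.
Qed.

Lemma cball_closed c r : closed (cball c r).
Proof.
have := closed_comp (f := fun y => enorm (y - c)) (D := [set t | t <= r]).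
apply; last exact: closed_le.
by move=> y _; exact: enorm_continuous.
Qed.

Lemma eball_open c r : open (eball c r).
Proof.
have /continuousP h := @enorm_continuous c.
exact: (h [set t | t < r] (@open_lt _ r)).
Qed.

Lemma compact_box3 (L : R) : compact [set x : R3 R | sup3 x <= L].
Proof.
have -> : [set x : R3 R | sup3 x <= L] = (`[- L, L]%classic `*` `[- L, L]%classic) `*` `[- L, L]%classic.
  apply/seteqP; split => -[[x1 x2] x3]; rewrite /= sup3_le/= !ler_norml !in_itv/=.
    by move=> /and3P[-> -> ->].
  by move=> [[-> ->] ->].
by apply: compact_setX; [apply: compact_setX|]; exact: segment_compact.
Qed.

Lemma sup3_tri x y : sup3 (x + y) <= sup3 x + sup3 y.
Proof.
have := lexx (sup3 x); have := lexx (sup3 y); rewrite !sup3_le.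
move=> /and3P[y1 y2 y3] /and3P[x1 x2 x3]; apply/and3P; split.
- by rewrite (le_trans (ler_normD _ _))// lerD.
- by rewrite (le_trans (ler_normD _ _))// lerD.
- by rewrite (le_trans (ler_normD _ _))// lerD.
Qed.

Lemma closed_sup3_compact (K : set (R3 R)) (L : R) : closed K -> (forall x, K x -> sup3 x <= L) -> compact K.
Proof. by move=> cK KL; apply: (subclosed_compact cK (@compact_box3 L)). Qed.

Lemma cball_compact c r : compact (cball c r).
Proof.
apply: (@closed_sup3_compact _ (r + sup3 c)); first exact: cball_closed.
move=> x xr; rewrite -[x in sup3 x](subrK c).
by apply: (le_trans (sup3_tri _ _)); rewrite lerD2r (le_trans (sup3_le_enorm _)).
Qed.

Lemma compact_support_bounded (f : R3 R -> R) c r : continuous f ->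
  (forall y, ~ cball c r y -> f y = 0) -> exists C, 0 <= C /\ forall y, `|f y| <= C.
Proof.
move=> cf f0; have cK := continuous_compact (continuous_subspaceT cf) (@cball_compact c r).
have [K [_ hK]] := compact_bounded cK.
exists (`|K| + 1); split=> [|y]; first by rewrite addr_ge0.
have [yc|/f0 ->] := pselect (cball c r y); last by rewrite normr0 addr_ge0.
by apply: hK; [rewrite ltr_pwDr// ler_norm|exists y].
Qed.

Lemma cutoff_ge0 c r y : 0 <= cutoff c r y.
Proof. exact: flat_ge0. Qed.

Lemma flat_le_sqr m r (t : R) : t <= r ^+ 2 -> `|flat m t| <= (m.+1)`!%:R * r ^+ 2.
Proof.
move=> tr; have [t0|t0] := leP t 0.
  by rewrite flat_eq0// normr0 mulr_ge0 ?sqr_ge0.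
by apply: (le_trans (flat_le _ _)); rewrite gtr0_norm// ler_wpM2l.
Qed.

Lemma cutoff_le c r y : `|cutoff c r y| <= r ^+ 2.
Proof.
rewrite -[leRHS]mul1r; apply: (@flat_le_sqr 0).
by rewrite gerBl nsq3_ge0.
Qed.

(** 12 is 3! times 2: the bound of [flat 2] times the factor 2 |y_k - c_k| <= 2 r. *)
Lemma dcutoff_le c r k y : 0 <= r -> `|dcutoff c r k y| <= 12 * r ^+ 3.
Proof.
move=> r0; have [yr|ry] := leP r (enorm (y - c)).
  by rewrite dcutoff_eq0// normr0 mulr_ge0 ?exprn_ge0.
have h1 : `|flat 2 (r ^+ 2 - nsq3 (y - c))| <= 6 * r ^+ 2.
  by apply: (@flat_le_sqr 2); rewrite gerBl nsq3_ge0.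
have h2 : `|- 2 * coord3 (y - c) k| <= 2 * r.
  rewrite mulNr normrN normrM ger0_norm// ler_wpM2l//.
  by apply: (le_trans (coord3_le_enorm _ _)); exact: ltW.
rewrite normrM; apply: (le_trans (ler_pM _ _ h1 h2)) => //.
by apply: le_of_eq; ring.
Qed.

Lemma cutoff_lower c r r' y : 0 <= r' -> r' < r -> enorm (y - c) <= r' ->
  flat 0 (r ^+ 2 - r' ^+ 2) <= cutoff c r y.
Proof.
move=> r'0 rr' yr'; have r0 : 0 <= r by rewrite (le_trans r'0)// ltW.
have h : nsq3 (y - c) <= r' ^+ 2.
  by rewrite -[leLHS]sqr_sqrtr ?nsq3_ge0// ler_sqr ?nnegrE ?sqrtr_ge0.
have p : 0 < r ^+ 2 - r' ^+ 2 by rewrite subr_gt0 ltr_sqr.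
have q : 0 < r ^+ 2 - nsq3 (y - c) by rewrite subr_gt0 (le_lt_trans h)// -subr_gt0.
rewrite /cutoff /flat p q !expr0 !mul1r ler_expR lerN2 lef_pV2 ?posrE//.
by rewrite lerD2l lerN2.
Qed.

Lemma measurable_cutoff c r : measurable_fun [set: T3] (fun y : T3 => cutoff c r y).
Proof. by apply: continuous_measurable_fun3; exact: cutoff_continuous. Qed.

Lemma measurable_dcutoff c r k : measurable_fun [set: T3] (fun y : T3 => dcutoff c r k y).
Proof. by apply: continuous_measurable_fun3; exact: dcutoff_continuous. Qed.

(** A point of the closed ball is approached along its radius, moving slightly towards c. *)
Lemma closure_eball c r : 0 < r -> closure (eball c r) = cball c r.
Proof.
move=> r0; apply/seteqP; split.
  rewrite closureE => x; apply; split; first exact: cball_closed.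
  by move=> y /ltW.
move=> x xr B /nbhs_ballP[e /= e0 eB].
pose f (t : R) := x + t *: (c - x).
have cf : {for (0 : R), continuous f}.
  by apply: cvgD; [exact: cvg_cst|apply: cvgZr_tmp; exact: cvg_id].
have f0 : f 0 = x by rewrite /f scale0r addr0.
have : \forall t \near (0 : R), ball x e (f t).
  by apply: cf; rewrite f0; exact: nbhsx_ballx.
move=> /nbhs_ballP[d /= d0 dB].
pose t := Num.min (d / 2) (1 / 2).
have t0 : 0 < t by rewrite lt_min !divr_gt0.
have td : t < d by rewrite gt_min ltr_pdivrMr// ltr_pMr// ltr1n.
have t1 : t < 1 by rewrite gt_min orbC ltr_pdivrMr// mul1r ltr1n.
exists (f t); split; last first.
  by apply: eB; apply: dB; rewrite /ball/= sub0r normrN gtr0_norm.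
rewrite /eball/=.
have -> : f t - c = (1 - t) *: (x - c).
  rewrite /f scalerBl scale1r -(opprB x c) scalerN.
  by rewrite -addrA [X in _ + X = _]addrC addrA.
rewrite enormE nsq3Z sqrtrM ?sqr_ge0// sqrtr_sqr -enormE.
rewrite ger0_norm; last by rewrite subr_ge0 ltW.
have := xr; rewrite /cball/= le_eqVlt => /predU1P[->|xr'].
  by rewrite gtr_pMl// gtrBl.
apply: le_lt_trans xr'; rewrite ler_piMl ?enorm_ge0// gerBl ltW//.
Qed.

(** The part of a larger ball outside G is compact. Unless it is empty, it has a point nearest to c,
    at distance more than r; the mean of r and that distance is an admissible radius. *)
Lemma cball_enlarge (G : set (R3 R)) c r : open G -> 0 <= r -> cball c r `<=` G ->
  exists2 r', r < r' & cball c r' `<=` G.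
Proof.
move=> oG r0 cG; pose K := cball c (r + 1) `\` G.
have cK : compact K.
  apply: (@closed_sup3_compact _ (r + 1 + sup3 c)).
    by apply: closedI; [exact: cball_closed|exact: open_closedC].
  move=> x [xr _]; rewrite -[x in sup3 x](subrK c).
  by apply: (le_trans (sup3_tri _ _)); rewrite lerD2r (le_trans (sup3_le_enorm _)).
have [K0|/set0P K0] := eqVneq K set0.
  exists (r + 1); first by rewrite ltrDl.
  move=> x xr; apply: contrapT => xG.
  by have : K x by []; rewrite K0.
have cf : {within K, continuous (fun y => enorm (y - c))}.
  by apply: continuous_subspaceT; exact: enorm_continuous.
have [m /set_mem[mr mG] mK] := compact_EVT_min K0 cK cf.
have rm : r < enorm (m - c).
  by rewrite ltNge; apply/negP => h; apply: mG; exact: cG.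
exists ((r + enorm (m - c)) / 2); first by rewrite ltr_pdivlMr// mulr_natr mulr2n ltrD2l.
move=> x xr; apply: contrapT => xG.
have xm : enorm (x - c) < enorm (m - c).
  apply: (le_lt_trans xr).
  by rewrite ltr_pdivrMr// mulr_natr mulr2n ltrD2r.
have : K x by split => //; rewrite /cball/= (le_trans (ltW xm)).
by move=> /mem_set/mK; rewrite leNgt xm.
Qed.

Lemma flat_lipschitz m r (a b : R) : a <= r ^+ 2 -> b <= r ^+ 2 ->
  `|flat m a - flat m b| <= ((m.+3)`!%:R + m%:R * (m.+2)`!%:R) * r ^+ 2 * `|a - b|.
Proof.
wlog ab : a b / a <= b => [hw|].
  have [ab|/ltW ba] := leP a b; first exact: hw.
  by move=> ? ?; rewrite distrC (distrC a); exact: hw.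
move=> ar br; move: ab; rewrite le_eqVlt => /predU1P[->|ab].
  by rewrite !subrr !normr0 mulr0.
have [|s zab] := MVT ab (fun (z : R) _ => is_derive_flat m z).
  apply: continuous_subspaceT; exact: flat_continuous.
rewrite distrC => ->; rewrite (distrC a) normrM ler_wpM2r//.
have zr : s <= r ^+ 2.
  by move: zab; rewrite in_itv/= => /andP[_ /ltW/le_trans]; apply.
apply: (le_trans (ler_normB _ _)); rewrite mulrDl lerD ?flat_le_sqr//.
by rewrite normrM ger0_norm// -mulrA ler_wpM2l// flat_le_sqr.
Qed.

(** [flat 0] has Lipschitz constant 3! r^2 here, and the difference of squared norms is at most 2 r
    times the distance. *)
Lemma cutoff_lipschitz c r x x' : 0 <= r -> enorm (x - c) <= r -> enorm (x' - c) <= r ->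
  `|cutoff c r x - cutoff c r x'| <= 12 * r ^+ 3 * enorm (x - x').
Proof.
move=> r0 xr xr'.
have := @flat_lipschitz 0 r (r ^+ 2 - nsq3 (x - c)) (r ^+ 2 - nsq3 (x' - c)).
rewrite !gerBl !nsq3_ge0 => /(_ isT isT) h.
apply: (le_trans h); rewrite mul0r addr0.
have E (y : R3 R) : nsq3 y = enorm y ^+ 2 by rewrite enormE sqr_sqrtr ?nsq3_ge0.
have -> : r ^+ 2 - nsq3 (x - c) - (r ^+ 2 - nsq3 (x' - c)) =
    (enorm (x' - c) - enorm (x - c)) * (enorm (x' - c) + enorm (x - c)).
  by rewrite !E; ring.
have h1 : `|enorm (x' - c) - enorm (x - c)| <= enorm (x - x').
  apply: (le_trans (ler_dist_enorm _ _)).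
  by rewrite opprB addrA subrK -enormN opprB.
have h2 : `|enorm (x' - c) + enorm (x - c)| <= 2 * r.
  by rewrite ger0_norm ?addr_ge0 ?enorm_ge0// mulr_natl mulr2n lerD.
rewrite normrM; have := ler_pM (normr_ge0 _) (normr_ge0 _) h1 h2.
move=> /(ler_wpM2l (_ : 0 <= 6 * r ^+ 2)) => /(_ (mulr_ge0 (ler0n _ _) (sqr_ge0 _))).
by move=> /le_trans; apply; apply: le_of_eq; ring.
Qed.

End BallsAndBumps.

(** * The tested equation in a ball *)

Section LocalRepresentation.
Variable R : realType.
Local Notation leb3m := (@leb3m R).
Local Notation M := (measurableTypeR R).
Local Notation T3 := (M * M * M)%type.
Implicit Types x y z : R3 R.
Variables (G : set (R3 R)) (L Cn : R) (n V : T3 -> R).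
Variables (A : 'I_3 -> 'I_3 -> T3 -> R) (B : 'I_3 -> T3 -> R).
Hypotheses (GL : forall y, G y -> sup3 y < L) (Cn0 : 0 <= Cn).
Hypotheses (mV : measurable_fun setT V) (mA : forall k m, measurable_fun setT (A k m))
  (mB : forall m, measurable_fun setT (B m)) (mn : measurable_fun setT n).
Hypotheses (n0 : forall y, 0 <= n y) (in1 : leb3m.-integrable setT (EFin \o n)).
Hypothesis dom : {ae leb3m, forall y : T3, `|V y| <= Cn * n y /\
  (forall k m, `|A k m y| <= Cn * n y) /\ forall m, `|B m y| <= Cn * n y}.
(* V, A and B stand for a real component of w^*, w^* e_k e_m and (D w)^* e_m,
   where ^* is the quaternionic conjugate. *)
Hypothesis clifford : forall k m y, A k m y + A m k y = - (2 * (k == m)%:R) * V y.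
Hypothesis weak : forall m (zeta : R3 R -> R), smooth zeta ->
  (exists K, [/\ compact K, K `<=` G & forall x, ~ K x -> zeta x = 0]) ->
  (\int[leb3m]_y (\sum_k A k m y * partial k zeta y) =
   \int[leb3m]_y (B m y * zeta y))%R.
Variables (c : R3 R) (r : R).
Hypotheses (r0 : 0 < r) (cG : cball c r `<=` G).

(** The coefficient of [rho] in the summed equation; 3 is the factor between [rho] and minus the
    Laplacian. *)
Definition source_val y : R := 3 * (cutoff c r y * V y).

(** The terms that involve the kernel without further derivatives: the right-hand side of the
    equation, and the terms where the derivative falls on the cutoff. *)
Definition source_kern (m : 'I_3) y : R :=
  cutoff c r y * B m y - \sum_k dcutoff c r k y * A k m y.

Let L0 : 0 < L.
Proof.
have : G c by apply: cG; rewrite /cball/= subrr enorm0 ltW.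
by move=> /GL; apply: le_lt_trans; rewrite /sup3 le_max normr_ge0 orbT.
Qed.

Let notG_r y : L <= sup3 y -> r <= enorm (y - c).
Proof.
move=> Ly; rewrite leNgt; apply/negP => /ltW yr.
by have := GL (cG yr); rewrite ltNge Ly.
Qed.

Lemma source_kern_eq0 m y : L < sup3 y -> source_kern m y = 0.
Proof.
move=> /ltW/notG_r ry; rewrite /source_kern cutoff_eq0 ?(ltW r0)// mul0r big1 ?subr0//.
by move=> k _; rewrite dcutoff_eq0 ?mul0r// ltW.
Qed.

Lemma measurable_source_kern m : measurable_fun setT (source_kern m : T3 -> R).
Proof.
apply: measurable_funB; first by apply: measurable_funM => //; exact: measurable_cutoff.
apply: measurable_sum => k; apply: measurable_funM => //; exact: measurable_dcutoff.
Qed.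

Lemma measurable_source_val : measurable_fun setT (source_val : T3 -> R).
Proof.
apply: measurable_funM => //; apply: measurable_funM => //; exact: measurable_cutoff.
Qed.

(** The factor 3 counts the indices m, r^2 bounds the cutoff, and 36 r^3 is three times the bound of
    its derivatives. *)
Definition source_cst : R := 3 * Cn * (r ^+ 2 + 36 * r ^+ 3).

Lemma source_cst_ge0 : 0 <= source_cst.
Proof.
by rewrite mulr_ge0 ?mulr_ge0// addr_ge0 ?sqr_ge0// mulr_ge0// exprn_ge0// ltW.
Qed.

Lemma source_norm_le : {ae leb3m, forall y : T3,
  sum_norm source_kern y <= source_cst * (n y * \1_(cball c r) y)}.
Proof.
apply: filterS dom => y [_ [hA hB]]; rewrite indicE.
have [/set_mem yr|/negP yr] := boolP (y \in cball c r); last first.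
  have {}yr : r <= enorm ((y : R3 R) - c).
    by rewrite leNgt; apply/negP => h; apply: yr; apply/mem_set/ltW.
  rewrite mulr0 mulr0 /sum_norm big1// => m _.
  rewrite /source_kern cutoff_eq0 ?(ltW r0)// mul0r big1 ?subr0 ?normr0//.
  by move=> k _; rewrite dcutoff_eq0 ?mul0r// ltW.
rewrite mulr1; have nC : 0 <= Cn * n y by rewrite mulr_ge0.
have h m : `|source_kern m y| <= (r ^+ 2 + 36 * r ^+ 3) * (Cn * n y).
  apply: (le_trans (ler_normB _ _)); rewrite mulrDl; apply: lerD.
    by rewrite normrM ler_pM ?cutoff_le.
  apply: (le_trans (ler_norm_sum _ _ _)).
  apply: (@le_trans _ _ (\sum_(k < 3) 12 * r ^+ 3 * (Cn * n y))).
    by apply: ler_sum => k _; rewrite normrM ler_pM// dcutoff_le// ltW.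
  rewrite sumr_const card_ord -mulr_natl; apply: le_of_eq; ring.
apply: (@le_trans _ _ (\sum_(m < 3) (r ^+ 2 + 36 * r ^+ 3) * (Cn * n y))).
  by apply: ler_sum => m _.
rewrite sumr_const card_ord -mulr_natl; apply: le_of_eq.
by rewrite /source_cst; ring.
Qed.

Lemma source_val_le : {ae leb3m, forall y : T3, `|source_val y| <= source_cst * n y}.
Proof.
apply: filterS dom => y [hV _].
rewrite /source_val normrM ger0_norm// normrM /source_cst -!mulrA ler_wpM2l//.
apply: (@le_trans _ _ (r ^+ 2 * (Cn * n y))); first by rewrite ler_pM ?cutoff_le.
rewrite mulrA [leRHS]mulrA ler_wpM2r// mulrC ler_wpM2l// lerDl.
by rewrite mulr_ge0// exprn_ge0// ltW.
Qed.

Let integrable_dom (f : T3 -> R) (C : R) : measurable_fun setT f ->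
  {ae leb3m, forall y : T3, `|f y| <= C * n y} -> leb3m.-integrable setT (EFin \o f).
Proof.
move=> mf fn; apply/integrableP; split; first exact/measurable_EFinP.
apply: (@le_lt_trans _ _ (\int[leb3m]_y (`|C| * n y)%:E)%E).
  apply: ae_ge0_le_integral => //.
  - by apply/measurable_EFinP; exact: (measurable_norm mf).
  - by move=> y _; rewrite lee_fin mulr_ge0.
  - by apply/measurable_EFinP; exact: measurable_funM.
  - apply: filterS fn => y h _; rewrite lee_fin; apply: (le_trans h).
    by rewrite ler_wpM2r// ler_norm.
under eq_integral do rewrite EFinM.
have mnE : measurable_fun setT (EFin \o n) by apply/measurable_EFinP.
rewrite (ge0_integralZl leb3m measurableT mnE) ?lee_fin//; last first.
  by move=> y _; rewrite lee_fin.
apply: lte_mul_pinfty; rewrite ?lee_fin//.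
have /integrableP[_] := in1; apply: le_lt_trans.
by apply/le_of_eq/eq_integral => y _ /=; rewrite ger0_norm.
Qed.

Lemma integrable_source_val : leb3m.-integrable setT (EFin \o source_val).
Proof. exact: integrable_dom measurable_source_val source_val_le. Qed.

Lemma integrable_source_norm : leb3m.-integrable setT (EFin \o sum_norm source_kern).
Proof.
apply: (@integrable_dom _ source_cst).
  by apply: measurable_sum_norm; exact: measurable_source_kern.
apply: filterS source_norm_le => y h; rewrite ger0_norm ?sum_norm_ge0//.
apply: (le_trans h); rewrite ler_wpM2l ?source_cst_ge0// ler_piMr//.
Qed.

(** The left side minus the right side of [weak] for the test function [cutoff] times [kern]; its
    integral is 0 for e > 0. *)
Let Dm (e : R) x m y := \sum_k A k m y * partial k (fun y => cutoff c r y * kern e m x y) y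
  - B m y * (cutoff c r y * kern e m x y).

(** The Hessian is symmetric, so adding the double sum to its transpose brings in [clifford]. Only
    the diagonal survives, that is the Laplacian -3 [rho], with coefficient -2 V; half of the result
    is the claim. *)
Lemma sum_hessian (e : R) x y : e != 0 ->
  \sum_m \sum_k A k m y * (3 * coord3 (y - x) m * coord3 (y - x) k * inv_dist e x y ^+ 5
     - (k == m)%:R * inv_dist e x y ^+ 3) = 3 * (V y * rho e x y).
Proof.
move=> e0; set J := inv_dist e x y; pose s (k m : 'I_3) :=
  3 * coord3 (y - x) m * coord3 (y - x) k * J ^+ 5 - (k == m)%:R * J ^+ 3.
rewrite -[LHS]/(\sum_m \sum_k A k m y * s k m).
set S := LHS.
have SS : S + S = \sum_m \sum_k (- (2 * (k == m)%:R) * V y) * s k m.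
  rewrite {2}/S exchange_big/= -big_split/=; apply: eq_bigr => m _.
  rewrite -big_split/=; apply: eq_bigr => k _.
  rewrite -clifford mulrDl; congr (_ + _); rewrite /s (eq_sym m k); congr (_ * _); ring.
have {SS}SS : S + S = - 2 * V y * (3 * nsq3 (y - x) * J ^+ 5 - 3 * J ^+ 3).
  rewrite SS (eq_bigr (fun m => - 2 * V y * s m m)) => [|m _].
    rewrite -mulr_sumr; congr (_ * _).
    have ss m : s m m = 3 * coord3 (y - x) m ^+ 2 * J ^+ 5 - J ^+ 3.
      by rewrite /s eqxx mul1r expr2 mulrA.
    by under eq_bigr do rewrite ss; rewrite /nsq3 !big_ord_recl !big_ord0; ring.
  rewrite (bigD1 m)//= eqxx big1 ?addr0 ?mulr1// => k km.
  by rewrite (negbTE km) mulr0 oppr0 !mul0r.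
have J2 : nsq3 (y - x) * J ^+ 2 = 1 - e ^+ 2 * J ^+ 2.
  by rewrite -(nsq3_inv_dist x y e0) mulrDl addrK.
have E : 3 * nsq3 (y - x) * J ^+ 5 - 3 * J ^+ 3 = - (3 * rho e x y).
  rewrite /rho -/J (_ : 3 * nsq3 (y - x) * J ^+ 5 = 3 * (nsq3 (y - x) * J ^+ 2) * J ^+ 3); last by ring.
  by rewrite J2; ring.
move: SS; rewrite E => SS; have : 2 * S = 2 * (3 * (V y * rho e x y)).
  by rewrite mulr_natl mulr2n SS; ring.
by apply: mulfI; rewrite pnatr_eq0.
Qed.

Lemma sum_Dm (e : R) x y : e != 0 ->
  \sum_m Dm e x m y = source_val y * rho e x y - sum_kern source_kern e x y.
Proof.
move=> e0; rewrite /Dm /source_val.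
have -> : 3 * (cutoff c r y * V y) * rho e x y = cutoff c r y * (3 * (V y * rho e x y)) by ring.
rewrite -(sum_hessian x y e0) mulr_sumr /sum_kern -sumrB; apply: eq_bigr => m _.
under eq_bigr do rewrite (partial_cutoff_kern _ _ _ _ _ _ e0).
rewrite /source_kern mulrBl mulr_sumr mulr_suml opprB addrA -big_split/=; congr (_ - _).
  by apply: eq_bigr => k _; ring.
ring.
Qed.

Let smooth_test (e : R) x m : 0 < e ->
  (\int[leb3m]_y Dm e x m y = 0)%R /\
  leb3m.-integrable setT (fun y : T3 => (Dm e x m y)%:E).
Proof.
move=> e0; have en0 : e != 0 by rewrite gt_eqF.
pose zeta y := cutoff c r y * kern e m x y.
have sz : smooth zeta by exact: smooth_cutoff_kern.
have cz y : ~ cball c r y -> zeta y = 0.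
  move=> /negP; rewrite -ltNge => /ltW h.
  by rewrite /zeta cutoff_eq0 ?mul0r// ltW.
have w := weak m sz (ex_intro _ (cball c r) (And3 (@cball_compact _ c r) cG cz)).
have mz : measurable_fun [set: T3] (fun y : T3 => zeta y).
  by apply: continuous_measurable_fun3; have [] := sz [::].
have mp k : measurable_fun [set: T3] (fun y : T3 => partial k zeta y).
  by apply: continuous_measurable_fun3; have [] := sz [:: k].
have [Cz [Cz0 zb]] : exists C, 0 <= C /\ forall y, `|zeta y| <= C.
  by apply: (@compact_support_bounded _ _ c r) => //; have [] := sz [::].
have /choice[Cp hp] k : exists C, 0 <= C /\ forall y, `|partial k zeta y| <= C.
  apply: (@compact_support_bounded _ _ c r); first by have [] := sz [:: k].
  move=> y /negP; rewrite -ltNge => /ltW h.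
  by rewrite partial_cutoff_kern// cutoff_eq0 ?dcutoff_eq0 ?(ltW r0)// !mul0r addr0.
have i1 : leb3m.-integrable setT (EFin \o (fun y : T3 => \sum_k A k m y * partial k zeta y)).
  apply: (@integrable_dom _ (\sum_k Cn * Cp k)).
    by apply: measurable_sum => k; exact: measurable_funM.
  apply: filterS dom => y [_ [hA _]].
  apply: (le_trans (ler_norm_sum _ _ _)); rewrite mulr_suml; apply: ler_sum => k _.
  by have [_ pk] := hp k; rewrite normrM mulrAC ler_pM.
have i2 : leb3m.-integrable setT (EFin \o (fun y : T3 => B m y * zeta y)).
  apply: (@integrable_dom _ (Cn * Cz)); first exact: measurable_funM.
  by apply: filterS dom => y [_ [_ hB]]; rewrite normrM mulrAC ler_pM.
split.
  rewrite /Dm RintegralB//; rewrite w subrr//.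
by under eq_fun do rewrite EFinB; exact: integrableB.
Qed.

Lemma source_identity (e : R) x : 0 < e ->
  (\int[leb3m]_y (source_val y * rho e x y)%:E =
   \int[leb3m]_y (sum_kern source_kern e x y)%:E)%E.
Proof.
move=> e0; have en0 : e != 0 by rewrite gt_eqF.
have h m := smooth_test x m e0.
have sD : (\int[leb3m]_y (\sum_m Dm e x m y)%:E = 0)%E.
  under eq_integral do rewrite -sumEFin.
  rewrite integral_sum//; last by move=> m; have [] := h m.
  rewrite big1// => m _; have [h1 h2] := h m.
  have hf := integrable_fin_num measurableT h2.
  by rewrite -(fineK hf) -[fine _]/(\int[leb3m]_y Dm e x m y)%R h1.
have irho : leb3m.-integrable setT (EFin \o (fun y : T3 => source_val y * rho e x y)).
  have mr := measurable_rhor e x.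
  apply: (@integrable_dom _ (source_cst * (e ^+ 2 * e^-1 ^+ 5))).
    by apply: measurable_funM => //; exact: measurable_source_val.
  apply: filterS source_val_le => y h1.
  rewrite normrM mulrAC ler_pM// ger0_norm ?rho_ge0// /rho ler_wpM2l ?sqr_ge0//.
  by apply: lerXn2r; rewrite ?nnegrE ?inv_dist_ge0 ?invr_ge0 ?(ltW e0)//; exact: inv_dist_le_inv.
have iD : leb3m.-integrable setT (fun y : T3 => (\sum_m Dm e x m y)%:E).
  under eq_fun do rewrite -sumEFin.
  by apply: integrable_sum => // m _; have [] := h m.
(* Integrability of the kernel sum follows from that of the two other terms of [sum_Dm]. *)
have isk : leb3m.-integrable setT (fun y : T3 => (sum_kern source_kern e x y)%:E).
  have := integrableB measurableT irho iD; apply: eq_integrable => // y _ /=.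
  by rewrite -EFinB sum_Dm// opprB addrC subrK.
move: sD; under eq_integral do rewrite sum_Dm// EFinB.
rewrite integralB//.
have f1 := integrable_fin_num measurableT irho.
have f2 := integrable_fin_num measurableT isk.
rewrite -[X in (X - _)%E](fineK f1) -(fineK f2) -EFinB => -[] /eqP.
rewrite subr_eq0 => /eqP E.
by rewrite -[LHS](fineK f1) [in LHS]E.
Qed.

Lemma local_representation : {ae leb3m, forall x : T3, G x ->
  ((rho_mass R * source_val x)%:E = \int[leb3m]_y (sum_kern source_kern 0 x y)%:E)%E}.
Proof.
have := representation L0 integrable_source_val measurable_source_kern
  integrable_source_norm source_kern_eq0 source_identity.
apply: filterS => x h Gx; apply: h.
have := GL Gx; rewrite /sup3 !gt_max /oc3 /box3/= !in_itv/= -!andbA => /and3P[h1 h2 h3].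
have aux (t : R) : `|t| < L -> (- L < t <= L) by rewrite ltr_norml => /andP[-> /ltW].
by split; [split|]; exact: aux.
Qed.

End LocalRepresentation.

(** * Gain of integrability and Hoelder continuity for the coupled real components *)

Section Bootstrap.
Variable R : realType.
Local Notation leb3m := (@leb3m R).
Local Notation M := (measurableTypeR R).
Local Notation T3 := (M * M * M)%type.
Implicit Types x y z : R3 R.
Variables (I : finType) (G : set (R3 R)) (L Cn : R).
Variables (V : I -> T3 -> R) (A : I -> 'I_3 -> 'I_3 -> T3 -> R) (B : I -> 'I_3 -> T3 -> R).

(** The equation couples the components: the coefficients A and B of one are controlled only by all
    of them together. *)
Definition total_norm y : R := \sum_i `|V i y|.

Hypotheses (GL : forall y, G y -> sup3 y < L) (Cn0 : 0 <= Cn).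
Hypotheses (mV : forall i, measurable_fun setT (V i))
  (mA : forall i k m, measurable_fun setT (A i k m))
  (mB : forall i m, measurable_fun setT (B i m)).
Hypothesis in1 : leb3m.-integrable setT (EFin \o total_norm).
Hypothesis dom : forall i, {ae leb3m, forall y : T3, `|V i y| <= Cn * total_norm y /\
  (forall k m, `|A i k m y| <= Cn * total_norm y) /\ forall m, `|B i m y| <= Cn * total_norm y}.
Hypothesis clifford : forall i k m y, A i k m y + A i m k y = - (2 * (k == m)%:R) * V i y.
Hypothesis weak : forall i m (zeta : R3 R -> R), smooth zeta ->
  (exists K, [/\ compact K, K `<=` G & forall x, ~ K x -> zeta x = 0]) ->
  (\int[leb3m]_y (\sum_k A i k m y * partial k zeta y) =
   \int[leb3m]_y (B i m y * zeta y))%R.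

Lemma total_norm_ge0 y : 0 <= total_norm y.
Proof. exact: sumr_ge0. Qed.

Lemma measurable_total_norm : measurable_fun setT (total_norm : T3 -> R).
Proof.
by apply: measurable_sum => i; exact: (measurable_norm (mV i)).
Qed.

Lemma measurable_cball c r : @measurable _ T3 (cball c r).
Proof.
rewrite -[cball c r]setCK; apply: measurableC; apply: open_measurable3.
by apply: closed_openC; exact: cball_closed.
Qed.

Let N c r y : R := source_cst Cn r * (total_norm y * \1_(cball c r) y).

Let N0 c r y : 0 < r -> 0 <= N c r y.
Proof.
by move=> r0; rewrite /N mulr_ge0 ?source_cst_ge0// mulr_ge0 ?total_norm_ge0//.
Qed.

Let mN c r : measurable_fun setT (N c r : T3 -> R).
Proof.
apply: measurable_funM => //; apply: measurable_funM; first exact: measurable_total_norm.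
by apply: measurable_indic; exact: measurable_cball.
Qed.

Let integral_N c r q : 0 < r -> 0 < q ->
  (\int[leb3m]_(y in cball c r) (total_norm y `^ q)%:E < +oo)%E ->
  (\int[leb3m]_y (N c r y `^ q)%:E < +oo)%E.
Proof.
move=> r0 q0 h.
have mB1 := measurable_cball c r.
have -> : (\int[leb3m]_y (N c r y `^ q)%:E =
   \int[leb3m]_(y in cball c r) ((source_cst Cn r `^ q)%:E * (total_norm y `^ q)%:E))%E.
  rewrite [RHS]integral_mkcond; apply: eq_integral => y _.
  rewrite /N /patch indicE; case: (y \in cball c r).
    by rewrite mulr1 powRM ?source_cst_ge0 ?total_norm_ge0// EFinM.
  by rewrite !mulr0 powR0// gt_eqF.
have mq : measurable_fun (cball c r : set T3) (fun y => (total_norm y `^ q)%:E).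
  by apply: measurable_funTS; exact: measurable_EFin_powR measurable_total_norm.
rewrite (ge0_integralZl leb3m mB1 mq).
- by rewrite lte_mul_pinfty// ?lee_fin ?powR_ge0.
- by move=> y _; rewrite lee_fin powR_ge0.
- by rewrite lee_fin powR_ge0.
Qed.

Section InBall.
Variables (c : R3 R) (r r' : R).
Hypotheses (r'0 : 0 < r') (r'r : r' < r) (cG : cball c r `<=` G).

Let r0 : 0 < r. Proof. exact: lt_trans r'r. Qed.

Let L0 : 0 < L.
Proof.
have : G c by apply: cG; rewrite /cball/= subrr enorm0 ltW.
by move=> /GL; apply: le_lt_trans; rewrite /sup3 le_max normr_ge0 orbT.
Qed.

Let F i := source_kern (A i) (B i) c r.

Let F0 i m y : L < sup3 y -> F i m y = 0.
Proof. exact: (source_kern_eq0 _ _ GL r0 cG). Qed.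

Let mF i m : measurable_fun setT (F i m).
Proof. exact: measurable_source_kern. Qed.

Let FN i : {ae leb3m, forall y : T3, sum_norm (F i) y <= N c r y}.
Proof. exact: (source_norm_le Cn0 total_norm_ge0 (dom i) c r0). Qed.

Let rep i : {ae leb3m, forall x : T3, G x ->
  ((rho_mass R * source_val (V i) c r x)%:E = \int[leb3m]_y (sum_kern (F i) 0 x y)%:E)%E}.
Proof.
exact: (local_representation GL Cn0 (mV i) (mA i) (mB i) measurable_total_norm
  total_norm_ge0 in1 (dom i) (clifford i) (weak i) r0 cG).
Qed.

(** A positive lower bound, on the smaller ball, of the cutoff of the larger one. *)
Let delta := flat 0 (r ^+ 2 - r' ^+ 2).

Let delta0 : 0 < delta.
Proof. by apply: flat_gt0; rewrite subr_gt0 ltr_sqr ?nnegrE ?(ltW r0) ?(ltW r'0). Qed.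

(** On the smaller ball the cutoff is at least [delta], so the representation bounds a constant
    times each component by the potential of [N]. The bounds are summed over the components before
    [young_potential] is applied. *)
Lemma bootstrap_lebesgue (p q : R) : 1 < p -> p <= q -> p^-1 - 3^-1 < q^-1 ->
  (\int[leb3m]_(y in cball c r) (total_norm y `^ p)%:E < +oo)%E ->
  (\int[leb3m]_(y in cball c r') (total_norm y `^ q)%:E < +oo)%E.
Proof.
move=> p1 pq pq3 np.
have p0 : 0 < p by rewrite (lt_trans _ p1).
have q0 : 0 < q by exact: lt_le_trans pq.
(* A lower bound, on the smaller ball, for the coefficient of V in the representation. *)
pose c0 := rho_mass R * 3 * delta.
have c00 : 0 < c0.
  by apply: mulr_gt0; [apply: mulr_gt0 => //; exact: rho_mass_gt0|exact: delta0].
pose NN (y : T3) := #|I|%:R * N c r y.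
pose W (x : T3) := c0 * total_norm x.
have mNN : measurable_fun setT NN by apply: measurable_funM => //; exact: mN.
have NN0 y : 0 <= NN y by rewrite mulr_ge0// N0.
have mW : measurable_fun setT W by apply: measurable_funM => //; exact: measurable_total_norm.
have NNp : (\int[leb3m]_y (NN y `^ p)%:E < +oo)%E.
  have h := integral_N r0 p0 np.
  under eq_integral do rewrite powRM ?N0// EFinM.
  have mNp : measurable_fun setT (fun y : T3 => (N c r y `^ p)%:E).
    exact: measurable_EFin_powR (@mN c r).
  rewrite (ge0_integralZl leb3m measurableT mNp).
  - by rewrite lte_mul_pinfty// ?lee_fin ?powR_ge0.
  - by move=> y _; rewrite lee_fin powR_ge0.
  - by rewrite lee_fin powR_ge0.
have Vle i : {ae leb3m, forall x : T3, cball c r' x ->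
   ((c0 * `|V i x|)%:E <= \int[leb3m]_y (N c r y * trunc_pow 2 (2 * L) ((y : R3 R) - x)%R)%:E)%E}.
  apply: filterS (rep i) => x hrep xr'.
  have Gx : G x by apply: cG; rewrite /cball/= (le_trans xr')// ltW.
  have xL : sup3 x <= L by rewrite ltW// GL.
  have {}hrep := hrep Gx.
  have mFx : measurable_fun [set: T3] (fun y : T3 => (sum_kern (F i) 0 x y)%:E).
    apply/measurable_EFinP.
    exact: (measurableT_comp (measurable_sum_kern 0 (mF i)) (pair1_measurable x)).
  apply: (@le_trans _ _ `|(rho_mass R * source_val (V i) c r x)%:E|%E).
    rewrite lee_fin /source_val !normrM (ger0_norm (ltW (rho_mass_gt0 R))) (ger0_norm (ler0n R 3)).
    rewrite /c0 -!mulrA ler_wpM2l ?(ltW (rho_mass_gt0 R))// ler_wpM2l//.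
    rewrite ler_wpM2r// ger0_norm ?cutoff_ge0//.
    by apply: cutoff_lower => //; exact: ltW.
  rewrite hrep; apply: (le_trans (le_abse_integral leb3m measurableT mFx)).
  apply: ae_ge0_le_integral => //.
  - exact: measurableT_comp.
  - by move=> y _; rewrite lee_fin mulr_ge0 ?N0 ?trunc_pow_ge0.
  - apply/measurable_EFinP; apply: measurable_funM; first exact: mN.
    exact: measurable_trunc_pow_subr.
  apply: filterS (FN i) => y hy _.
  rewrite lee_fin.
  have [yL|yL] := leP (sup3 y) L; last first.
    have -> : sum_kern (F i) 0 x y = 0 by rewrite /sum_kern big1// => m _; rewrite F0 ?mul0r.
    by rewrite normr0 mulr_ge0 ?N0 ?trunc_pow_ge0.
  apply: (@le_trans _ _ (sum_norm (F i) y * trunc_pow 2 (2 * L) ((y : R3 R) - x))).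
    apply: (le_trans (ler_norm_sum _ _ _)).
    rewrite mulr_suml; apply: ler_sum => m _; rewrite normrM ler_wpM2l//.
    by rewrite /trunc_pow (sup3B xL yL); exact: kern_le.
  by rewrite ler_wpM2r ?trunc_pow_ge0.
have Wle : {ae leb3m, forall x : T3, cball c r' x ->
   ((W x)%:E <= \int[leb3m]_y (NN y * trunc_pow 2 (2 * L) ((y : R3 R) - x)%R)%:E)%E}.
  apply: filterS (ae_forall_fin Vle) => x hx xr'.
  have E : (\int[leb3m]_y (NN y * trunc_pow 2 (2 * L) ((y : R3 R) - x)%R)%:E =
     \sum_(i : I) \int[leb3m]_y (N c r y * trunc_pow 2 (2 * L) ((y : R3 R) - x)%R)%:E)%E.
    have cI : ((#|I|%:R : R)%:E = \sum_(i : I) 1%:E)%E by rewrite sumEFin sumr_const.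
    rewrite -[in RHS](@eq_bigr _ _ _ _ _ _ (fun i : I => 1%:E * _)%E _ (fun i _ => mul1e _)).
    rewrite -ge0_sume_distrl// -cI.
    under eq_integral do rewrite /NN -mulrA EFinM.
    rewrite ge0_integralZl//.
    - apply/measurable_EFinP; apply: measurable_funM; first exact: mN.
      exact: measurable_trunc_pow_subr.
    - by move=> y _; rewrite lee_fin mulr_ge0 ?N0 ?trunc_pow_ge0.
  rewrite E /W /total_norm mulr_sumr -sumEFin.
  by apply: lee_sum => i _; exact: hx.
have L20 : 0 < 2 * L by apply: mulr_gt0 => //; exact: L0.
have := young_potential L20 mNN NN0 NNp p1 pq pq3 (measurable_cball c r') mW
  (fun x => mulr_ge0 (ltW c00) (total_norm_ge0 x)) Wle.
under eq_integral do rewrite powRM ?total_norm_ge0 ?(ltW c00)// EFinM.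
have mq : measurable_fun (cball c r' : set T3) (fun y => (total_norm y `^ q)%:E).
  by apply: measurable_funTS; exact: measurable_EFin_powR measurable_total_norm.
rewrite (ge0_integralZl leb3m (measurable_cball c r') mq).
- have : (0 <= \int[leb3m]_(y in cball c r') (total_norm y `^ q)%:E)%E.
    by apply: integral_ge0 => y _; rewrite lee_fin powR_ge0.
  case: (\int[leb3m]_(y in _) _)%E => [s _ _| |]//; first exact: ltry.
  by rewrite gt0_muley ?lte_fin ?powR_gt0.
- by move=> y _; rewrite lee_fin powR_ge0.
- by rewrite lee_fin powR_ge0.
Qed.

(** Almost everywhere V is the potential divided by 3 [rho_mass] times the cutoff. On the smaller
    ball the potential is Hoelder continuous and bounded, and so is the reciprocal of the cutoff. *)
Lemma bootstrap_hoelder (q t : R) : 0 <= t <= 1 -> 1 < q -> (2 + t) * (1 - q^-1)^-1 < 3 ->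
  (\int[leb3m]_(y in cball c r) (total_norm y `^ q)%:E < +oo)%E ->
  forall i, exists h : R3 R -> R,
    (exists C, forall x x', cball c r' x -> cball c r' x' ->
       `|h x - h x'| <= C * enorm (x - x') `^ t) /\
    {ae leb3m, forall x : T3, cball c r' x -> h x = V i x}.
Proof.
move=> t01 q1 tq nq i; have /andP[t0 t1] := t01.
have q0 : 0 < q by rewrite (lt_trans _ q1).
have q'0 : 0 < (1 - q^-1)^-1 by rewrite invr_gt0 subr_gt0 invf_lt1.
have qq' : q^-1 + ((1 - q^-1)^-1)^-1 = 1 by rewrite invrK addrC subrK.
have Fq : (\int[leb3m]_y (sum_norm (F i) y `^ q)%:E < +oo)%E.
  apply: le_lt_trans (integral_N r0 q0 nq).
  have mpow (f : T3 -> R) : measurable_fun setT f -> measurable_fun setT (fun y => (f y `^ q)%:E).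
    by move=> mf; exact: measurable_EFin_powR mf.
  apply: ae_ge0_le_integral => //.
  - by move=> y _; rewrite lee_fin powR_ge0.
  - by apply: mpow; apply: measurable_sum_norm; exact: mF.
  - by move=> y _; rewrite lee_fin powR_ge0.
  - by apply: mpow; exact: mN.
  apply: filterS (FN i) => y hy _; rewrite lee_fin.
  by apply: (ge0_ler_powR (ltW q0)); rewrite ?nnegrE ?sum_norm_ge0 ?N0.
have [C0 hC0] := potential_holder L0 (mF i) (@F0 i) Fq q0 q'0 qq' t01 tq.
have cL x : cball c r x -> sup3 x <= L by move=> /cG/GL/ltW.
have rr x : cball c r' x -> cball c r x by move=> h; rewrite /cball/= (le_trans h)// ltW.
have c_r' : cball c r' c by rewrite /cball/= subrr enorm0 ltW.
pose C := `|C0|; have C_ge0 : 0 <= C by exact: normr_ge0.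
have hC x x' : cball c r' x -> cball c r' x' ->
    `|potential (F i) x - potential (F i) x'| <= C * enorm (x - x') `^ t.
  move=> xr xr'; apply: (le_trans (hC0 _ _ (cL _ (rr _ xr)) (cL _ (rr _ xr')))).
  by rewrite ler_wpM2r ?powR_ge0// ler_norm.
pose k0 := rho_mass R * 3; have k00 : 0 < k0 by rewrite mulr_gt0// rho_mass_gt0.
pose M0 := `|potential (F i) c| + C * r' `^ t.
have M0_ge0 : 0 <= M0 by rewrite addr_ge0// mulr_ge0// powR_ge0.
have Pb x : cball c r' x -> `|potential (F i) x| <= M0.
  move=> xr; rewrite -[potential _ x](subrK (potential (F i) c)) addrC.
  apply: (le_trans (ler_normD _ _)); rewrite lerD2l.
  apply: (le_trans (hC _ _ xr c_r')); rewrite ler_wpM2l//.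
  by apply: (ge0_ler_powR t0); rewrite ?nnegrE ?enorm_ge0// ltW.
pose g x := (k0 * cutoff c r x)^-1.
have cpos x : cball c r' x -> delta <= cutoff c r x.
  by move=> xr; apply: cutoff_lower => //; exact: ltW.
have gb x : cball c r' x -> `|g x| <= (k0 * delta)^-1.
  move=> xr; have cp := lt_le_trans delta0 (cpos _ xr).
  rewrite ger0_norm; last by rewrite invr_ge0 mulr_ge0// ltW.
  have a1 := mulr_gt0 k00 cp; have a2 := mulr_gt0 k00 delta0.
  rewrite lef_pV2 ?posrE//; apply: ler_wpM2l; [exact: ltW k00|exact: cpos].
(* On a ball of diameter 2 r' a Lipschitz function is Hoelder continuous of exponent t. *)
have d_le x x' : cball c r' x -> cball c r' x' -> enorm (x - x') <= (2 * r') `^ (1 - t) * enorm (x - x') `^ t.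
  move=> xr xr'; have d2 : enorm (x - x') <= 2 * r'.
    have -> : x - x' = (x - c) + (c - x') by rewrite addrA subrK.
    apply: (le_trans (enorm_tri _ _)); rewrite mulr_natl mulr2n lerD//.
    by rewrite -enormN opprB.
  have := enorm_ge0 (x - x'); rewrite le_eqVlt => /predU1P[<-|dp].
    by rewrite mulr_ge0 ?powR_ge0.
  have -> : enorm (x - x') = enorm (x - x') `^ (1 - t) * enorm (x - x') `^ t.
    by rewrite -powRD ?(gt_eqF dp) ?implybT// subrK powRr1// ltW.
  have -> : (enorm (x - x') `^ (1 - t) * enorm (x - x') `^ t) `^ t = enorm (x - x') `^ t.
    by rewrite -powRD ?(gt_eqF dp) ?implybT// subrK powRr1// ltW.
  rewrite ler_wpM2r ?powR_ge0//; apply: ge0_ler_powR; rewrite ?nnegrE ?subr_ge0 ?(ltW dp)//.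
  by rewrite mulr_ge0// ltW.
(* 1/a - 1/b = (b - a)/(a b): the numerator comes from [cutoff_lipschitz] and [d_le], the
   denominator from the lower bound [delta]. *)
pose Cg := (12 * r ^+ 3 * (2 * r') `^ (1 - t)) / (k0 * delta ^+ 2).
have Cg0 : 0 <= Cg.
  apply: divr_ge0; last exact: mulr_ge0 (ltW k00) (sqr_ge0 delta).
  by apply: mulr_ge0 (powR_ge0 _ _); apply: mulr_ge0 => //; exact: exprn_ge0 (ltW r0).
have gh x x' : cball c r' x -> cball c r' x' -> `|g x - g x'| <= Cg * enorm (x - x') `^ t.
  move=> xr xr'; have cp := cpos _ xr; have cp' := cpos _ xr'.
  have p1 := lt_le_trans delta0 cp; have p2 := lt_le_trans delta0 cp'.
  have -> : g x - g x' = (cutoff c r x' - cutoff c r x) / (k0 * (cutoff c r x * cutoff c r x')).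
    by rewrite /g; field; rewrite !gt_eqF.
  have den : 0 < k0 * (cutoff c r x * cutoff c r x') by apply: mulr_gt0 => //; exact: mulr_gt0.
  rewrite (normrM (cutoff c r x' - cutoff c r x)) normfV (gtr0_norm den) distrC.
  rewrite /Cg [leRHS]mulrAC ler_pM ?invr_ge0 ?(ltW den)//.
    apply: (le_trans (cutoff_lipschitz (ltW r0) (rr _ xr) (rr _ xr'))).
    have r3 : 0 <= 12 * r ^+ 3 by apply: mulr_ge0 => //; exact: exprn_ge0 (ltW r0).
    by have := ler_wpM2l r3 (d_le _ _ xr xr'); rewrite (mulrA (12 * r ^+ 3)).
  have dd : 0 < k0 * delta ^+ 2 by apply: mulr_gt0 k00 _; exact: exprn_gt0 delta0.
  rewrite lef_pV2 ?posrE//; apply: ler_wpM2l (ltW k00) _ _ _.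
  by rewrite expr2; exact: ler_pM (ltW delta0) (ltW delta0) cp cp'.
exists (fun x => potential (F i) x * g x); split.
  exists (C * (k0 * delta)^-1 + M0 * Cg) => x x' xr xr'.
  have -> : potential (F i) x * g x - potential (F i) x' * g x' =
     (potential (F i) x - potential (F i) x') * g x + potential (F i) x' * (g x - g x') by ring.
  apply: (le_trans (ler_normD _ _)); rewrite [leRHS]mulrDl; apply: lerD.
    rewrite (normrM (_ - _)) [leRHS]mulrAC; apply: ler_pM => //; [exact: hC|exact: gb].
  rewrite (normrM (potential _ _)) -(mulrA M0); apply: ler_pM => //; [exact: Pb|exact: gh].
apply: filterS (rep i) => x hrep xr.
have Gx : G x by apply: cG; exact: rr.
have cp := lt_le_trans delta0 (cpos _ xr).
rewrite /potential /Rintegral -hrep//= /source_val /g /k0.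
by field; rewrite (gt_eqF cp) gt_eqF// rho_mass_gt0.
Qed.

End InBall.

End Bootstrap.

(** * Biquaternions *)

Section BiquaternionAlgebra.
Variable R : realType.
Local Notation C := R[i].
Local Notation H := (biquaternion R).
Implicit Types (p q : H) (z : C).

(** Preferred to the modulus because its sum over the coordinates is the sum of the absolute values
    of the eight real components, the norm of the bootstrap. *)
Definition cabs1 z : R := `|complex.Re z| + `|complex.Im z|.

Lemma cabs1_ge0 z : 0 <= cabs1 z.
Proof. exact: addr_ge0. Qed.

Lemma cabs1D z z' : cabs1 (z + z') <= cabs1 z + cabs1 z'.
Proof.
case: z z' => a b [a' b']; rewrite /cabs1/=.
by rewrite addrACA; apply: lerD; exact: ler_normD.
Qed.

Lemma cabs1N z : cabs1 (- z) = cabs1 z.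
Proof. by case: z => a b; rewrite /cabs1/= !normrN. Qed.

Lemma cabs1_0 : cabs1 0 = 0.
Proof. by rewrite /cabs1/= normr0 addr0. Qed.

Lemma cabs1_1 : cabs1 1 = 1.
Proof. by rewrite /cabs1/= normr1 normr0 addr0. Qed.

Lemma cabs1M z z' : cabs1 (z * z') <= cabs1 z * cabs1 z'.
Proof.
case: z z' => a b [a' b']; rewrite /cabs1/=.
apply: (le_trans (lerD (ler_normB _ _) (ler_normD _ _))); rewrite !normrM.
by apply: le_of_eq; ring.
Qed.

Lemma cabs1_sum (I : Type) (s : seq I) (f : I -> C) :
  cabs1 (\sum_(i <- s) f i) <= \sum_(i <- s) cabs1 (f i).
Proof.
elim: s => [|i s ih]; first by rewrite !big_nil cabs1_0.
by rewrite !big_cons; apply: (le_trans (cabs1D _ _)); rewrite lerD2l.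
Qed.

Lemma cabs1_le_normc z : cabs1 z <= 2 * Normc.normc z.
Proof.
case: z => a b; rewrite /cabs1/= mulr_natl mulr2n.
have h (x y : R) : `|x| <= Num.sqrt (x ^+ 2 + y ^+ 2).
  by rewrite -sqrtr_sqr ler_sqrt ?addr_ge0 ?sqr_ge0// lerDl sqr_ge0.
by apply: lerD; [exact: h|rewrite addrC; exact: h].
Qed.

Lemma normc_le_cabs1 z : Normc.normc z <= cabs1 z.
Proof.
case: z => a b; rewrite /cabs1/= -[leRHS]ger0_norm ?addr_ge0// -sqrtr_sqr.
rewrite ler_sqrt ?sqr_ge0// sqrrD !real_normK ?num_real// lerD2r lerDl.
by rewrite mulrn_wge0// mulr_ge0.
Qed.

Definition bqabs1 p : R := \sum_j cabs1 (p 0 j).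

Lemma bqabs1_ge0 p : 0 <= bqabs1 p.
Proof. by apply: sumr_ge0 => j _; exact: cabs1_ge0. Qed.

Lemma cabs1_le_bqabs1 p j : cabs1 (p 0 j) <= bqabs1 p.
Proof.
rewrite /bqabs1 (bigD1 j)//= lerDl; apply: sumr_ge0 => i _; exact: cabs1_ge0.
Qed.

Lemma bqabs1D p q : bqabs1 (p + q) <= bqabs1 p + bqabs1 q.
Proof.
rewrite /bqabs1 -big_split/=; apply: ler_sum => j _; rewrite mxE; exact: cabs1D.
Qed.

Lemma bqnorm_le_bqabs1 p : bqnorm p <= bqabs1 p.
Proof.
rewrite /bqnorm -[leRHS]ger0_norm ?bqabs1_ge0// -sqrtr_sqr ler_sqrt ?sqr_ge0//.
rewrite expr2 {2}/bqabs1 mulr_sumr; apply: ler_sum => j _; rewrite expr2.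
have n0 : 0 <= Normc.normc (p 0 j) by case: (p 0 j) => a b /=; exact: sqrtr_ge0.
apply: ler_pM => //; last exact: normc_le_cabs1.
exact: le_trans (normc_le_cabs1 _) (cabs1_le_bqabs1 _ _).
Qed.

Lemma bqnorm_gt0 p : p != 0 -> 0 < bqnorm p.
Proof.
rewrite /bqnorm sqrtr_gt0; apply: contra_neqT; rewrite -leNgt => h.
apply/rowP => j; rewrite mxE; apply: Normc.eq0_normc; apply/eqP.
have := h; rewrite (bigD1 j)//= => {}h.
rewrite -sqrf_eq0 eq_le sqr_ge0 andbT; apply: le_trans h; rewrite lerDl.
by apply: sumr_ge0 => k _; exact: sqr_ge0.
Qed.

Lemma bqmk_scal (s : C) v : bqmk s v 0 (lshift 3 0) = s.
Proof. by rewrite /bqmk row_mxEl mxE eqxx. Qed.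

Lemma bqmk_vect (s : C) v k : bqmk s v 0 (rshift 1 k) = v 0 k.
Proof. by rewrite /bqmk row_mxEr. Qed.

Lemma bqDE p q j : (p + q) 0 j = p 0 j + q 0 j.
Proof. by rewrite mxE. Qed.

Lemma bqBE p q j : (p - q) 0 j = p 0 j - q 0 j.
Proof. by rewrite !mxE. Qed.

Lemma bqZE (a : C) p j : (a *: p) 0 j = a * p 0 j.
Proof. by rewrite mxE. Qed.

Lemma bqscalE p : bqscal p = p 0 (lshift 3 0).
Proof. by rewrite /bqscal mxE. Qed.

Lemma bqvectE p k : bqvect p 0 k = p 0 (rshift 1 k).
Proof. by rewrite /bqvect mxE. Qed.

Lemma bq_ind (P : 'I_(1 + 3) -> Prop) :
  P (lshift 3 0) -> (forall k, P (rshift 1 k)) -> forall j, P j.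
Proof.
by move=> P0 Pk j; rewrite -(fintype.splitK j); case: (fintype.split j) => k/=; rewrite ?ord1.
Qed.

Lemma bqP p q : p 0 (lshift 3 0) = q 0 (lshift 3 0) ->
  (forall k, p 0 (rshift 1 k) = q 0 (rshift 1 k)) -> p = q.
Proof. by move=> h0 hk; apply/rowP; exact: bq_ind. Qed.

Lemma bqmul_scal p q : bqmul p q 0 (lshift 3 0) =
  p 0 (lshift 3 0) * q 0 (lshift 3 0) - \sum_k p 0 (rshift 1 k) * q 0 (rshift 1 k).
Proof.
by rewrite /bqmul bqmk_scal !bqscalE /dotC; congr (_ - _); apply: eq_bigr => k _; rewrite !bqvectE.
Qed.

Lemma bqmul_vect p q k : bqmul p q 0 (rshift 1 k) =
  p 0 (lshift 3 0) * q 0 (rshift 1 k) + q 0 (lshift 3 0) * p 0 (rshift 1 k)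
  + (p 0 (rshift 1 (k + 1)) * q 0 (rshift 1 (k + 1 + 1))
     - p 0 (rshift 1 (k + 1 + 1)) * q 0 (rshift 1 (k + 1))).
Proof. by rewrite /bqmul bqmk_vect !mxE !bqscalE. Qed.

Lemma bqconj_scal p : bqconj p 0 (lshift 3 0) = p 0 (lshift 3 0).
Proof. by rewrite /bqconj bqmk_scal bqscalE. Qed.

Lemma bqconj_vect p k : bqconj p 0 (rshift 1 k) = - p 0 (rshift 1 k).
Proof. by rewrite /bqconj bqmk_vect !mxE. Qed.

Lemma bqconjK : involutive (@bqconj R).
Proof.
by move=> p; apply: bqP => [|k]; rewrite ?bqconj_scal// !bqconj_vect opprK.
Qed.

Lemma bqconjB p q : bqconj (p - q) = bqconj p - bqconj q.
Proof.
apply: bqP => [|k]; rewrite bqBE ?bqconj_scal ?bqconj_vect bqBE//.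
by rewrite opprD.
Qed.

Lemma bqconj0 : bqconj 0 = 0 :> H.
Proof. by rewrite -{1}(subrr 0) bqconjB subrr. Qed.

Lemma bqabs1_conj p : bqabs1 (bqconj p) = bqabs1 p.
Proof.
apply: eq_bigr => j _; elim/bq_ind: j => [|k]; first by rewrite bqconj_scal.
by rewrite bqconj_vect cabs1N.
Qed.

Lemma bqmulDr p : {morph bqmul p : q q' / q + q'}.
Proof.
move=> q q'; apply: bqP => [|k]; rewrite bqDE ?bqmul_scal ?bqmul_vect !bqDE; last by ring.
rewrite mulrDr -addrA -[RHS]addrA; congr (_ + _).
rewrite addrCA; congr (_ + _); rewrite -opprD -big_split/=; congr (- _).
by apply: eq_bigr => k _; rewrite bqDE mulrDr.
Qed.

Lemma bqmulZr p (a : C) q : bqmul p (a *: q) = a *: bqmul p q.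
Proof.
apply: bqP => [|k]; rewrite bqZE ?bqmul_scal ?bqmul_vect !bqZE; last by ring.
rewrite mulrBr mulr_sumr mulrCA; congr (_ - _).
by apply: eq_bigr => k _; rewrite bqZE mulrCA.
Qed.

Lemma bqmul0l q : bqmul 0 q = 0.
Proof.
apply: bqP => [|k]; rewrite ?bqmul_scal ?bqmul_vect !mxE.
  by rewrite mul0r big1 ?subr0// => k _; rewrite mxE mul0r.
by ring.
Qed.

Lemma bqmul_sumr p (I : Type) (s : seq I) (f : I -> H) :
  bqmul p (\sum_(i <- s) f i) = \sum_(i <- s) bqmul p (f i).
Proof.
elim: s => [|i s ih]; last by rewrite !big_cons bqmulDr ih.
by rewrite !big_nil -[0 in LHS](scale0r 0) bqmulZr scale0r.
Qed.

(** The Clifford relations, multiplied by p on the left. The product of units is kept in brackets,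
    so linearity in the right factor is all that is used. *)
Lemma bqe_mulD k m p :
  bqmul p (bqmul (bqe R k) (bqe R m)) + bqmul p (bqmul (bqe R m) (bqe R k)) =
  (- (2 * (k == m)%:R)) *: p.
Proof.
rewrite -bqmulDr.
have -> : bqmul (bqe R k) (bqe R m) + bqmul (bqe R m) (bqe R k) =
    (- (2 * (k == m)%:R)) *: bqmk 1 0.
  apply: bqP => [|l]; rewrite bqDE bqZE ?bqmul_scal ?bqmul_vect /bqe ?bqmk_scal ?bqmk_vect.
    have D (i l : 'I_3) : \sum_k (bqmk 0 (delta_mx 0 i) : H) 0 (rshift 1 k) *
       (bqmk 0 (delta_mx 0 l) : H) 0 (rshift 1 k) = (i == l)%:R.
      rewrite (bigD1 i)//= big1 ?addr0 => [|s si]; rewrite !bqmk_vect !mxE !eqxx/=.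
        by rewrite mul1r.
      by rewrite (negbTE si) mul0r.
    rewrite !D eq_sym; ring.
  rewrite !mxE; ring.
rewrite bqmulZr; congr (_ *: _); apply: bqP => [|l].
  rewrite bqmul_scal bqmk_scal big1 ?subr0 ?mulr1// => s _.
  by rewrite bqmk_vect mxE mulr0.
by rewrite bqmul_vect bqmk_scal !bqmk_vect !mxE; ring.
Qed.

(** Each of the four coordinates is a signed sum of four products of coordinates, each at most
    [PQ]. *)
Lemma bqabs1M p q : bqabs1 (bqmul p q) <= 16 * (bqabs1 p * bqabs1 q).
Proof.
set PQ := _ * bqabs1 q.
have t i j : cabs1 (p 0 i * q 0 j) <= PQ.
  apply: (le_trans (cabs1M _ _)); apply: ler_pM; rewrite ?cabs1_ge0 ?cabs1_le_bqabs1//.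
have h j : cabs1 (bqmul p q 0 j) <= 4 * PQ.
  have -> : 4 * PQ = PQ + PQ + (PQ + PQ) by ring.
  elim/bq_ind: j => [|k].
    rewrite bqmul_scal; apply: (le_trans (cabs1D _ _)); rewrite cabs1N -(addrA PQ); apply: (lerD (t _ _)).
    apply: (le_trans (cabs1_sum _ _)); rewrite !big_ord_recl big_ord0 addr0 /=.
    by rewrite lerD// lerD.
  rewrite bqmul_vect; apply: (le_trans (cabs1D _ _)); apply: lerD.
    by apply: (le_trans (cabs1D _ _)); apply: lerD => //; rewrite mulrC.
  by apply: (le_trans (cabs1D _ _)); rewrite cabs1N lerD.
apply: (@le_trans _ _ (\sum_(j < 1 + 3) 4 * PQ)); first by apply: ler_sum => j _; exact: h.
by rewrite sumr_const card_ord -mulr_natl; apply: le_of_eq; ring.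
Qed.

Lemma bqabs1_bqe k : bqabs1 (bqe R k) = 1.
Proof.
rewrite /bqabs1 big_split_ord/= big_ord1 bqmk_scal cabs1_0 add0r.
rewrite (bigD1 k)//= big1 ?addr0 => [|s sk]; rewrite bqmk_vect mxE ?(negbTE sk) ?eqxx ?eqxx.
  exact: cabs1_1.
exact: cabs1_0.
Qed.

Definition cpart (b : bool) z : R := if b then complex.Re z else complex.Im z.

Lemma cpartD b z z' : cpart b (z + z') = cpart b z + cpart b z'.
Proof. by case: b z z' => -[a c] [a' c']. Qed.

Lemma cpartZ b (x : R) z : cpart b (x%:C%C * z) = x * cpart b z.
Proof. by case: b z => -[a c]; rewrite /= mul0r ?subr0 ?addr0. Qed.

(** Real components, indexed by a coordinate and a choice of real (true) or imaginary part. They are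
    real-linear, so the weak equation with real test factors splits into eight real ones. *)
Definition bqpart (i : 'I_(1 + 3) * bool) p : R := cpart i.2 (p 0 i.1).

Lemma bqpartD i p q : bqpart i (p + q) = bqpart i p + bqpart i q.
Proof. by rewrite /bqpart mxE cpartD. Qed.

Lemma bqpartZ i (x : R) p : bqpart i (x%:C%C *: p) = x * bqpart i p.
Proof. by rewrite /bqpart mxE cpartZ. Qed.

Lemma bqpart0 i : bqpart i 0 = 0.
Proof. by rewrite /bqpart mxE; case: i.2. Qed.

Lemma bqpart_sum i (I : Type) (s : seq I) (f : I -> H) :
  bqpart i (\sum_(k <- s) f k) = \sum_(k <- s) bqpart i (f k).
Proof.
by elim: s => [|k s ih]; rewrite ?big_nil ?bqpart0// !big_cons bqpartD ih.
Qed.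

Lemma sum_bqpart p : \sum_i `|bqpart i p| = bqabs1 p.
Proof.
rewrite -(pair_bigA _ (fun j b => `|cpart b (p 0 j)|))/=; apply: eq_bigr => j _.
by rewrite big_bool.
Qed.

Lemma bqpart_le i p : `|bqpart i p| <= bqabs1 p.
Proof. by rewrite -sum_bqpart (bigD1 i)//= lerDl sumr_ge0. Qed.

Lemma bqpart_inj p q : (forall i, bqpart i p = bqpart i q) -> p = q.
Proof.
move=> h; apply/rowP => j; have := h (j, true); have := h (j, false).
by rewrite /bqpart/=; case: (p 0 j) (q 0 j) => a b [c d] /= -> ->.
Qed.

Lemma bqpart_row i (f : 'I_(1 + 3) * bool -> R) :
  bqpart i (\row_j (f (j, true) +i* f (j, false))%C) = f i.
Proof. by rewrite /bqpart mxE; case: i => j []. Qed.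

End BiquaternionAlgebra.

(** * Weak solutions *)

Section WeakSolutions.
Variable R : realType.
Local Notation leb3m := (@leb3m R).
Local Notation M := (measurableTypeR R).
Local Notation T3 := (M * M * M)%type.
Local Notation H := (biquaternion R).
Implicit Types (G : set (R3 R)) (u v w : R3 R -> H).

(** Values outside G are arbitrary, possibly not measurable; the potential theory is done on the
    whole space. *)
Definition zext G u y : H := if y \in G then u y else 0.

Lemma zextT G u y : G y -> zext G u y = u y.
Proof. by rewrite /zext => /mem_set ->. Qed.

Lemma zextN G u y : ~ G y -> zext G u y = 0.
Proof. by rewrite /zext; case: ifP => // /set_mem. Qed.

Definition measC (f : T3 -> R[i]) :=
  measurable_fun setT (fun y => complex.Re (f y) : M) /\
  measurable_fun setT (fun y => complex.Im (f y) : M).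

Lemma measC_add f g : measC f -> measC g -> measC (fun y => f y + g y).
Proof.
move=> [f1 f2] [g1 g2]; split.
  rewrite (_ : (fun y => _) = (fun y => complex.Re (f y) + complex.Re (g y))).
    exact: measurable_funD.
  by apply/funext => y; case: (f y) (g y) => a b [].
rewrite (_ : (fun y => _) = (fun y => complex.Im (f y) + complex.Im (g y))).
  exact: measurable_funD.
by apply/funext => y; case: (f y) (g y) => a b [].
Qed.

Lemma measC_mul f g : measC f -> measC g -> measC (fun y => f y * g y).
Proof.
move=> [f1 f2] [g1 g2]; split.
  rewrite (_ : (fun y => _) = (fun y => complex.Re (f y) * complex.Re (g y)
     - complex.Im (f y) * complex.Im (g y))).
    by apply: measurable_funB; exact: measurable_funM.
  by apply/funext => y; case: (f y) (g y) => a b [].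
rewrite (_ : (fun y => _) = (fun y => complex.Re (f y) * complex.Im (g y)
     + complex.Im (f y) * complex.Re (g y))).
  by apply: measurable_funD; exact: measurable_funM.
by apply/funext => y; case: (f y) (g y) => a b [].
Qed.

Lemma measC_cst z : measC (fun=> z).
Proof. by split; exact: measurable_cst. Qed.

Lemma measC_opp f : measC f -> measC (fun y => - f y).
Proof.
move=> mf; rewrite (_ : (fun y => _) = (fun y => -1 * f y)).
  exact: measC_mul (measC_cst _) mf.
by apply/funext => y; rewrite mulN1r.
Qed.

Lemma measC_sum (I : Type) (s : seq I) (f : I -> T3 -> R[i]) :
  (forall i, measC (f i)) -> measC (fun y => \sum_(i <- s) f i y).
Proof.
move=> mf; elim: s => [|i s ih].
  by under eq_fun do rewrite big_nil; exact: measC_cst.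
by under eq_fun do rewrite big_cons; exact: measC_add.
Qed.

Definition measH (u : T3 -> H) := forall j, measC (fun y => u y 0 j).

Lemma measH_cst p : measH (fun=> p).
Proof. by move=> j; exact: measC_cst. Qed.

Lemma measH_add u v : measH u -> measH v -> measH (fun y => u y + v y).
Proof. by move=> mu mv j; under eq_fun do rewrite bqDE; exact: measC_add. Qed.

Lemma measH_conj u : measH u -> measH (fun y => bqconj (u y)).
Proof.
move=> mu; apply: bq_ind => [|k]; first by under eq_fun do rewrite bqconj_scal.
by under eq_fun do rewrite bqconj_vect; exact: measC_opp.
Qed.

Lemma measH_mul u v : measH u -> measH v -> measH (fun y => bqmul (u y) (v y)).
Proof.
move=> mu mv; apply: bq_ind => [|k].
  under eq_fun do rewrite bqmul_scal; apply: measC_add; first exact: measC_mul.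
  by apply: measC_opp; apply: measC_sum => k; exact: measC_mul.
under eq_fun do rewrite bqmul_vect; apply: measC_add.
  by apply: measC_add; exact: measC_mul.
by apply: measC_add; [|apply: measC_opp]; exact: measC_mul.
Qed.

Lemma measH_part i u : measH u -> measurable_fun setT (fun y : T3 => bqpart i (u y) : M).
Proof. by move=> mu; have [] := mu i.1; rewrite /bqpart /cpart; case: i.2. Qed.

Lemma measH_abs1 u : measH u -> measurable_fun setT (fun y : T3 => bqabs1 (u y) : M).
Proof.
move=> mu; under eq_fun do rewrite -sum_bqpart.
apply: measurable_sum => i.
exact: (measurable_norm (measH_part i mu)).
Qed.

Lemma measH_zext G q u : open G -> Lp G q u -> measH (zext G u).
Proof.
move=> oG hu j; have [h1 h2 _] := hu j; have mG := open_measurable3 oG.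
have aux (f : T3 -> M) : measurable_fun (G : set T3) f ->
    measurable_fun setT (fun y : T3 => (if y \in G then f y else 0) : M).
  by move=> mf; have /(measurable_restrictT f mG) := mf.
split; apply: eq_measurable_fun (aux _ _); [|exact: h1| |exact: h2];
  by move=> y _; rewrite /zext; case: ifP => //; rewrite mxE.
Qed.

Lemma zext_QA G a1 a2 a3 a4 w :
  zext G (QA a1 a2 a3 a4 w) = QA (zext G a1) (zext G a2) (zext G a3) (zext G a4) (zext G w).
Proof.
apply/funext => y; have [yG|yG] := pselect (G y); rewrite /QA.
  by rewrite !zextT.
by rewrite !zextN// !(bqmul0l, bqconj0) !addr0.
Qed.

Lemma measH_QA a1 a2 a3 a4 w : measH a1 -> measH a2 -> measH a3 -> measH a4 ->
  measH w -> measH (QA a1 a2 a3 a4 w).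
Proof.
move=> m1 m2 m3 m4 mw; have mc := measH_conj mw.
by do ![exact: measH_mul|apply: measH_add].
Qed.

Lemma bqabs1_QA_le a1 a2 a3 a4 w y (K : R) :
  bqabs1 (a1 y) <= K -> bqabs1 (a2 y) <= K -> bqabs1 (a3 y) <= K -> bqabs1 (a4 y) <= K ->
  bqabs1 (QA a1 a2 a3 a4 w y) <= 64 * K * bqabs1 (w y).
Proof.
move=> h1 h2 h3 h4; set n := bqabs1 (w y); have n0 : 0 <= n by exact: bqabs1_ge0.
have r (p q : H) : bqabs1 p <= n -> bqabs1 q <= K -> bqabs1 (bqmul p q) <= 16 * (K * n).
  move=> hp hq; apply: (le_trans (bqabs1M _ _)); rewrite ler_wpM2l// mulrC.
  by apply: ler_pM; rewrite ?bqabs1_ge0.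
have l (p q : H) : bqabs1 p <= K -> bqabs1 q <= n -> bqabs1 (bqmul p q) <= 16 * (K * n).
  move=> hp hq; apply: (le_trans (bqabs1M _ _)); rewrite ler_wpM2l//.
  by apply: ler_pM; rewrite ?bqabs1_ge0.
have -> : 64 * K * n = 16 * (K * n) + 16 * (K * n) + 16 * (K * n) + 16 * (K * n) by ring.
rewrite /QA.
do 3 (apply: (le_trans (bqabs1D _ _)); apply: lerD; [|by [apply: r; rewrite ?bqabs1_conj|apply: l; rewrite ?bqabs1_conj]]).
exact: r.
Qed.

Lemma powR_sum_le (n : nat) (x : 'I_n.+1 -> R) (p : R) : 0 <= p ->
  (forall j, 0 <= x j) -> (\sum_j x j) `^ p <= n.+1%:R `^ p * \sum_j x j `^ p.
Proof.
move=> p0 x0; have [j _ hj] := @Order.TotalTheory.arg_maxP _ _ 'I_n.+1 ord0 xpredT x isT.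
apply: (@le_trans _ _ ((n.+1%:R * x j) `^ p)).
  apply: (ge0_ler_powR p0); rewrite ?nnegrE ?sumr_ge0 ?mulr_ge0//.
  apply: (@le_trans _ _ (\sum_(i < n.+1) x j)); first by apply: ler_sum => i _; exact: hj.
  by rewrite sumr_const card_ord mulr_natl.
rewrite powRM// ler_wpM2l ?powR_ge0// (bigD1 j)//= lerDl.
by apply: sumr_ge0 => i _; exact: powR_ge0.
Qed.

Lemma leb3_bounded_lty G (L : R) : open G -> (forall y, G y -> sup3 y < L) ->
  (leb3m G < +oo)%E.
Proof.
move=> oG GL; pose I := `[- L, L]%classic : set M.
have mI : measurable I by exact: measurable_itv.
apply: (@le_lt_trans _ _ (leb3m (box3 I I I))).
  apply: le_measure; rewrite ?inE; [exact: open_measurable3|exact: measurable_box3|].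
  move=> y /GL/ltW; rewrite sup3_le => /and3P[].
  by rewrite !ler_norml => h1 h2 h3; rewrite /box3 /I/=; split; [split|]; rewrite /= in_itv.
rewrite leb3_box3//; have : (@lebesgue_measure R I < +oo)%E.
  by rewrite lebesgue_measure_itv/=; case: ifP => // _; rewrite -EFinB ltry.
have : (0 <= @lebesgue_measure R I)%E by [].
by case: (lebesgue_measure I) => //= s _ _; rewrite -!EFinM ltry.
Qed.

Lemma Lp_integral_lty G p u : open G -> 1 <= p -> Lp G p%:E u ->
  (\int[leb3m]_y (bqabs1 (zext G u y) `^ p)%:E < +oo)%E.
Proof.
move=> oG p1 hu; have p0 : 0 <= p by rewrite (le_trans _ p1).
pose x j (y : T3) : R := ((fun x => Normc.normc (u x 0 j)) \_ G) y.
have x0 j y : 0 <= x j y.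
  by rewrite /x /patch; case: ifP => // _; case: (u y 0 j) => a b; exact: sqrtr_ge0.
have mx j : leb3m.-integrable setT (fun y : T3 => (`|x j y| `^ p)%:E).
  by have [_ _ h] := hu j; exact: Lfun_integrable p1 h.
(* The 2 compares [cabs1] with the modulus; 1 + 3 is the number of coordinates in [powR_sum_le]. *)
pose K : R := 2 `^ p * (1 + 3)%:R `^ p; have K0 : 0 <= K by rewrite mulr_ge0 ?powR_ge0.
have ms : leb3m.-integrable setT (fun y : T3 => (K * \sum_j `|x j y| `^ p)%:E).
  under eq_fun do rewrite EFinM -sumEFin.
  by apply: integrableZl => //; apply: integrable_sum.
have/integrableP[_] := ms; apply: le_lt_trans.
apply: ge0_le_integral => //.
- by move=> y _; rewrite lee_fin powR_ge0.
- apply/measurable_EFinP; apply: (measurableT_comp (measurable_powR _)).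
  exact: measH_abs1 (measH_zext oG hu).
- by apply: measurableT_comp => //; have/measurable_int := ms.
move=> y _; rewrite lee_fin ger0_norm; last first.
  by rewrite mulr_ge0// sumr_ge0// => j _; exact: powR_ge0.
apply: (@le_trans _ _ ((2 * \sum_j x j y) `^ p)).
  apply: (ge0_ler_powR p0); rewrite ?nnegrE ?bqabs1_ge0 ?mulr_ge0 ?sumr_ge0//.
  rewrite mulr_sumr; apply: ler_sum => j _; rewrite /zext /x /patch; case: ifP => _.
    exact: cabs1_le_normc.
  by rewrite mxE cabs1_0 mulr0.
rewrite powRM ?sumr_ge0// /K -mulrA ler_wpM2l ?powR_ge0//.
under [X in _ * X]eq_bigr do rewrite ger0_norm//.
exact: powR_sum_le.
Qed.

Lemma Linfty_bound G u : Lp G +oo%E u ->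
  exists2 K, 0 <= K & {ae leb3m, forall y : T3, bqabs1 (zext G u y) <= K}.
Proof.
move=> hu.
pose x j (y : T3) : R := ((fun x => Normc.normc (u x 0 j)) \_ G) y.
have hx j : exists K : R, {ae leb3m, forall y : T3, `|x j y| <= K}.
  have [_ _] := hu j; rewrite inE => /andP[_]; rewrite inE/= /finite_norm unlock/=.
  case: ifPn => [_ h|].
    have h1 := ess_sup_ge leb3m (abse \o (EFin \o x j)).
    move: h h1; rewrite -[X in (X < _)%E]/(ess_sup leb3m (abse \o (EFin \o x j))).
    case: (ess_sup _ _) => [K| |] // _ h.
      by exists K; apply: filterS h => y /=; rewrite lee_fin.
    by exists 0; apply: filterS h => y /=.
  (* The degenerate branch of the definition of the norm, where the whole space is null and any
     bound holds almost everywhere. *)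
  rewrite -leNgt => h; exists 0; exists setT; split => //.
  by apply/eqP; rewrite eq_le; apply/andP; split.
have [K hK] := choice hx.
exists (\sum_j 2 * `|K j|); first by rewrite sumr_ge0.
apply: filterS (ae_forall_fin hK) => y h; apply: ler_sum => j _; apply: (@le_trans _ _ (2 * `|x j y|)); last first.
  by rewrite ler_wpM2l// (le_trans (h j))// ler_norm.
rewrite /zext /x /patch; case: ifP => _.
  by apply: (le_trans (cabs1_le_normc _)); rewrite ler_wpM2l// ler_norm.
by rewrite mxE cabs1_0 mulr_ge0.
Qed.

(** n^q <= 1 + n^p on G, according to whether n <= 1, and G has finite measure. *)
Lemma integral_powR_lty G (n : T3 -> R) (p q : R) : open G -> (leb3m G < +oo)%E ->
  measurable_fun setT n -> (forall y, 0 <= n y) -> (forall y, ~ G y -> n y = 0) ->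
  0 < q <= p -> (\int[leb3m]_y (n y `^ p)%:E < +oo)%E ->
  (\int[leb3m]_y (n y `^ q)%:E < +oo)%E.
Proof.
move=> oG fG mn n0 nG /andP[q0 qp] np.
have mp s : measurable_fun setT (fun y : T3 => (n y `^ s)%:E).
  exact: measurable_EFin_powR mn.
have mG := open_measurable3 oG.
have m1 : measurable_fun setT (fun y : T3 => (\1_G y : R)%:E).
  by apply/measurable_EFinP; exact: measurable_indic.
apply: (@le_lt_trans _ _ (\int[leb3m]_y ((\1_G y)%:E + (n y `^ p)%:E))%E).
  apply: ge0_le_integral => //.
  - by move=> y _; rewrite lee_fin powR_ge0.
  - exact: emeasurable_funD.
  move=> y _; rewrite -EFinD lee_fin indicE.
  have [/set_mem yG|/negP yG] := boolP (y \in G); last first.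
    rewrite nG; last by move=> /mem_set.
    by rewrite (powR0 (lt0r_neq0 q0)) add0r powR_ge0.
  have [n1|n1] := leP (n y) 1.
    rewrite -[leLHS]addr0 lerD ?powR_ge0//.
    rewrite (_ : true%:R = 1 `^ q); last by rewrite powR1.
    by apply: (ge0_ler_powR (ltW q0)); rewrite ?nnegrE.
  by rewrite -[leLHS]add0r lerD// ler_powR// ltW.
rewrite ge0_integralD//; last by move=> y _; rewrite lee_fin powR_ge0.
by rewrite integral_indic// setIT lte_add_pinfty.
Qed.

Lemma partialZ k (f : R3 R -> R) (a : R) x : derivable f x (basis3 R k) ->
  partial k (fun y => f y * a) x = partial k f x * a.
Proof.
move=> df; rewrite /partial (_ : (fun y => _) = a *: f); last first.
  by apply/funext => y; rewrite mulrC.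
by rewrite deriveZ// mulrC.
Qed.

Lemma smoothZ (f : R3 R -> R) (a : R) : smooth f -> smooth (fun y => f y * a).
Proof.
move=> sf; have E s : iter_partial s (fun y => f y * a) = (fun y => iter_partial s f y * a).
  elim: s => [//|k s ih] /=; rewrite ih; apply/funext => x; apply: partialZ.
  by have [_] := sf s; exact.
move=> s; rewrite E; have [cs ds] := sf s; split.
  by move=> x; apply: cvgMl; exact: cs.
move=> k x; rewrite (_ : (fun y => _) = a *: iter_partial s f); first exact: derivableZ.
by apply/funext => y; rewrite mulrC.
Qed.

Lemma bqpart_bqint i G u : bqpart i (bqint G u) = (\int[leb3 R]_(x in G) bqpart i (u x))%R.
Proof. by case: i => j b; rewrite /bqpart /bqint mxE/=; case: b. Qed.

(** The test function is zeta e_m. As zeta is real, its derivatives come out of the products and of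
    the real component. *)
Lemma weakD_part G u v i m (zeta : R3 R -> R) : weakD G u v -> smooth zeta ->
  (exists K, [/\ compact K, K `<=` G & forall x, ~ K x -> zeta x = 0]) ->
  (\int[leb3m]_y (\sum_k bqpart i (bqmul (bqconj (zext G u y)) (bqmul (bqe R k) (bqe R m)))
      * partial k zeta y) =
   \int[leb3m]_y (bqpart i (bqmul (bqconj (zext G v y)) (bqe R m)) * zeta y))%R.
Proof.
move=> [_ _ w] sz [K [cK KG zK]].
pose phi y : H := (zeta y)%:C%C *: bqe R m.
have ReE (x : R) (z : R[i]) : complex.Re (x%:C%C * z) = x * complex.Re z by exact: (cpartZ true).
have ImE (x : R) (z : R[i]) : complex.Im (x%:C%C * z) = x * complex.Im z by exact: (cpartZ false).
have tphi : test_function G phi.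
  split; last by exists K; split => // x /zK zx; rewrite /phi zx scale0r.
  move=> j; split.
    by under eq_fun do rewrite bqZE ReE; exact: smoothZ.
  by under eq_fun do rewrite bqZE ImE; exact: smoothZ.
have dphi k y : dpartial k phi y = (partial k zeta y)%:C%C *: bqe R m.
  have dz : derivable zeta y (basis3 R k) by have [_] := sz [::]; exact.
  apply/rowP => j; rewrite mxE bqZE.
  under eq_fun do rewrite bqZE ReE; under [X in Complex _ (partial _ X _)]eq_fun do rewrite bqZE ImE.
  by rewrite !partialZ//; case: (bqe R m 0 j) => a b; apply/eqP; rewrite eq_complex/= !mul0r subr0 addr0 !eqxx.
have lhsE y : (if y \in G then bqpart i (bqmul (bqconj (u y)) (Dop phi y)) else 0) =
    \sum_k bqpart i (bqmul (bqconj (zext G u y)) (bqmul (bqe R k) (bqe R m))) * partial k zeta y.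
  rewrite /zext; case: ifP => _; last first.
    by rewrite big1// => k _; rewrite bqconj0 bqmul0l bqpart0 mul0r.
  rewrite /Dop bqmul_sumr bqpart_sum; apply: eq_bigr => k _.
  by rewrite dphi bqmulZr bqmulZr bqpartZ mulrC.
have rhsE y : (if y \in G then bqpart i (bqmul (bqconj (v y)) (phi y)) else 0) =
    bqpart i (bqmul (bqconj (zext G v y)) (bqe R m)) * zeta y.
  rewrite /zext; case: ifP => _; last by rewrite bqconj0 bqmul0l bqpart0 mul0r.
  by rewrite /phi bqmulZr bqpartZ mulrC.
have RE (f g : R3 R -> R) : (forall y, (if y \in G then f y else 0) = g y) ->
    (\int[leb3 R]_(x in G) f x)%R = (\int[leb3m]_x g x)%R.
  move=> fg; rewrite /Rintegral integral_mkcond; congr fine.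
  by apply: eq_integral => y _; rewrite -fg /patch; case: ifP.
have wi := congr1 (bqpart i) (w phi tphi).
exact: etrans (esym (etrans (bqpart_bqint i G _) (RE _ _ lhsE)))
  (etrans wi (etrans (bqpart_bqint i G _) (RE _ _ rhsE))).
Qed.

End WeakSolutions.

(** * Local representatives and their gluing *)

Section Regularity.
Variable R : realType.
Local Notation leb3m := (@leb3m R).
Local Notation M := (measurableTypeR R).
Local Notation T3 := (M * M * M)%type.
Local Notation H := (biquaternion R).
Implicit Types (G : set (R3 R)) (u v w : R3 R -> H).

Definition holder_rep (t : R) w (K : set (R3 R)) (h : R3 R -> H) :=
  holder_on K t h /\ {ae leb3m, forall x : T3, K x -> h x = w x}.

(** Any q between max(r, p) and the Sobolev conjugate [ps] of p works: q < [ps] is the second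
    condition, as 1/[ps] = 1/p - 1/3, and q > r is the third, which simplifies to 1/q < 1/r. *)
Lemma bootstrap_exponent (p r : R) : 3 / 2 < p < 3 -> 3 < r < 3 * p / (3 - p) ->
  exists q, [/\ p < q, p^-1 - 3^-1 < q^-1 & (2 + (1 - 3 / r)) * (1 - q^-1)^-1 < 3].
Proof.
move=> /andP[p32 p3] /andP[r3]; set ps := _ / (3 - p) => rp.
have p3' : 0 < 3 - p by rewrite subr_gt0.
have p1 : 1 < p by apply: lt_trans p32; rewrite ltr_pdivlMr//; lra.
have p0 : 0 < p by exact: lt_trans p1.
have pps : p < ps by rewrite /ps ltr_pdivlMr//; nra.
pose q := (Num.max r p + ps) / 2.
have [rq pq qps] : [/\ r < q, p < q & q < ps].
  have h1 : r <= Num.max r p by rewrite le_max lexx.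
  have h2 : p <= Num.max r p by rewrite le_max lexx orbT.
  have h3 : Num.max r p < ps by rewrite gt_max rp.
  rewrite /q; set m := Num.max r p in h1 h2 h3 *; clear -h1 h2 h3.
  by split; [rewrite ltr_pdivlMr//|rewrite ltr_pdivlMr//|rewrite ltr_pdivrMr//]; lra.
have q0 : 0 < q by exact: lt_trans pq.
have r0 : 0 < r by exact: lt_trans r3.
have q1 : 1 < q by exact: lt_trans pq.
exists q; split => //.
  have -> : p^-1 - 3^-1 = ps^-1 by rewrite /ps; field; rewrite !gt_eqF.
  by rewrite ltf_pV2 ?posrE// (lt_trans q0).
have iq : 0 < 1 - q^-1 by rewrite subr_gt0 invf_lt1.
rewrite ltr_pdivrMr//.
have : q^-1 < r^-1 by rewrite ltf_pV2 ?posrE.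
clear; lra.
Qed.

Lemma weak_solution_holder_rep G (L p r : R) a1 a2 a3 a4 w c s :
  open G -> (forall y, G y -> sup3 y < L) -> 3 / 2 < p < 3 -> 3 < r < 3 * p / (3 - p) ->
  Lp G +oo%E a1 -> Lp G +oo%E a2 -> Lp G +oo%E a3 -> Lp G +oo%E a4 ->
  measH (zext G w) -> (\int[leb3m]_y (bqabs1 (zext G w y) `^ p)%:E < +oo)%E ->
  weakD G w (QA a1 a2 a3 a4 w) -> 0 < s -> cball c s `<=` G ->
  exists h, holder_rep (1 - 3 / r) w (cball c s) h.
Proof.
move=> oG GL pp rr; have /andP[p32 p3] := pp; have /andP[r3 rp] := rr.
move=> l1 l2 l3 l4 mw np wD s0 sG.
(* The conjugate of w is what the weak formulation multiplies by D phi; it is undone at the end. *)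
pose V (i : 'I_(1 + 3) * bool) (y : T3) := bqpart i (bqconj (zext G w y)).
pose A i k m (y : T3) := bqpart i (bqmul (bqconj (zext G w y)) (bqmul (bqe R k) (bqe R m))).
pose Q := zext G (QA a1 a2 a3 a4 w).
pose B i m (y : T3) := bqpart i (bqmul (bqconj (Q y)) (bqe R m)).
have mQ : measH Q.
  by rewrite /Q zext_QA; apply: measH_QA => //; exact: measH_zext oG _.
have nE : total_norm V = fun y => bqabs1 (zext G w y).
  by apply/funext => y; rewrite /total_norm sum_bqpart bqabs1_conj.
have mV i : measurable_fun setT (V i) by exact: measH_part (measH_conj mw).
have mA i k m : measurable_fun setT (A i k m).
  exact: measH_part (measH_mul (measH_conj mw) (measH_cst _)).
have mB i m : measurable_fun setT (B i m).
  exact: measH_part (measH_mul (measH_conj mQ) (measH_cst _)).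
have p1 : 1 < p by apply: lt_trans p32; rewrite ltr_pdivlMr//; lra.
have p0 : 0 < p by exact: lt_trans p1.
have in1 : leb3m.-integrable setT (EFin \o total_norm V).
  have mn : measurable_fun setT (total_norm V) by exact: measurable_total_norm.
  apply/integrableP; split; first by apply/measurable_EFinP.
  have n0 y : 0 <= total_norm V y by exact: total_norm_ge0.
  have nG y : ~ G y -> total_norm V y = 0.
    move=> yG; rewrite nE zextN// /bqabs1 big1// => j _; by rewrite mxE cabs1_0.
  have := @integral_powR_lty _ G (total_norm V) p 1 oG (leb3_bounded_lty oG GL) mn n0 nG.
  rewrite ltr01 (ltW p1) nE => /(_ isT np); apply: le_lt_trans.
  apply/le_of_eq/eq_integral => y _ /=.
  by rewrite powRr1 ?bqabs1_ge0// ger0_norm ?bqabs1_ge0.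
have [K1 K10 hK1] := Linfty_bound l1; have [K2 K20 hK2] := Linfty_bound l2.
have [K3 K30 hK3] := Linfty_bound l3; have [K4 K40 hK4] := Linfty_bound l4.
(* Each product costs a factor 16 by [bqabs1M]. There are two products in [A]; in [B] there is one,
   applied to [Q], itself bounded by 64 K times the norm of w. *)
pose K := K1 + K2 + K3 + K4; pose Cn := 16 * 16 + 16 * 64 * K.
have K0 : 0 <= K by rewrite !addr_ge0.
have Cn0 : 0 <= Cn by apply: addr_ge0; apply: mulr_ge0 => //; exact: mulr_ge0.
have dom i : {ae leb3m, forall y : T3, `|V i y| <= Cn * total_norm V y /\
    (forall k m, `|A i k m y| <= Cn * total_norm V y) /\
    forall m, `|B i m y| <= Cn * total_norm V y}.
  apply: filterS2 (filterI hK1 hK2) (filterI hK3 hK4) => y [h1 h2] [h3 h4].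
  rewrite nE; set n := bqabs1 _; have n0 : 0 <= n by exact: bqabs1_ge0.
  have Kn : 0 <= K * n by rewrite mulr_ge0.
  have -> : Cn * n = 16 * 16 * n + 16 * 64 * (K * n) by rewrite /Cn; ring.
  have e1 := bqabs1_bqe R.
  split; last split.
  - apply: (le_trans (bqpart_le _ _)); rewrite bqabs1_conj -/n; lra.
  - move=> k m; apply: (le_trans (bqpart_le _ _)); apply: (le_trans (bqabs1M _ _)).
    rewrite bqabs1_conj -/n.
    have h : bqabs1 (bqmul (bqe R k) (bqe R m)) <= 16.
      by apply: (le_trans (bqabs1M _ _)); rewrite !e1 !mulr1.
    have := ler_wpM2l n0 h; lra.
  move=> m; apply: (le_trans (bqpart_le _ _)); apply: (le_trans (bqabs1M _ _)).
  rewrite bqabs1_conj e1 mulr1.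
  have : bqabs1 (Q y) <= 64 * K * n.
    rewrite /Q zext_QA; apply: bqabs1_QA_le; rewrite /K.
    - by apply: (le_trans h1); rewrite -!addrA lerDl !addr_ge0.
    - by apply: (le_trans h2); rewrite -addrA addrAC lerDr !addr_ge0.
    - by apply: (le_trans h3); rewrite addrAC lerDr !addr_ge0.
    - by apply: (le_trans h4); rewrite lerDr !addr_ge0.
  lra.
have clifford i k m y : A i k m y + A i m k y = - (2 * (k == m)%:R) * V i y.
  rewrite /A /V -bqpartD bqe_mulD -bqpartZ; congr (bqpart _ (_ *: _)).
  by rewrite rmorphN rmorphM /= !rmorph_nat.
have weak i m zeta sz hz := @weakD_part _ G w _ i m zeta wD sz hz.
(* Three concentric balls: integrability is gained from s2 to s1, Hoelder continuity from s1 to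
   s. *)
have [s1 ss1 s1G] := cball_enlarge oG (ltW s0) sG.
have s10 := lt_trans s0 ss1.
have [s2 ss2 s2G] := cball_enlarge oG (ltW s10) s1G.
have [q [pq pq3 tq]] := bootstrap_exponent pp rr.
have r0 : 0 < r by exact: lt_trans r3.
have np2 : (\int[leb3m]_(y in cball c s2) (total_norm V y `^ p)%:E < +oo)%E.
  apply: le_lt_trans np; rewrite nE; apply: ge0_subset_integral => //.
  - exact: measurable_cball.
  - apply/measurable_EFinP; apply: (measurableT_comp (measurable_powR _)).
    exact: measH_abs1.
  - by move=> y _; rewrite lee_fin powR_ge0.
have nq := bootstrap_lebesgue GL Cn0 mV mA mB in1 dom clifford weak s10 ss2 s2G p1 (ltW pq) pq3 np2.
pose t := 1 - 3 / r.
have t01 : 0 <= t <= 1.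
  have h : 0 <= 3 / r <= 1.
    by rewrite divr_ge0 ?(ltW r0)//= ler_pdivrMr// mul1r ltW.
  by move/andP: h => [h1 h2]; rewrite /t lerBlDr lerDl h1 subr_ge0 h2.
have q1 : 1 < q by exact: lt_trans pq.
have /choice[h hh] := bootstrap_hoelder GL Cn0 mV mA mB in1 dom clifford weak s0 ss1 s1G t01 q1 tq nq.
have [C hC] := choice (fun i => (hh i).1).
pose hc x : H := \row_j (h (j, true) x +i* h (j, false) x)%C.
exists (fun x => bqconj (hc x)); split.
  exists (\sum_i C i) => x y xs ys; rewrite -bqconjB.
  apply: (le_trans (bqnorm_le_bqabs1 _)); rewrite bqabs1_conj -sum_bqpart mulr_suml.
  apply: ler_sum => i _; apply: le_trans (hC i x y xs ys).
  have -> : hc x - hc y = hc x + (-1)%:C%C *: hc y by rewrite rmorphN rmorph1 scaleN1r.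
  by rewrite bqpartD bqpartZ mulN1r /hc !(bqpart_row i (fun i => h i _)).
apply: filterS (ae_forall_fin (fun i => (hh i).2)) => x hx xs; rewrite -[RHS]bqconjK; congr bqconj.
apply: bqpart_inj => i; rewrite /hc (bqpart_row i (fun i => h i x)) hx//.
by rewrite /V zextT//; exact: sG.
Qed.

(** The ball contains a cube of half-side d = s/3, because 3 d^2 < 9 d^2 = s^2. *)
Lemma leb3_eball_gt0 c (s : R) : 0 < s -> (0 < leb3m (eball c s))%E.
Proof.
move=> s0; pose d := s / 3; have d0 : 0 < d by rewrite divr_gt0.
pose I (a : R) := `]a - d, a + d[%classic : set M.
have mI a : measurable (I a) by exact: measurable_itv.
apply: (@lt_le_trans _ _ (leb3m (box3 (I c.1.1) (I c.1.2) (I c.2)))).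
  rewrite leb3_box3// /I !lebesgue_measure_itv/= !lte_fin.
  have h (a : R) : a - d < a + d by lra.
  by rewrite !h -!EFinB -!EFinM lte_fin; apply: mulr_gt0; [apply: mulr_gt0|]; rewrite subr_gt0.
apply: le_measure; rewrite ?inE; [exact: measurable_box3|by apply: open_measurable3; exact: eball_open|].
have sq (a b : R) : I a b -> (b - a) ^+ 2 <= d ^+ 2.
  rewrite /I/= in_itv/= => /andP[h1 h2]; rewrite -real_normK ?num_real//.
  by apply: lerXn2r; rewrite ?nnegrE ?(ltW d0)// ler_norml; apply/andP; split; lra.
move=> y [[/= /sq h1 /sq h2] /sq h3]; rewrite /eball/= enormE.
rewrite -[ltRHS]gtr0_norm// -sqrtr_sqr ltr_sqrt ?exprn_gt0//.
have -> : s = 3 * d by rewrite /d; field.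
rewrite /nsq3 !big_ord_recl big_ord0 addr0 /coord3 /=.
have : 0 < d ^+ 2 by rewrite exprn_gt0.
rewrite (_ : (3 * d) ^+ 2 = 9 * d ^+ 2); last by ring.
lra.
Qed.

Lemma bqabs1_le_bqnorm (p : H) : bqabs1 p <= 8 * bqnorm p.
Proof.
have n0 (z : R[i]) : 0 <= Normc.normc z by case: z => a b; exact: sqrtr_ge0.
apply: (@le_trans _ _ (\sum_(j < 1 + 3) 2 * bqnorm p)); last first.
  by rewrite sumr_const card_ord -mulr_natl; apply: le_of_eq; ring.
apply: ler_sum => j _; apply: (le_trans (cabs1_le_normc _)); rewrite ler_wpM2l//.
rewrite -[leLHS]ger0_norm// -sqrtr_sqr /bqnorm ler_sqrt ?sumr_ge0// => [|k _]; last exact: sqr_ge0.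
by rewrite (bigD1 j)//= lerDl sumr_ge0// => k _; exact: sqr_ge0.
Qed.

Lemma eball_center (x : R3 R) (s : R) : 0 < s -> eball x s x.
Proof.
by move=> s0; rewrite /eball/= subrr enorm0.
Qed.

(** If the values at x differed, continuity would keep them different on a ball around x. But both
    functions equal w almost everywhere there, and the ball has positive measure. *)
Lemma holder_rep_unique (t : R) w c1 s1 h1 c2 s2 h2 x : 0 < t ->
  holder_rep t w (cball c1 s1) h1 -> holder_rep t w (cball c2 s2) h2 ->
  eball c1 s1 x -> eball c2 s2 x -> h1 x = h2 x.
Proof.
move=> t0 [[C1 hC1] w1] [[C2 hC2] w2] x1 x2.
apply/eqP; apply/negPn/negP => hx.
have D0 : 0 < bqabs1 (h1 x - h2 x).
  by apply: lt_le_trans (bqnorm_le_bqabs1 _); apply: bqnorm_gt0; rewrite subr_eq0.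
(* Within distance [eta] of x the difference changes by at most K D / (2 K) = D / 2 in the norm
   [bqabs1], where 8 is the cost of passing from [bqnorm]. The 1 keeps K positive. *)
set D := bqabs1 _ in D0; pose K := 8 * (`|C1| + `|C2|) + 1.
have K0 : 0 < K by rewrite ltr_wpDl// mulr_ge0// addr_ge0.
have DK : 0 < D / (2 * K) by apply: divr_gt0 => //; exact: mulr_gt0.
pose eta := (D / (2 * K)) `^ t^-1; have eta0 : 0 < eta by exact: powR_gt0.
have etat : eta `^ t = D / (2 * K) by rewrite -powRrM mulVf ?gt_eqF// powRr1// ltW.
pose d := Num.min eta (Num.min (s1 - enorm (x - c1)) (s2 - enorm (x - c2))).
have d0 : 0 < d by rewrite !lt_min eta0 !subr_gt0 x1 x2.
have dsub y c s : enorm (x - c) < s -> d <= s - enorm (x - c) -> eball x d y -> cball c s y.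
  move=> xs ds yd; rewrite /cball/= (_ : y - c = (y - x) + (x - c)); last by rewrite addrA subrK.
  by rewrite (le_trans (enorm_tri _ _))// -lerBrDr ltW// (lt_le_trans yd).
have y1 y : eball x d y -> cball c1 s1 y by apply: dsub => //; rewrite !ge_min lexx !orbT.
have y2 y : eball x d y -> cball c2 s2 y by apply: dsub => //; rewrite !ge_min lexx !orbT.
have neq y : eball x d y -> h1 y != h2 y.
  move=> yd; apply/negP => /eqP E.
  have xy : enorm (x - y) `^ t <= D / (2 * K).
    rewrite -etat; apply: (ge0_ler_powR (ltW t0)); rewrite ?nnegrE ?enorm_ge0 ?(ltW eta0)//.
    by rewrite -enormN opprB ltW// (lt_le_trans yd)// ge_min lexx.
  have e1 := hC1 _ _ (ltW x1 : cball c1 s1 x) (y1 _ yd).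
  have e2 := hC2 _ _ (ltW x2 : cball c2 s2 x) (y2 _ yd).
  have b (C : R) p : bqnorm p <= C * enorm (x - y) `^ t -> bqabs1 p <= 8 * (`|C| * (D / (2 * K))).
    move=> hp; apply: (le_trans (bqabs1_le_bqnorm _)); rewrite ler_wpM2l//.
    apply: (le_trans hp); apply: (@le_trans _ _ (`|C| * enorm (x - y) `^ t)).
      by rewrite ler_wpM2r ?powR_ge0// ler_norm.
    by rewrite ler_wpM2l.
  have : D <= K * (D / (2 * K)).
    rewrite [leLHS](_ : D = bqabs1 ((h1 x - h1 y) + (h2 y - h2 x))); last by rewrite E addrA subrK.
    apply: (le_trans (bqabs1D _ _)).
    have -> : bqabs1 (h2 y - h2 x) = bqabs1 (h2 x - h2 y).
      by apply: eq_bigr => j _; rewrite -cabs1N !bqBE opprB.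
    apply: (le_trans (lerD (b _ _ e1) (b _ _ e2))).
    move: DK; set X := _ / (2 * K) => DK.
    have -> : K * X = 8 * (`|C1| * X) + 8 * (`|C2| * X) + X by rewrite {1}/K; ring.
    by rewrite lerDl ltW.
  apply/negP; rewrite -ltNge (_ : K * _ = D / 2); last by field; rewrite gt_eqF.
  by rewrite ltr_pdivrMr//; lra.
have N : leb3m.-negligible (eball x d).
  have : {ae leb3m, forall y : T3, ~ eball x d y}.
    apply: filterS2 w1 w2 => y g1 g2 yd; have := neq y yd.
    by rewrite g1 ?g2 ?eqxx//; [exact: y2|exact: y1].
  by apply: negligibleS => y /= yd; exact.
have := leb3_eball_gt0 x d0.
have md : @measurable _ T3 (eball x d) by apply: open_measurable3; exact: eball_open.
by rewrite (measure_negligible md N) ltxx.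
Qed.

(** The value at x is read off a representative chosen on a ball centred at x; by uniqueness it
    agrees with every representative on an open ball containing x. *)
Lemma holder_rep_glue (t : R) w G : 0 < t -> open G ->
  (forall c s, 0 < s -> cball c s `<=` G -> exists h, holder_rep t w (cball c s) h) ->
  ae_class G (Cbloc G t) w.
Proof.
move=> t0 oG loc.
have rad x : exists sh : R * (R3 R -> H), G x ->
    [/\ 0 < sh.1, cball x sh.1 `<=` G & holder_rep t w (cball x sh.1) sh.2].
  have [Gx|nGx] := pselect (G x); last by exists (0, w).
  have xG : cball x 0 `<=` G.
    move=> y /= y0; have /enorm_eq0/eqP : enorm (y - x) = 0.
      by apply/eqP; rewrite eq_le y0 enorm_ge0.
    by rewrite subr_eq0 => /eqP ->.
  have [s s0 sG] := cball_enlarge oG (lexx _) xG.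
  by have [h hh] := loc _ _ s0 sG; exists (s, h).
have [f hf] := choice rad; pose v x := (f x).2 x.
have vE c s h x : cball c s `<=` G -> holder_rep t w (cball c s) h -> eball c s x -> v x = h x.
  move=> sG hh xs; have Gx : G x by apply: sG; exact: ltW.
  have [f0 _ fh] := hf x Gx.
  exact: holder_rep_unique t0 fh hh (eball_center x f0) xs.
exists v.
  move=> c s s0 [_]; rewrite closure_eball// => sG.
  (* Uniqueness holds in open balls only, whereas the estimate is asked up to the boundary, hence
     the larger ball. *)
  have [s' ss' s'G] := cball_enlarge oG (ltW s0) sG.
  have [h hh] := loc _ _ (lt_trans s0 ss') s'G.
  have [[C hC] _] := hh; exists C => x y xs ys.
  have xs' : eball c s' x by exact: le_lt_trans ss'.
  have ys' : eball c s' y by exact: le_lt_trans ss'.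
  by rewrite (vE _ _ _ _ s'G hh xs') (vE _ _ _ _ s'G hh ys'); apply: hC; exact: ltW.
pose Q (U : set (R3 R)) := {ae leb3m, forall x : T3, U x -> w x = v x}.
have [||x Gx|F [hF GF]] := @lindelof3 R G Q.
- by apply: aeW => x [].
- move=> U V UV; apply: (@filterS _ _ (ae_filter_ringOfSetsType leb3m)) => x h /UV.
  exact: h.
- have [f0 fG fh] := hf x Gx; exists (eball x (f x).1).
    by apply: open_nbhs_nbhs; split; [exact: eball_open|exact: eball_center].
  have [_ +] := fh; apply: filterS => y hy ys.
  by rewrite (vE _ _ _ _ fG fh ys) hy//; exact: ltW.
have : {ae leb3m, forall x : T3, forall n, F n x -> w x = v x}.
  by apply: ae_foralln => n; have [_] := hF n.
by apply: filterS => x hx /GF[n _]; exact: hx.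
Qed.

Lemma weak_solution_regular G (p q r : R) a1 a2 a3 a4 :
  liapunov_domain G -> 3 / 2 < q < 3 -> q <= p -> 3 < r < 3 * q / (3 - q) ->
  Lp G +oo%E a1 -> Lp G +oo%E a2 -> Lp G +oo%E a3 -> Lp G +oo%E a4 ->
  VA G p a1 a2 a3 a4 `<=` ae_class G (Cbloc G (1 - 3 / r)).
Proof.
move=> [_ oG _ [N [_ bG]] _] qq qp rr l1 l2 l3 l4 w [wp wD].
(* Boundedness gives |y| <= M, in the sup norm, for every M > N; N + 1 is such an M, and the further
   1 makes the inequality strict. *)
pose L := N + 2; have GL y : G y -> sup3 y < L.
  move=> Gy; have : `|y| <= N + 1 by apply: (bG (N + 1)) => //; rewrite ltrDl.
  by move/le_lt_trans; apply; rewrite /L ltrD2l ltr1n.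
have q0 : 0 < q by case/andP: qq => h _; apply: lt_trans h; rewrite divr_gt0.
have p1 : 1 <= p.
  by case/andP: qq => h _; apply: le_trans qp; apply: ltW; apply: lt_trans h; rewrite ltr_pdivlMr//; lra.
have mw := measH_zext oG wp.
have nq : (\int[leb3m]_y (bqabs1 (zext G w y) `^ q)%:E < +oo)%E.
  apply: (integral_powR_lty oG (leb3_bounded_lty oG GL) (measH_abs1 mw) (p := p)).
  - by move=> y; exact: bqabs1_ge0.
  - by move=> y yG; rewrite zextN// /bqabs1 big1// => j _; rewrite mxE cabs1_0.
  - by rewrite q0.
  - exact: Lp_integral_lty.
apply: holder_rep_glue => //.
  case/andP: rr => r3 _; have r0 : 0 < r by exact: lt_trans r3.
  by rewrite subr_gt0 ltr_pdivrMr// mul1r.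
by move=> c s s0 sG; exact: weak_solution_holder_rep oG GL qq rr l1 l2 l3 l4 mw nq wD s0 sG.
Qed.

End Regularity.

Theorem corollary12 (R : realType) (G : set (R3 R)) (p : R)
    (a1 a2 a3 a4 : R3 R -> biquaternion R) :
  liapunov_domain G ->
  3 / 2 < p ->
  Lp G +oo%E a1 -> Lp G +oo%E a2 -> Lp G +oo%E a3 -> Lp G +oo%E a4 ->
  (p < 3 -> forall r : R, 3 < r -> r < 3 * p / (3 - p) ->
     VA G p a1 a2 a3 a4 `<=` ae_class G (Cbloc G (1 - 3 / r)))
  /\
  (3 <= p -> forall r : R, 3 < r ->
     VA G p a1 a2 a3 a4 `<=` ae_class G (Cbloc G (1 - 3 / r))).
Proof.
move=> GD p32 l1 l2 l3 l4; split => [p3 r r3 rp|p3 r r3].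
  by apply: (@weak_solution_regular R G p p r) => //; apply/andP.
(* The exponent whose Sobolev conjugate is r + 1. *)
pose q := 3 * (r + 1) / (r + 4).
have r4 : 0 < r + 4 by lra.
have q32 : 3 / 2 < q by rewrite /q ltr_pdivlMr//; lra.
have q3 : q < 3 by rewrite /q ltr_pdivrMr//; lra.
have qr : 3 * q / (3 - q) = r + 1.
  have q30 : 3 - q != 0 by rewrite subr_eq0 gt_eqF.
  by apply: (canLR (mulfK q30)); rewrite /q; field; rewrite gt_eqF.
apply: (@weak_solution_regular R G p q r) => //; first by apply/andP.
  by apply: le_trans p3; exact: ltW.
by rewrite r3 qr ltrDl ltr01.
Qed.
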